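(* Let $(\Gamma,E,G,M)$ be a VB-groupoid with core $C$. Choose a splitting $\sigma\colon s^!E\to\Gamma$ of the short exact sequence $0\to t^!C\to\Gamma\to s^!E\to0$ of vector bundles over $G$ such that $\sigma(e,1_x)=1_e\in\Gamma$ for all $x\in M$ and $e\in E_x$. Let $W_\bullet\Gamma$ be the simplicial manifold obtained by the bar construction from $\Gamma$ viewed as a double Lie groupoid. Then, for $r>0$, the $r$-th layer $W_r\Gamma$ is diffeomorphic to \[ \left\{\left.\begin{pmatrix} g_0 & g_1 & g_2 & \dots & g_{r-1} & \\ & c_{1,1} & c_{1,2} & \dots & c_{1,r-1} & e_1 \\ & & c_{2,2} & \dots & c_{2,r-1} & e_2 \\ & & & \ddots & \vdots & \vdots \\ & & & & c_{r-1,r-1} & e_{r-1} \\ & & & & & e_r \end{pmatrix} \right| \begin{aligned} s(g_{j}) &= t(g_{j+1}) && \forall\, 0 \leq j < r-1\\ q_C(c_{i,j}) &= t(g_{j}) && \forall\, 1 \leq i \leq j < r \\ q(e_i) &= s(g_{r-1}) && \forall\, 1 \leq i \leq r \end{aligned} \right\} \] (with $g_j\in G$, $c_{i,j}\in C$, $e_i\in E$), as a smooth embedded submanifold of $G^{(r)} \times E^{(r)} \times C^{(r-1)} \times C^{(r-2)} \times \dots \times C^{(1)}$.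
   Context: VB-groupoids. A VB-groupoid $(\Gamma,E,G,M)$ consists of a Lie groupoid $G\rightrightarrows M$ (source $s$, target $t$, units $1_x$), a Lie groupoid $\Gamma\rightrightarrows E$ (source $\tilde s$, target $\tilde t$, units $1_e$), and vector bundles $q_\Gamma\colon\Gamma\to G$, $q\colon E\to M$ such that all structure maps (source, target, multiplication, inversion, unit) of $\Gamma\rightrightarrows E$ are vector bundle morphisms over the corresponding structure maps of $G\rightrightarrows M$; $\tilde s$ is fibrewise surjective. The core is the vector bundle $q_C\colon C\to M$, $C:=\ker(\tilde s)|_M$ (restriction of $\ker\tilde s\to G$ to the units $M\subseteq G$). There is a short exact sequence of vector bundles over $G$ \[0\to t^!C\to\Gamma\to s^!E\to0,\] where the first map is $(c,g)\mapsto c\cdot 0_g$ (for $q_C(c)=t(g)$, $0_g$ the zero of $\Gamma_g$, product in $\Gamma\rightrightarrows E$) and the second is $\gamma\mapsto(\tilde s(\gamma),q_\Gamma(\gamma))$; here $t^!C$, $s^!E$ denote pullback vector bundles. A splitting is a vector bundle morphism $\sigma\colon s^!E\to\Gamma$ over $\mathrm{id}_G$ that is a right inverse of the second map. A vector bundle is a Lie groupoid over its base with source $=$ target $=$ projection and fibrewise addition as multiplication. In this way a VB-groupoid is a double Lie groupoid with horizontal side $G$ and vertical side $H:=E$: the structure $\Gamma\rightrightarrows G$ has $s_G=t_G=q_\Gamma$ with addition as multiplication, and $\Gamma\rightrightarrows E$ has $s_H=\tilde s$, $t_H=\tilde t$. $G^{(r)}$ is the manifold of composable $r$-tuples in $G$;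 $E^{(r)}$ and $C^{(j)}$ are accordingly the $r$-fold, resp. $j$-fold, fibre products over $M$ (the factor $C^{(j)}$ contains the column $(c_{1,j},\dots,c_{j,j})$). Bar construction, layers. For a double Lie groupoid $(\Gamma,G,H,M)$: $W_0\Gamma=M$; $W_1\Gamma=\{(g,h)\in G\times H\mid s(g)=t(h)\}$; for $r\ge2$, $W_r\Gamma$ is the set of $(g,(\gamma_{i,j})_{1\le i\le j<r},h)\in G\times\Gamma^{r(r-1)/2}\times H$ with $s(g)=t(t_G(\gamma_{1,1}))$; $s_H(\gamma_{i,j})=t_H(\gamma_{i,j+1})$ for $1\le i\le j<r-1$; $s_G(\gamma_{i,j})=t_G(\gamma_{i+1,j})$ for $1\le i<j<r$; $t(h)=s(s_H(\gamma_{r-1,r-1}))$; it is an embedded submanifold of $G\times\Gamma^{r(r-1)/2}\times H$. For $H=E$, $s(h)=t(h)=q(h)$. *)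

(* Defs.v *)
(* MathComp-Analysis; the scalars are an arbitrary R : realType. *)
From mathcomp Require Import all_boot all_order all_algebra.
From mathcomp Require Import all_classical all_reals all_analysis.
Import Order.TTheory GRing.Theory Num.Theory.
Import numFieldNormedType.Exports.

Set Implicit Arguments.
Unset Strict Implicit.
Unset Printing Implicit Defensive.

Local Open Scope classical_set_scope.
Local Open Scope ring_scope.

(** * Smooth manifolds

  A manifold is a set with an atlas, whose topology is the one induced by the
  atlas, and submersions and submanifolds are defined by adapted charts (as in
  Lang, Fundamentals of Differential Geometry, II.1 and II.2).  The dimension
  is locally constant.

  The data of a set with charts (atlas_space) is kept apart from the axioms
  (is_manifold), so that products and subsets of manifolds can be formed before
  one knows that they are manifolds. *)

Section Smooth.
Variable R : realType.

Fixpoint continuously_differentiable (k m n : nat) (U : set 'rV[R]_m)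
    (f : 'rV[R]_m -> 'rV[R]_n) : Prop :=
  match k with
  | 0 => forall x, U x -> {for x, continuous f}
  | k'.+1 => (forall x, U x -> differentiable f x) /\
      (forall v, continuously_differentiable k' U (fun x => 'D_v f x))
  end.

Definition smooth_on (m n : nat) (U : set 'rV[R]_m)
    (f : 'rV[R]_m -> 'rV[R]_n) : Prop :=
  open U /\ forall k, continuously_differentiable k U f.

(* Only the values of chart_map on chart_dom matter. *)
Record chart (T : Type) := Chart {
  chart_dim : nat;
  chart_dom : set T;
  chart_map :> T -> 'rV[R]_chart_dim }.

Record atlas_space := AtlasSpace {
  points :> Type;
  atlas : set (chart points) }.

(* The transition map c' o c^-1 is defined on an open set and smooth. *)
Definition smooth_transition (T : Type) (c c' : chart T) : Prop :=
  exists h : 'rV[R]_(chart_dim c) -> 'rV[R]_(chart_dim c'),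
    smooth_on (c @` (chart_dom c `&` chart_dom c')) h /\
    forall x, chart_dom c x -> chart_dom c' x -> c' x = h (c x).

Definition chart_axiom (T : Type) (c : chart T) : Prop :=
  open (c @` chart_dom c) /\
  forall x y, chart_dom c x -> chart_dom c y -> c x = c y -> x = y.

Definition atlas_open (X : atlas_space) (W : set X) : Prop :=
  forall c, atlas c -> open (c @` (chart_dom c `&` W)).

Definition atlas_hausdorff (X : atlas_space) : Prop :=
  forall x y : X, x <> y -> exists U V : set X,
    [/\ atlas_open U, atlas_open V, U x, V y & U `&` V = set0].

Definition atlas_second_countable (X : atlas_space) : Prop :=
  exists B : nat -> set X, (forall n, atlas_open (B n)) /\
    forall W : set X, atlas_open W ->
    forall x, W x -> exists2 n, B n x & B n `<=` W.

Definition is_manifold (X : atlas_space) : Prop :=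
  [/\ forall x : X, exists2 c, atlas c & chart_dom c x,
      forall c : chart X, atlas c -> chart_axiom c,
      forall c c' : chart X, atlas c -> atlas c' -> smooth_transition c c',
      atlas_hausdorff X & atlas_second_countable X].

Record manifold := Manifold {
  manifold_space :> atlas_space;
  manifoldP : is_manifold manifold_space }.

(* The charts of the maximal atlas. *)
Definition admissible (X : atlas_space) (c : chart X) : Prop :=
  chart_axiom c /\
  forall c', atlas c' -> smooth_transition c c' /\ smooth_transition c' c.

Definition smooth_at (X Y : atlas_space) (f : X -> Y) (p : X) : Prop :=
  exists (c : chart X) (c' : chart Y) (N : set X)
      (h : 'rV[R]_(chart_dim c) -> 'rV[R]_(chart_dim c')),
    [/\ atlas c, atlas c', atlas_open N & N p] /\
    [/\ N `<=` chart_dom c, forall x, N x -> chart_dom c' (f x),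
        smooth_on (c @` N) h & forall x, N x -> c' (f x) = h (c x)].

Definition smooth_map (X Y : atlas_space) (f : X -> Y) : Prop :=
  forall p, smooth_at f p.

Definition diffeomorphic (X Y : atlas_space) : Prop :=
  exists (f : X -> Y) (g : Y -> X),
    [/\ smooth_map f, smooth_map g, cancel f g & cancel g f].

Definition submersion (X Y : atlas_space) (f : X -> Y) : Prop :=
  forall p : X, exists (k l : nat) (U : set X) (phi : X -> 'rV[R]_(k + l))
      (V : set Y) (psi : Y -> 'rV[R]_k),
    [/\ admissible (Chart U phi), admissible (Chart V psi) & U p] /\
    forall x, U x -> V (f x) /\ psi (f x) = lsubmx (phi x).

Definition slice_chart (X : atlas_space) (S : set X) (k l : nat) (U : set X)
    (phi : X -> 'rV[R]_(k + l)) : Prop :=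
  admissible (Chart U phi) /\ forall x, U x -> (S x <-> rsubmx (phi x) = 0).

Definition embedded_submanifold (X : atlas_space) (S : set X) : Prop :=
  forall p, S p -> exists (k l : nat) (U : set X) (phi : X -> 'rV[R]_(k + l)),
    slice_chart S U phi /\ U p.

(* The structure induced on S by its slice charts; a manifold if S is an
   embedded submanifold of a manifold X. *)
Definition induced_space (X : atlas_space) (S : set X) : atlas_space :=
  {| points := set_type S;
     atlas := [set c | exists (k l : nat) (U : set X)
                           (phi : X -> 'rV[R]_(k + l)),
       slice_chart S U phi /\
       c = Chart (fun p : set_type S => U (val p))
                 (fun p : set_type S => lsubmx (phi (val p)))] |}.

Definition incl (X : atlas_space) (S : set X) (p : induced_space S) : X :=
  val (p : set_type S).

Definition euclidean (n : nat) : atlas_space :=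
  {| points := 'rV[R]_n; atlas := [set Chart setT (id : 'rV[R]_n -> _)] |}.

Definition prod_space (X Y : atlas_space) : atlas_space :=
  {| points := (X * Y)%type;
     atlas := [set c | exists (a : chart X) (b : chart Y),
       [/\ atlas a, atlas b &
       c = Chart (chart_dom a `*` chart_dom b)
                 (fun p : X * Y => row_mx (a p.1) (b p.2))]] |}.

Definition pi_space (I : finType) (X : I -> atlas_space) : atlas_space :=
  {| points := forall i, X i;
     atlas := [set c | exists a : forall i, chart (X i),
       (forall i, atlas (a i)) /\
       c = Chart [set x : forall i, X i | forall i, chart_dom (a i) (x i)]
                 (fun x : forall i, X i => \mxrow_(k < #|I|)
                    a (enum_val k) (x (enum_val k)))] |}.

Definition power_space (I : finType) (X : atlas_space) : atlas_space :=
  pi_space (fun _ : I => X).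

(** * Vector bundles

  vb_add e e' is the sum in the fibre if e and e' lie in the same fibre, and is
  unspecified otherwise.  The vector space axioms hold in each fibre because of
  the local trivialisations, which are fibrewise bijective and linear. *)

Record vector_bundle (E M : atlas_space) := VectorBundle {
  vb_proj :> E -> M;
  vb_zero : M -> E;
  vb_add : E -> E -> E;
  vb_scale : R -> E -> E;
  vb_proj_smooth : smooth_map vb_proj;
  vb_proj_zero : forall x, vb_proj (vb_zero x) = x;
  vb_proj_add : forall e e', vb_proj e = vb_proj e' ->
    vb_proj (vb_add e e') = vb_proj e;
  vb_proj_scale : forall a e, vb_proj (vb_scale a e) = vb_proj e;
  (* e |-> (vb_proj e, phi e) is a diffeomorphism from the part of E over U to
     U x R^n, with inverse psi. *)
  vb_locally_trivial : forall x : M,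
    exists (U : set M) (n : nat) (phi : E -> euclidean n)
        (psi : prod_space M (euclidean n) -> E),
      [/\ atlas_open U, U x,
          forall e, U (vb_proj e) -> smooth_at phi e &
          forall p, U p.1 -> smooth_at psi p] /\
      [/\ forall e, U (vb_proj e) -> psi (vb_proj e, phi e) = e,
          forall y v, U y -> vb_proj (psi (y, v)) = y /\ phi (psi (y, v)) = v,
          forall y, U y -> phi (vb_zero y) = 0 :> 'rV[R]_n,
          forall e e', U (vb_proj e) -> vb_proj e = vb_proj e' ->
            phi (vb_add e e') = (phi e : 'rV[R]_n) + phi e' &
          forall a e, U (vb_proj e) ->
            phi (vb_scale a e) = a *: (phi e : 'rV[R]_n)] }.

(* F is fibrewise linear over f. *)
Definition linear_over (E M E' M' : atlas_space) (B : vector_bundle E M)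
    (B' : vector_bundle E' M') (f : M -> M') (F : E -> E') : Prop :=
  [/\ forall e, B' (F e) = f (B e),
      forall e e', B e = B e' -> F (vb_add B e e') = vb_add B' (F e) (F e') &
      forall a e, F (vb_scale B a e) = vb_scale B' a (F e)].

Definition vb_morphism (E M E' M' : atlas_space) (B : vector_bundle E M)
    (B' : vector_bundle E' M') (f : M -> M') (F : E -> E') : Prop :=
  [/\ smooth_map F, smooth_map f & linear_over B B' f F].

(** * Lie groupoids

  The product gr_mul g h is meaningful if gr_src g = gr_tgt h, and is
  unspecified otherwise. *)

Definition composable (G M : atlas_space) (s t : G -> M) :
    set (prod_space G G) :=
  [set p : G * G | s p.1 = t p.2].

Record lie_groupoid (G M : atlas_space) := LieGroupoid {
  gr_src : G -> M;
  gr_tgt : G -> M;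
  gr_unit : M -> G;
  gr_inv : G -> G;
  gr_mul : G -> G -> G;
  gr_src_submersion : submersion gr_src;
  gr_tgt_submersion : submersion gr_tgt;
  gr_src_smooth : smooth_map gr_src;
  gr_tgt_smooth : smooth_map gr_tgt;
  gr_unit_smooth : smooth_map gr_unit;
  gr_inv_smooth : smooth_map gr_inv;
  gr_mul_smooth : smooth_map
    (fun p : induced_space (composable gr_src gr_tgt) =>
       gr_mul (incl p).1 (incl p).2);
  gr_src_unit : forall x, gr_src (gr_unit x) = x;
  gr_tgt_unit : forall x, gr_tgt (gr_unit x) = x;
  gr_src_mul : forall g h, gr_src g = gr_tgt h ->
    gr_src (gr_mul g h) = gr_src h;
  gr_tgt_mul : forall g h, gr_src g = gr_tgt h ->
    gr_tgt (gr_mul g h) = gr_tgt g;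
  gr_mulA : forall g h k, gr_src g = gr_tgt h -> gr_src h = gr_tgt k ->
    gr_mul g (gr_mul h k) = gr_mul (gr_mul g h) k;
  gr_mul1g : forall g, gr_mul (gr_unit (gr_tgt g)) g = g;
  gr_mulg1 : forall g, gr_mul g (gr_unit (gr_src g)) = g;
  gr_src_inv : forall g, gr_src (gr_inv g) = gr_tgt g;
  gr_tgt_inv : forall g, gr_tgt (gr_inv g) = gr_src g;
  gr_mulVg : forall g, gr_mul (gr_inv g) g = gr_unit (gr_src g);
  gr_mulgV : forall g, gr_mul g (gr_inv g) = gr_unit (gr_tgt g) }.

(** * VB-groupoids *)

Record vb_groupoid := VBGroupoid {
  vbM : manifold;
  vbG : manifold;
  vbE : manifold;
  vbGam : manifold;
  vb_base : lie_groupoid vbG vbM;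
  vb_total : lie_groupoid vbGam vbE;
  vb_qE : vector_bundle vbE vbM;
  vb_qGam : vector_bundle vbGam vbG;
  vb_src_morphism :
    vb_morphism vb_qGam vb_qE (gr_src vb_base) (gr_src vb_total);
  vb_tgt_morphism :
    vb_morphism vb_qGam vb_qE (gr_tgt vb_base) (gr_tgt vb_total);
  vb_unit_morphism :
    vb_morphism vb_qE vb_qGam (gr_unit vb_base) (gr_unit vb_total);
  vb_inv_morphism :
    vb_morphism vb_qGam vb_qGam (gr_inv vb_base) (gr_inv vb_total);
  (* The multiplication is a morphism over gr_mul vb_base, from the bundle of
     composable pairs of vbGam over the composable pairs of vbG, whose fibrewise
     operations are componentwise.  Its smoothness is gr_mul_smooth. *)
  vb_mul_proj : forall c d, gr_src vb_total c = gr_tgt vb_total d ->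
    vb_qGam (gr_mul vb_total c d) = gr_mul vb_base (vb_qGam c) (vb_qGam d);
  vb_mul_add : forall c d c' d',
    gr_src vb_total c = gr_tgt vb_total d ->
    gr_src vb_total c' = gr_tgt vb_total d' ->
    vb_qGam c = vb_qGam c' -> vb_qGam d = vb_qGam d' ->
    gr_mul vb_total (vb_add vb_qGam c c') (vb_add vb_qGam d d') =
    vb_add vb_qGam (gr_mul vb_total c d) (gr_mul vb_total c' d');
  vb_mul_scale : forall a c d, gr_src vb_total c = gr_tgt vb_total d ->
    gr_mul vb_total (vb_scale vb_qGam a c) (vb_scale vb_qGam a d) =
    vb_scale vb_qGam a (gr_mul vb_total c d);
  vb_src_fibrewise_surjective : forall g e, vb_qE e = gr_src vb_base g ->
    exists2 c, vb_qGam c = g & gr_src vb_total c = e }.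

Section VBGroupoid.
Variable V : vb_groupoid.

Local Notation M := (vbM V).
Local Notation G := (vbG V).
Local Notation E := (vbE V).
Local Notation Gam := (vbGam V).
Local Notation s := (gr_src (vb_base V)).
Local Notation t := (gr_tgt (vb_base V)).
Local Notation s' := (gr_src (vb_total V)).
Local Notation q := (vb_proj (vb_qE V)).
Local Notation qGam := (vb_proj (vb_qGam V)).

(* The kernel of s' restricted to the units of G. *)
Definition core_set : set Gam :=
  [set c | exists x : M, qGam c = gr_unit (vb_base V) x /\
                         s' c = vb_zero (vb_qE V) x].

Definition core : atlas_space := induced_space core_set.

(* The x with c in the fibre of vbGam over 1_x. *)
Definition core_proj (c : core) : M := s (qGam (incl c)).

(* s^!E *)
Definition pullback_set : set (prod_space E G) :=
  [set p : E * G | q p.1 = s p.2].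

(* sigma e g is meaningful if q e = s g. *)
Definition is_splitting (sigma : E -> G -> Gam) : Prop :=
  [/\ smooth_map (fun p : induced_space pullback_set =>
        sigma (incl p).1 (incl p).2),
      forall e g, q e = s g -> qGam (sigma e g) = g,
      forall e g, q e = s g -> s' (sigma e g) = e,
      forall e e' g, q e = s g -> q e' = s g ->
        sigma (vb_add (vb_qE V) e e') g =
        vb_add (vb_qGam V) (sigma e g) (sigma e' g) &
      forall a e g, q e = s g ->
        sigma (vb_scale (vb_qE V) a e) g =
        vb_scale (vb_qGam V) a (sigma e g)].

Definition is_unital (sigma : E -> G -> Gam) : Prop :=
  forall (x : M) (e : E), q e = x ->
    sigma e (gr_unit (vb_base V) x) = gr_unit (vb_total V) e.

(* G^(r); the entries are indexed from 0. *)
Definition composable_tuples (r : nat) : atlas_space :=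
  induced_space ([set g | forall i j : 'I_r, j = i.+1 :> nat ->
                    s (g i) = t (g j)]
                 : set (power_space 'I_r G)).

(* r-fold fibre product over M; entry i.+1 has index i : 'I_r. *)
Definition fibre_power (X : atlas_space) (p : X -> M) (r : nat) : atlas_space :=
  induced_space ([set x | forall i j : 'I_r, p (x i) = p (x j)]
                 : set (power_space 'I_r X)).

(* The column (c_{1,j}, ..., c_{j,j}), 1 <= j < r, has index j.-1 : 'I_r.-1. *)
Definition matrix_space (r : nat) : atlas_space :=
  prod_space (composable_tuples r)
    (prod_space (fibre_power q r)
       (pi_space (fun j : 'I_r.-1 => fibre_power core_proj j.+1))).

(* The conditions s (g_j) = t (g_{j+1}) are part of composable_tuples r. *)
Definition layer_matrices (r : nat) : set (matrix_space r) :=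
  [set m : matrix_space r |
    (forall (j : 'I_r.-1) (i : 'I_j.+1) (k : 'I_r), k = j.+1 :> nat ->
       core_proj (incl (m.2.2 j) i) = t (incl m.1 k)) /\
    (forall (i k : 'I_r), k = r.-1 :> nat ->
       q (incl m.2.1 i) = s (incl m.1 k))].

End VBGroupoid.

(** * Bar construction

  The layers only involve the source and target maps of a double Lie groupoid
  (Gam, G, H, M). *)

Record double_sides := DoubleSides {
  dM : atlas_space;
  dG : atlas_space;
  dH : atlas_space;
  dGam : atlas_space;
  d_sG : dGam -> dG;
  d_tG : dGam -> dG;
  d_sH : dGam -> dH;
  d_tH : dGam -> dH;
  d_sGM : dG -> dM;
  d_tGM : dG -> dM;
  d_sHM : dH -> dM;
  d_tHM : dH -> dM }.

(* The pairs (i, j) with 1 <= i <= j < r. *)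
Definition triangle (r : nat) : finType :=
  {p : 'I_r * 'I_r | (0 < p.1)%N && (p.1 <= p.2)%N}.

Definition tri_row (r : nat) (p : triangle r) : nat := (val p).1.
Definition tri_col (r : nat) (p : triangle r) : nat := (val p).2.

Definition bar_ambient (D : double_sides) (r : nat) : atlas_space :=
  prod_space (dG D) (prod_space (power_space (triangle r) (dGam D)) (dH D)).

(* Used for 0 < r.  The first clause is the definition for r = 1, where
   triangle r is empty; the others only apply for 2 <= r. *)
Definition bar_set (D : double_sides) (r : nat) : set (bar_ambient D r) :=
  [set w : bar_ambient D r |
    let g := w.1 in let gam := w.2.1 in let h := w.2.2 in
    [/\ r = 1%N -> d_sGM g = d_tHM h,
        forall p : triangle r, tri_row p = 1%N -> tri_col p = 1%N ->
          d_sGM g = d_tGM (d_tG (gam p)),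
        forall p p' : triangle r, tri_row p' = tri_row p ->
          tri_col p' = (tri_col p).+1 ->
          d_sH (gam p) = d_tH (gam p'),
        forall p p' : triangle r, tri_row p' = (tri_row p).+1 ->
          tri_col p' = tri_col p ->
          d_sG (gam p) = d_tG (gam p') &
        forall p : triangle r, tri_row p = r.-1 -> tri_col p = r.-1 ->
          d_tHM h = d_sHM (d_sH (gam p))]].

Definition bar_layer (D : double_sides) (r : nat) : atlas_space :=
  if r is 0 then dM D else induced_space (@bar_set D r).

(* A vector bundle is a groupoid whose source and target are the projection. *)
Definition vb_double_sides (V : vb_groupoid) : double_sides :=
  {| dM := vbM V; dG := vbG V; dH := vbE V; dGam := vbGam V;
     d_sG := vb_qGam V; d_tG := vb_qGam V;
     d_sH := gr_src (vb_total V); d_tH := gr_tgt (vb_total V);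
     d_sGM := gr_src (vb_base V); d_tGM := gr_tgt (vb_base V);
     d_sHM := vb_qE V; d_tHM := vb_qE V |}.

End Smooth.

(* Main.v *)
(* Write a column of W_r with base arrow g_j as a column of elements of vbGam
   over g_j.  The splitting decomposes gamma over g uniquely as
   c * 0_g + sigma e g with e the source of gamma and c in the core, both
   depending smoothly on gamma.  In a row the source of gamma_(i, j) is the
   target of gamma_(i, j+1), so that the row is determined by the core elements
   c_(i, j) and by the source e_i of its last entry, and it is recovered from
   these from right to left.

   All submanifold statements follow from one principle: a subset that is the
   image of a locally defined smooth retraction rho is embedded.  In a chart, if
   P is the derivative of rho at a point p of the subset, then
   x |-> P (rho x) + (1 - P) (x - rho x) has the identity as derivative at p, so
   that it is a local diffeomorphism, and it takes the subset to the image of P.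
   The core is embedded because gamma |-> c is a retraction of vbGam onto it, and
   the bar layer because the inverse of the map from matrices to W_r extends to a
   neighbourhood of W_r. *)

From HB Require Import structures.
From mathcomp Require Import all_boot all_order all_algebra.
From mathcomp Require Import all_classical all_reals all_analysis.
From mathcomp Require Import ring lra zify.
Require Import Defs.
Import Order.TTheory GRing.Theory Num.Theory.
Import numFieldNormedType.Exports.

Set Implicit Arguments.
Unset Strict Implicit.
Unset Printing Implicit Defensive.

Local Open Scope classical_set_scope.
Local Open Scope ring_scope.
(** * Calculus on R^n *)

(** Two features of the setting shape the proof. A subset carries a manifold structure only once it
    is known to be embedded, so tuple spaces and the layer of matrices need retractions before maps
    into them can be called smooth. These retractions come from lifting along a projection: a point
    is moved to a prescribed nearby fibre and stays fixed if it already lies there. Moreover,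
    multiplication and splitting are smooth only on composable pairs and on the pullback, so that
    assembling a row from a matrix is smooth on the layer of matrices. Taking apart is better
    behaved: the core part combines elements that always match, so it is smooth on all of $\Gamma$,
    and the coordinates of a point of $W_r$ are smooth on the whole ambient product. Off $W_r$ these
    coordinates may violate the matching conditions; they are replaced by maps into the subspaces
    that agree with them on $W_r$. This is the origin of the extended inverse. *)

Section Differentiability.
Variables (R : realType) (V W : normedModType R).

(** A continuous linear map with this remainder estimate is the derivative by uniqueness. The
    epsilon form is the one in which the inverse function is shown to be differentiable. *)
Lemma diff_littleo (f : V -> W) (df : {linear V -> W}) x :
  continuous df ->
  (forall e, 0 < e -> \forall h \near (0 : V),
     `|f (h + x) - f x - df h| <= e * `|h|) ->
  differentiable f x /\ 'd f x = df :> (V -> W).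
Proof.
move=> cdf lo.
have E : f \o shift x = cst (f x) + df +o_ 0 id.
  apply/eqaddoP => e e0; apply: filterS (lo e e0) => h.
  by rewrite !fctE /= opprD addrA.
have dE : 'd f x = df :> (V -> W) by exact: diff_unique.
by split=> //; apply/diff_locallyP; rewrite dE.
Qed.

Lemma littleo_diff (f : V -> W) x : differentiable f x ->
  forall e, 0 < e -> \forall h \near (0 : V),
     `|f (h + x) - f x - 'd f x h| <= e * `|h|.
Proof.
move=> /diff_locallyP[_ E] e e0.
apply: filterS ((eqaddoP _ _ _ _).1 E e e0) => h.
by rewrite !fctE /= opprD addrA.
Qed.

Lemma near_eq_differentiable (f g : V -> W) x :
  (\near x, f x = g x) -> differentiable f x -> differentiable g x.
Proof.
move=> fg df.
have [cdf _] := (diff_locallyP _ _).1 df.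
suff: differentiable g x /\ 'd g x = 'd f x :> (V -> W) by case.
apply: diff_littleo => // e e0.
have fg' : \forall h \near (0 : V), f (h + x) = g (h + x).
  by move: fg; rewrite (near_shift 0); apply: filterS => h /=; rewrite subr0.
apply: filterS2 (littleo_diff df e0) fg' => h.
by move=> + <-; rewrite -(nbhs_singleton fg).
Qed.

End Differentiability.

(** * Maps of class $C^k$ on open sets of row vectors *)

Section Calculus.
Variable R : realType.

(** Agrees with [continuously_differentiable] on row-valued maps; the target is an arbitrary normed
    space so that coordinates, products and determinants fall under the same notion. *)
Fixpoint cdiff (W : normedModType R) (k m : nat) (U : set 'rV[R]_m)
    (f : 'rV[R]_m -> W) : Prop :=
  match k with
  | 0 => forall x, U x -> {for x, continuous f}
  | k'.+1 => (forall x, U x -> differentiable f x) /\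
      (forall v, cdiff k' U (fun x => 'D_v f x))
  end.

Lemma cdiffE k m n (U : set 'rV[R]_m) (f : 'rV[R]_m -> 'rV[R]_n) :
  cdiff k U f <-> continuously_differentiable k U f.
Proof.
elim: k f => [|k IH] f //=.
by split=> -[? h]; split=> // v; apply/IH; apply: h.
Qed.

Lemma cdiff_sub (W : normedModType R) k m (U U' : set 'rV[R]_m)
    (f : 'rV[R]_m -> W) : U' `<=` U -> cdiff k U f -> cdiff k U' f.
Proof.
move=> sU; elim: k f => [|k IH] f /= => [cf x /sU|[df Df]]; first exact: cf.
by split=> [x /sU|v]; [exact: df|exact: IH].
Qed.

Section OnOpenSet.
Variables (m : nat) (U : set 'rV[R]_m).
Hypothesis oU : open U.
Implicit Types (W Z : normedModType R) (k : nat).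

Lemma near_open x : U x -> \forall y \near x, U y.
Proof. by move=> Ux; apply: open_nbhs_nbhs. Qed.

Lemma eq_cdiff W k (f g : 'rV[R]_m -> W) :
  (forall x, U x -> f x = g x) -> cdiff k U f -> cdiff k U g.
Proof.
have nfg (f1 g1 : 'rV[R]_m -> W) x : (forall x, U x -> f1 x = g1 x) -> U x ->
    \near x, f1 x = g1 x.
  by move=> fg Ux; apply: filterS (near_open Ux).
elim: k f g => [|k IH] f g fg /=.
  move=> cf x Ux; move: (cf x Ux).
  rewrite /prop_for /continuous_at -fg // => cfx.
  exact: (cvg_trans (near_eq_cvg (nfg _ _ _ fg Ux)) cfx).
move=> [df Df]; split=> [x Ux|v].
  by apply: near_eq_differentiable (df x Ux); apply: nfg.
by apply: IH (Df v) => x Ux; apply: near_eq_derive; apply: nfg.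
Qed.

Lemma cdiff_continuous W k (f : 'rV[R]_m -> W) x :
  cdiff k U f -> U x -> {for x, continuous f}.
Proof.
case: k => [|k] /=; first exact.
by move=> [df _] /df /differentiable_continuous.
Qed.

Lemma cdiffW W k (f : 'rV[R]_m -> W) : cdiff k.+1 U f -> cdiff k U f.
Proof.
elim: k f => [|k IH] f; first by move=> h x; apply: cdiff_continuous h.
by move=> [df Df]; split=> // v; apply: IH; apply: Df.
Qed.

Lemma cdiff_cst W k (a : W) : cdiff k U (fun _ : 'rV[R]_m => a).
Proof.
elim: k a => [|k IH] a /=; first by move=> x _; apply: cst_continuous.
split=> [x _|v]; first exact: differentiable_cst.
by apply: eq_cdiff (IH 0) => x _; rewrite derive_cst.
Qed.

Lemma cdiffD W k (f g : 'rV[R]_m -> W) :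
  cdiff k U f -> cdiff k U g -> cdiff k U (fun x => f x + g x).
Proof.
elim: k f g => [|k IH] f g /=.
  by move=> cf cg x Ux; exact: (continuousD (cf x Ux) (cg x Ux)).
move=> [df Df] [dg Dg]; split=> [x Ux|v].
  by apply: differentiableD; [exact: df|exact: dg].
apply: eq_cdiff (IH _ _ (Df v) (Dg v)) => x Ux.
by rewrite -deriveD //; apply: diff_derivable; [exact: df|exact: dg].
Qed.

Lemma cdiff_sum W k (I : Type) (r : seq I) (P : pred I)
    (f : I -> 'rV[R]_m -> W) :
  (forall i, P i -> cdiff k U (f i)) ->
  cdiff k U (fun x => \sum_(i <- r | P i) f i x).
Proof.
move=> cf; elim: r => [|i r IH].
  by apply: eq_cdiff (cdiff_cst k 0) => x _; rewrite big_nil.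
have [Pi|nPi] := boolP (P i).
  by apply: eq_cdiff (cdiffD (cf i Pi) IH) => x _; rewrite big_cons Pi.
by apply: eq_cdiff IH => x _; rewrite big_cons (negbTE nPi).
Qed.

Lemma cdiff_linear W Z k (L : {linear W -> Z}) (f : 'rV[R]_m -> W) :
  continuous L -> cdiff k U f -> cdiff k U (fun x => L (f x)).
Proof.
move=> cL; elim: k f => [|k IH] f /=.
  by move=> cf x Ux; apply: continuous_comp; [exact: cf|exact: cL].
move=> [df Df].
have dL y : differentiable L y by exact: linear_differentiable.
split=> [x Ux|v]; first by apply: differentiable_comp => //; exact: df.
apply: eq_cdiff (IH _ (Df v)) => x Ux.
have dfx := df x Ux.
rewrite [RHS]deriveE; last exact: differentiable_comp.
by rewrite diff_comp //= diff_lin //= deriveE.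
Qed.

(** The product rule leaves one factor undifferentiated in each term; [cdiffW] lowers its order to
    that of the derivative of the other factor. *)
Lemma cdiffM k (f g : 'rV[R]_m -> R) :
  cdiff k U f -> cdiff k U g -> cdiff k U (fun x => f x * g x).
Proof.
elim: k f g => [|k IH] f g.
  by move=> cf cg x Ux; exact: (continuousM (cf x Ux) (cg x Ux)).
move=> cf cg; have [df Df] := cf; have [dg Dg] := cg.
split=> [x Ux|v]; first by apply: differentiableM; [exact: df|exact: dg].
apply: eq_cdiff (cdiffD (IH _ _ (cdiffW cf) (Dg v))
                        (IH _ _ (cdiffW cg) (Df v))) => x Ux.
by rewrite deriveM //; apply: diff_derivable; [exact: df|exact: dg].
Qed.

Lemma cdiff_prod k (I : Type) (r : seq I) (P : pred I)
    (f : I -> 'rV[R]_m -> R) :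
  (forall i, P i -> cdiff k U (f i)) ->
  cdiff k U (fun x => \prod_(i <- r | P i) f i x).
Proof.
move=> cf; elim: r => [|i r IH].
  by apply: eq_cdiff (cdiff_cst k (1 : R)) => x _; rewrite big_nil.
have [Pi|nPi] := boolP (P i).
  by apply: eq_cdiff (cdiffM (cf i Pi) IH) => x _; rewrite big_cons Pi.
by apply: eq_cdiff IH => x _; rewrite big_cons (negbTE nPi).
Qed.

(** The derivative $-f^{-2}D_vf$ contains the reciprocal itself, whose regularity of one order less
    is the induction hypothesis. *)
Lemma cdiffV k (f : 'rV[R]_m -> R) : (forall x, U x -> f x != 0) ->
  cdiff k U f -> cdiff k U (fun x => (f x)^-1).
Proof.
move=> f0; elim: k => [|k IH].
  by move=> cf x Ux; exact: (continuousV (f0 x Ux) (cf x Ux)).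
move=> cf; have [df Df] := cf; have cV := IH (cdiffW cf).
split=> [x Ux|v]; first by apply: differentiableV; [exact: df|exact: f0].
have := cdiffM (cdiffM (cdiff_cst k (-1 : R)) (cdiffM cV cV)) (Df v).
apply: eq_cdiff => x Ux.
rewrite deriveV; [|exact: f0|exact/diff_derivable/df].
by rewrite -exprVn expr2 mulN1r -scaleNr.
Qed.

Lemma cdiff_coord k n (f : 'rV[R]_m -> 'rV[R]_n) j :
  cdiff k U f -> cdiff k U (fun x => f x 0 j).
Proof.
pose L := fun y : 'rV[R]_n => y 0 j.
have linL : linear L by move=> a y z; rewrite /L !mxE.
pose LM := GRing.isLinear.Build _ _ _ _ _ linL.
pose LL : {linear 'rV[R]_n -> R} := HB.pack L LM.
exact: (@cdiff_linear _ _ k LL f (@coord_continuous _ _ _ _ _)).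
Qed.

Lemma cdiff_row k n (f : 'I_n -> 'rV[R]_m -> R) :
  (forall j, cdiff k U (f j)) -> cdiff k U (fun x => \row_j f j x).
Proof.
move=> cf.
have cL j : continuous (fun a : R => a *: (delta_mx 0 j : 'rV[R]_n)).
  exact: scalel_continuous.
pose linL j : linear (fun a : R => a *: (delta_mx 0 j : 'rV[R]_n)) :=
  fun a y z => etrans (scalerDl _ _ _) (congr1 (+%R^~ _) (esym (scalerA _ _ _))).
pose LL j : {linear R -> 'rV[R]_n} :=
  HB.pack (fun a : R => a *: (delta_mx 0 j : 'rV[R]_n))
          (GRing.isLinear.Build _ _ _ _ _ (linL j)).
have := @cdiff_sum 'rV[R]_n k 'I_n (index_enum _) xpredT
  (fun j x => f j x *: delta_mx 0 j)
  (fun j _ => @cdiff_linear _ _ k (LL j) (f j) (cL j) (cf j)).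
apply: eq_cdiff => x _; rewrite [RHS]row_sum_delta.
by apply: eq_bigr => j _; rewrite mxE.
Qed.

Lemma cdiff_rowP k n (f : 'rV[R]_m -> 'rV[R]_n) :
  (forall j, cdiff k U (fun x => f x 0 j)) -> cdiff k U f.
Proof.
by move=> /cdiff_row; apply: eq_cdiff => x _; apply/rowP => j; rewrite mxE.
Qed.

Lemma cdiff_mulmx k n p (M : 'M[R]_(n, p)) (f : 'rV[R]_m -> 'rV[R]_n) :
  cdiff k U f -> cdiff k U (fun x => f x *m M).
Proof.
move=> cf; apply: cdiff_rowP => j.
have cfM := @cdiff_sum R k 'I_n (index_enum _) xpredT
  (fun i x => f x 0 i * M i j)
  (fun i _ => cdiffM (cdiff_coord i cf) (cdiff_cst k (M i j))).
by apply: eq_cdiff cfM => x _; rewrite mxE.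
Qed.

Lemma cdiff_row_mx k n p (f : 'rV[R]_m -> 'rV[R]_n) (g : 'rV[R]_m -> 'rV[R]_p) :
  cdiff k U f -> cdiff k U g -> cdiff k U (fun x => row_mx (f x) (g x)).
Proof.
move=> cf cg; apply: cdiff_rowP => j; rewrite -[j]splitK.
case: (fintype.split j) => j' /=.
  by apply: eq_cdiff (cdiff_coord j' cf) => x _; rewrite row_mxEl.
by apply: eq_cdiff (cdiff_coord j' cg) => x _; rewrite row_mxEr.
Qed.

Lemma cdiff_id k : cdiff k U (fun x : 'rV[R]_m => x).
Proof.
elim: k => [|k _]; first by move=> x _; apply: cvg_id.
split=> [x _|v]; first exact: ex_diff.
by apply: eq_cdiff (cdiff_cst k v) => x _; rewrite derive_id.
Qed.

Lemma cdiff_det k n (A : 'rV[R]_m -> 'M[R]_n) :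
  (forall i j, cdiff k U (fun x => A x i j)) -> cdiff k U (fun x => \det (A x)).
Proof.
move=> cA; apply: cdiff_sum => s _; apply: cdiffM; first exact: cdiff_cst.
by apply: cdiff_prod => i _; apply: cA.
Qed.

(** By Cramer's formula the entries are cofactors divided by the determinant. *)
Lemma cdiff_invmx k n (A : 'rV[R]_m -> 'M[R]_n) :
  (forall x, U x -> A x \in unitmx) ->
  (forall i j, cdiff k U (fun x => A x i j)) ->
  forall i j, cdiff k U (fun x => invmx (A x) i j).
Proof.
move=> uA cA i j.
have cdet := cdiffV (f := fun x => \det (A x)) _ (cdiff_det cA).
have cadj : cdiff k U (fun x => cofactor (A x) j i).
  apply: cdiffM; first exact: cdiff_cst.
  apply: cdiff_det => i' j'.
  by apply: eq_cdiff (cA (lift j i') (lift i j')) => x _; rewrite !mxE.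
apply: eq_cdiff (cdiffM (cdet _) cadj) => x Ux.
  by rewrite /invmx uA // !mxE.
by have := uA x Ux; rewrite unitmxE unitfE.
Qed.

End OnOpenSet.

Lemma derive_comp (V W Z : normedModType R) (f : V -> W) (g : W -> Z) x v :
  differentiable f x -> differentiable g (f x) ->
  'D_v (fun y => g (f y)) x = 'D_('D_v f x) g (f x).
Proof.
move=> df dg; rewrite deriveE; last exact: differentiable_comp.
by rewrite diff_comp // /= !deriveE.
Qed.

Lemma derive_sum_delta n (W : normedModType R) (g : 'rV[R]_n -> W) y v :
  differentiable g y ->
  'D_v g y = \sum_j v 0 j *: 'D_(delta_mx 0 j) g y.
Proof.
move=> dg; rewrite deriveE // {1}[v]row_sum_delta linear_sum.
by apply: eq_bigr => j _; rewrite linearZ deriveE.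
Qed.

(** By the chain rule $D_v(g\circ f)=\sum_j (D_vf)_j\cdot(\partial_jg)\circ f$, and the induction
    applies to the partial derivatives of [g]. Scalar values of [g] make the summands products of
    scalars. *)
Lemma cdiff_comp m n k (U : set 'rV[R]_m) (U' : set 'rV[R]_n)
    (f : 'rV[R]_m -> 'rV[R]_n) (g : 'rV[R]_n -> R) :
  open U -> (forall x, U x -> U' (f x)) ->
  cdiff k U f -> cdiff k U' g -> cdiff k U (fun x => g (f x)).
Proof.
move=> oU fU; elim: k g => [|k IH] g.
  by move=> cf cg x Ux; apply: continuous_comp; [exact: cf|exact/cg/fU].
move=> cf; have [df Df] := cf; move=> cg; have [dg Dg] := cg.
split=> [x Ux|v].
  by apply: differentiable_comp; [exact: df|exact/dg/fU].
have := @cdiff_sum _ _ oU R k 'I_n (index_enum _) xpredT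
  (fun j x => 'D_v f x 0 j * 'D_(delta_mx 0 j) g (f x))
  (fun j _ => cdiffM oU (cdiff_coord oU j (Df v)) (IH _ (cdiffW cf) (Dg _))).
apply: (eq_cdiff oU) => x Ux.
have dgx := dg _ (fU x Ux).
by rewrite (derive_comp v (df x Ux) dgx) [RHS](derive_sum_delta _ dgx).
Qed.

Lemma cdiff_comp_row m n p k (U : set 'rV[R]_m) (U' : set 'rV[R]_n)
    (f : 'rV[R]_m -> 'rV[R]_n) (g : 'rV[R]_n -> 'rV[R]_p) :
  open U -> open U' -> (forall x, U x -> U' (f x)) ->
  cdiff k U f -> cdiff k U' g -> cdiff k U (fun x => g (f x)).
Proof.
move=> oU oU' fU cf cg; apply: cdiff_rowP => // j.
exact: (cdiff_comp oU fU cf (cdiff_coord oU' j cg)).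
Qed.

Lemma row_norm_le n (v : 'rV[R]_n) c : 0 <= c ->
  (forall j, `|v 0 j| <= c) -> `|v| <= c.
Proof.
move=> c0 vc; rewrite /Num.Def.normr /= mx_normrE.
by apply: bigmax_le => // -[i j] _; rewrite [i]ord1; apply: vc.
Qed.

Lemma coord_norm_le n (v : 'rV[R]_n) j : `|v 0 j| <= `|v|.
Proof.
rewrite [leRHS]/Num.Def.normr /= mx_normrE.
exact: (le_bigmax _ (fun ij : 'I_1 * 'I_n => `|v ij.1 ij.2|) (0, j)).
Qed.

(** The mean value theorem for real functions is applied to each coordinate of [h] along the segment
    from [x] to [y]; in the maximum norm the coordinatewise bounds suffice. *)
Lemma mean_value n p (h : 'rV[R]_n -> 'rV[R]_p) (x y : 'rV[R]_n) c : 0 <= c ->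
  (forall t : R, 0 <= t <= 1 -> differentiable h (x + t *: (y - x)) /\
     `|'D_(y - x) h (x + t *: (y - x))| <= c) ->
  `|h y - h x| <= c.
Proof.
move=> c0 H; apply: row_norm_le => // j.
pose l (t : R) : 'rV[R]_n := x + t *: (y - x).
have dl (t : R) : is_derive t 1 l (y - x).
  have [dd dE] := is_diff_scalel t (y - x).
  split; first exact/derivableD/diff_derivable.
  rewrite deriveD //; last exact: diff_derivable.
  by rewrite derive_cst add0r deriveE // dE scale1r.
pose g (t : R) := h (l t) 0 j.
have dg (t : R) : 0 <= t <= 1 -> is_derive t 1 g ('D_(y - x) h (l t) 0 j).
  move=> t01; have [dh _] := H t t01.
  have dll : differentiable l t by apply/derivable1_diffP/ex_derive.
  have dhl : derivable (fun t => h (l t)) t 1.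
    by apply/derivable1_diffP; apply: differentiable_comp.
  split; first exact: (derivable_mxP _ _ _).1 dhl 0 j.
  have := congr1 (fun v : 'rV[R]_p => v 0 j) (derive_mx dhl).
  by rewrite [in RHS]mxE (derive_comp _ dll dh) derive_val => <-.
have [||t t01] := @MVT R g (fun t => 'D_(y - x) h (l t) 0 j) 0 1 ltr01.
- by move=> t; rewrite in_itv /= => /andP[t0 t1]; apply: dg; rewrite !ltW.
- apply: derivable_within_continuous => t; rewrite in_itv /= => t01.
  by have [] := dg t t01.
rewrite /g /l scale1r addrCA subrr addr0 scale0r addr0 subr0 mulr1 !mxE => ->.
have /H[_] : 0 <= t <= 1.
  by move: t01; rewrite in_itv /= => /andP[t0 t1]; rewrite !ltW.
by apply: le_trans; apply: coord_norm_le.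
Qed.

Lemma derive_norm_le n (W : normedModType R) (g : 'rV[R]_n -> W) y v c :
  differentiable g y -> (forall j, `|'D_(delta_mx 0 j) g y| <= c) ->
  `|'D_v g y| <= c *+ n * `|v|.
Proof.
move=> dg cg; rewrite (derive_sum_delta _ dg).
apply: le_trans (ler_norm_sum _ _ _) _.
rewrite mulrnAl -[X in _ *+ X]card_ord -sumr_const ler_sum // => j _.
by rewrite normrZ mulrC ler_pM // coord_norm_le.
Qed.
End Calculus.
(** Makes the row spaces complete normed spaces, as the Banach fixed point theorem requires. *)
HB.instance Definition _ (R : realType) n := Complete.on 'rV[R]_n.

(** * The inverse function theorem *)

Section InverseFunction.
Variables (R : realType) (n : nat).
Implicit Types (U : set 'rV[R]_n) (f g : 'rV[R]_n -> 'rV[R]_n).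

Section Local.
Variables (U : set 'rV[R]_n) (f : 'rV[R]_n -> 'rV[R]_n) (p : 'rV[R]_n).
Hypothesis oU : open U.
Hypothesis sf : forall k, cdiff k U f.
Hypothesis Up : U p.
Hypothesis dfp : forall v, 'D_v f p = v.

Let df x : U x -> differentiable f x.
Proof. by case: (sf 1) => + _; apply. Qed.

(** The deviation of [f] from the identity; its derivative vanishes at [p], so it is a contraction
    nearby. *)
Let h x : 'rV[R]_n := x - f x.

Let dh x : U x -> differentiable h x.
Proof. by move=> Ux; apply: differentiableB; [exact: ex_diff|exact: df]. Qed.

Let Dh x v : U x -> 'D_v h x = v - 'D_v f x.
Proof.
move=> Ux; have dfx : derivable f x v by exact/diff_derivable/df.
by rewrite (deriveB (@derivable_id R _ x v) dfx) derive_id.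
Qed.

Let half_small : \forall x \near p, U x /\ forall v, `|'D_v h x| <= 2^-1 * `|v|.
Proof.
(* A bound [c] on the [n] partial derivatives bounds $D_vh$ by $nc|v|\le|v|/2$. Dividing by [n.+1]
   keeps the constant meaningful for [n = 0]. *)
pose c : R := 2^-1 / n.+1%:R.
have c0 : 0 < c by rewrite divr_gt0 // invr_gt0.
have cD (j : 'I_n) : \forall x \near p, `|'D_(delta_mx 0 j) h x| <= c.
  have cont : {for p, continuous (fun x => 'D_(delta_mx 0 j) f x)}.
    by case: (sf 1) => _ /(_ (delta_mx 0 j)) /(_ p Up).
  have /cvgrPdist_le/(_ c c0) := cont.
  have nU := near_open oU Up.
  by apply: filterS2 nU => x Ux; rewrite Dh // dfp.
have cD' : \forall x \near p, forall j : 'I_n, `|'D_(delta_mx 0 j) h x| <= c.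
  exact: (filter_forall (nbhs_filter p) cD).
apply: filterS2 (near_open oU Up) cD' => x Ux Dx; split => // v.
apply: le_trans (derive_norm_le _ (dh Ux) Dx) _.
rewrite ler_wpM2r // -[_ *+ n]mulr_natr /c -mulrA ler_piMr ?invr_ge0 //.
by rewrite ler_pdivrMl // mulr1 ler_nat.
Qed.

(** On a ball where [h] is Lipschitz with constant 1/2, [f] is injective, and a preimage of [y] is a
    fixed point of the contraction [x |-> y + h x]. An identity derivative at [p] is the case that
    arises from straightening a retraction. *)
Lemma inverse_function : exists V g,
  [/\ open V, V `<=` U, V p, open (f @` V) &
   (forall x, V x -> g (f x) = x) /\ forall k, cdiff k (f @` V) g].
Proof.
have /nbhs_ballP[d /= d0 Hd] := half_small.
have dU x : ball p d x -> U x by move=> /Hd[].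
have convex_ball (x y : 'rV[R]_n) (t : R) : ball p d x -> ball p d y ->
    0 <= t <= 1 -> ball p d (x + t *: (y - x)).
  rewrite -ball_normE /= => xd yd /andP[t0 t1].
  have -> : p - (x + t *: (y - x)) = (1 - t) *: (p - x) + t *: (p - y).
    by apply/rowP => i; rewrite !mxE; ring.
  apply: le_lt_trans (ler_normD _ _) _.
  rewrite !normrZ !ger0_norm ?subr_ge0 //.
  have [->|tn0] := eqVneq t 0; first by rewrite subr0 mul1r mul0r addr0.
  have tp : 0 < t by rewrite lt0r tn0.
  have : t * `|p - y| < t * d by rewrite ltr_pM2l.
  have : (1 - t) * `|p - x| <= (1 - t) * d by rewrite ler_wpM2l ?subr_ge0 // ltW.
  lra.
have lip (x y : 'rV[R]_n) : ball p d x -> ball p d y -> `|h y - h x| <= 2^-1 * `|y - x|.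
  move=> xd yd; apply: mean_value => [|t t01]; first by rewrite mulr_ge0 ?invr_ge0.
  have [Ux' Hx'] := Hd _ (convex_ball _ _ _ xd yd t01).
  by split; [exact: dh|exact: Hx'].
have expand (x y : 'rV[R]_n) : ball p d x -> ball p d y -> `|y - x| <= 2 * `|f y - f x|.
  move=> xd yd; have l := lip _ _ xd yd.
  have e : y - x = (f y - f x) + (h y - h x).
    by apply/rowP => i; rewrite !mxE; ring.
  have := ler_normD (f y - f x) (h y - h x); rewrite -e; lra.
pose V := ball p d.
have inj (x y : 'rV[R]_n) : V x -> V y -> f x = f y -> x = y.
  move=> xd yd e; apply/eqP; rewrite eq_sym -subr_eq0 -normr_le0.
  by apply: le_trans (expand _ _ xd yd) _; rewrite e subrr normr0 mulr0.
have oV : open V by exact: ball_open.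
have ofV : open (f @` V).
  rewrite openE => _ [x0 Vx0 <-]; rewrite /interior.
  have /nbhs_ballP[e /= e0 eV] := near_open oV Vx0.
  (* The closed ball of half the radius lies in [V], and closedness is what the fixed point theorem
     asks for. *)
  pose r := e / 2; have r0 : 0 < r by rewrite divr_gt0.
  pose K := closed_ball_ (fun x => `|x|) x0 r.
  have KV x : K x -> V x.
    move=> Kx; apply: eV; rewrite -ball_normE /=.
    by apply: le_lt_trans Kx _; rewrite /r ltr_pdivrMr // ltr_pMr // ltr1n.
  (* For [y] within [r / 2] of [f x0] one has $|x_0-Tx|\le|fx_0-y|+|hx-hx_0|\le r/2+r/2$, so [T]
     preserves [K]. *)
  apply/nbhs_ballP; exists (r / 2); first by rewrite /= divr_gt0.
  move=> y; rewrite -ball_normE /= => yr.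
  pose T x := y + h x.
  have KT : {homo T : x / K x >-> K x}.
    move=> x Kx; rewrite /K /closed_ball_ /=.
    have -> : x0 - T x = (f x0 - y) - (h x - h x0).
      by apply/rowP => i; rewrite !mxE; ring.
    apply: le_trans (ler_normB _ _) _.
    have Kx' : `|x0 - x| <= r := Kx.
    by have := lip _ _ Vx0 (KV _ Kx); rewrite [`|x - x0|]distrC; lra.
  have ctr : is_contraction (mkfun KT).
    exists (2^-1)%:nng; split => /=; first by rewrite invf_lt1 // ltr1n.
    move=> [x x'] [/= Kx Kx'].
    have -> : T x - T x' = h x - h x' by apply/rowP => i; rewrite !mxE; ring.
    exact: lip (KV _ Kx') (KV _ Kx).
  have [||x Kx xT] := banach_fixed_point ctr.
  - exact: closed_closed_ball_.
  - by exists x0; rewrite /K /closed_ball_ /= subrr normr0 ltW.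
  exists x; first exact: KV.
  apply/rowP => i; have /rowP/(_ i) := xT; rewrite !mxE => e'.
  lra.
(* Off the image of [V] the value is the default [p]. *)
pose g y := xget p [set x | V x /\ f x = y].
have gf x : V x -> g (f x) = x.
  move=> Vx; rewrite /g; case: xgetP => [z _ [Vz e]|/(_ x)]; first exact: inj.
  by case.
have unitJ x : V x -> jacobian f x \in unitmx.
  (* If the Jacobian kills [v] then $D_vh=v$, and $|v|\le|v|/2$ forces [v = 0]. *)
  move=> Vx; rewrite -row_free_unit; apply: inj_row_free => v.
  have [Ux /(_ v)] := Hd _ Vx.
  rewrite -deriveEjacobian; last exact: df.
  move=> + e; rewrite Dh // e subr0 => hv.
  by apply/eqP; rewrite -normr_le0; lra.
have dg x : V x -> differentiable g (f x) /\
    forall w, 'D_w g (f x) = w *m invmx (jacobian f x).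
  move=> Vx; set J := jacobian f x.
  have cM : continuous (mulmxr (invmx J) : 'rV[R]_n -> 'rV[R]_n).
    by move=> w; apply: (cdiff_mulmx openT (invmx J) (cdiff_id openT 0)).
  have [C C0 HC] := linear_lipschitz cM.
  have JM : J *m invmx J = 1%:M by rewrite mulmxV // unitJ.
  have [|dgx Dg] := @diff_littleo _ _ _ g (mulmxr (invmx J)) (f x) cM; last first.
    by split=> // w; rewrite deriveE // Dg.
  (* [C] is a Lipschitz constant of the inverse Jacobian, and 2 is the constant of [expand], which
     bounds [x' - x] by [w]; their product turns [e'] into [e]. *)
  move=> e e0; pose e' := e / (2 * C).
  have e'0 : 0 < e' by rewrite divr_gt0 // mulr_gt0.
  have Ux := dU _ Vx.
  have /nbhs_ballP[r /= r0 Hr] := littleo_diff (df Ux) e'0.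
  have near_im : \forall w \near (0 : 'rV[R]_n), (f @` V) (w + f x).
    have := near_open ofV (imageP f Vx).
    by rewrite (near_shift 0); apply: filterS => w /=; rewrite subr0.
  have near_r : \forall w \near (0 : 'rV[R]_n), `|w| < r / 2.
    by apply/nbhs_ballP; exists (r / 2); rewrite /= ?divr_gt0 // => w;
      rewrite -ball_normE /= sub0r normrN.
  apply: filterS2 near_im near_r => w [x' Vx' fx'] wr.
  have k2 := expand _ _ Vx Vx'.
  have fw : f x' - f x = w by rewrite fx' addrK.
  rewrite fw in k2.
  have /Hr : ball 0 r (x' - x) by rewrite -ball_normE /= sub0r normrN; lra.
  rewrite subrK fw -deriveE; last exact: df.
  rewrite (deriveEjacobian _ (df Ux)) -/J => Hw.
  rewrite -fx' !gf //.
  have -> : x' - x - mulmxr (invmx J) w =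
      mulmxr (invmx J) (- (w - (x' - x) *m J)).
    by rewrite /= opprB mulmxBl -mulmxA JM mulmx1.
  apply: le_trans (HC _) _; rewrite normrN.
  apply: (@le_trans _ _ (C * (e' * (2 * `|w|)))).
    rewrite ler_pM2l //; apply: le_trans Hw _.
    by rewrite ler_pM2l.
  by rewrite le_eqVlt; apply/orP; left; apply/eqP; rewrite /e'; field; rewrite gt_eqF.
exists V, g; split => //; first exact: ball_center_subproof.
split=> //; elim=> [|k IH].
  by move=> _ [x Vx <-]; apply: differentiable_continuous; case: (dg _ Vx).
split=> [_ [x Vx <-]|v]; first by case: (dg _ Vx).
(* The derivative of [g] is the inverse of the Jacobian of [f] along [g]. By induction [g] has order
   [k], hence so has this Jacobian, and [g] gains one order. *)
have cJ i j : cdiff k (f @` V) (fun y => jacobian f (g y) i j).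
  have gV y : (f @` V) y -> V (g y) by move=> [x Vx <-]; rewrite gf.
  have cD : cdiff k V (fun x => 'D_(delta_mx 0 i) f x 0 j).
    have [_ /(_ (delta_mx 0 i)) Df] := sf k.+1.
    exact: (cdiff_coord oV j (cdiff_sub dU Df)).
  apply: eq_cdiff (cdiff_comp ofV gV IH cD) => // y fy.
  have Ug := dU _ (gV y fy).
  by rewrite (deriveEjacobian _ (df Ug)) -rowE mxE.
have unitJg y : (f @` V) y -> jacobian f (g y) \in unitmx.
  by move=> [x Vx <-]; rewrite gf // unitJ.
apply: cdiff_rowP => // j.
have cs := @cdiff_sum _ _ _ ofV R k 'I_n (index_enum _) xpredT
  (fun i y => v 0 i * invmx (jacobian f (g y)) i j)
  (fun i _ => cdiffM ofV (cdiff_cst ofV k (v 0 i : R)) (cdiff_invmx ofV unitJg cJ i j)).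
apply: eq_cdiff cs => // _ [x Vx <-].
by have [_ ->] := dg _ Vx; rewrite !gf // mxE.
Qed.

End Local.
End InverseFunction.
Lemma open_preimage_on (T Z : topologicalType) (U : set T) (V : set Z)
    (f : T -> Z) : open U -> open V -> (forall x, U x -> {for x, continuous f}) ->
  open (U `&` f @^-1` V).
Proof.
rewrite !openE => oU oV cf x [Ux Vx]; apply: filterI; first exact: oU.
exact: (cf x Ux _ (oV _ Vx)).
Qed.

Lemma near_open_nbhd (T : topologicalType) (p : T) (P : set T) :
  nbhs p P -> exists N, [/\ open N, N p & N `<=` P].
Proof. by rewrite nbhsE => -[N [oN Np] NP]; exists N. Qed.

(** * Straightening a retraction of an open set of row vectors *)

Section Retraction.
Variables (R : realType) (n : nat).

(** With $P=CR$ the factorisation of full rank, idempotence reads $C(RC)R=CR$, where [C] can be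
    cancelled on the left and [R] on the right. *)
Lemma idempotent_factor (F : fieldType) (P : 'M[F]_n) : P *m P = P ->
  row_base P *m col_base P = 1%:M.
Proof.
move=> PP; have := PP; rewrite -{1 2 3}(mulmx_base P).
rewrite mulmxA -[in X in X = _](mulmxA (col_base P)) => e.
apply: (row_full_inj (col_base_full P)); rewrite mulmx1.
exact: (row_free_inj (row_base_free P)).
Qed.

Lemma base_orthogonal (F : fieldType) (P Q : 'M[F]_n) : P *m Q = 0 ->
  row_base P *m col_base Q = 0.
Proof.
move=> PQ; apply: (row_full_inj (col_base_full P)).
apply: (row_free_inj (row_base_free Q)).
by rewrite mulmx0 mul0mx -mulmxA -mulmxA mulmx_base mulmxA mulmx_base.
Qed.

Lemma differentiable_mulmxr m k (M : 'M[R]_(m, k)) y :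
  differentiable (mulmxr M : 'rV[R]_m -> 'rV[R]_k) y.
Proof.
apply: linear_differentiable => w.
exact: (cdiff_mulmx openT M (cdiff_id openT 0)).
Qed.

Lemma derive_mulmx m k q (f : 'rV[R]_m -> 'rV[R]_k) (M : 'M[R]_(k, q)) x v :
  differentiable f x -> 'D_v (fun y => f y *m M) x = 'D_v f x *m M.
Proof.
move=> df; have dM := differentiable_mulmxr M (f x).
by rewrite (derive_comp v df dM) deriveE // diff_lin // => w;
  apply/differentiable_continuous/differentiable_mulmxr.
Qed.

(** [Phi] is written in a basis adapted to the images of the complementary projections [P] and [Q],
    so that the last coordinates are its [Q]-component. The inverse [psi] is returned as well, since
    compatibility with other charts involves both directions. *)
Lemma retraction_straighten (U : set 'rV[R]_n) (h : 'rV[R]_n -> 'rV[R]_n) p :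
  open U -> (forall k, cdiff k U h) -> U p -> h p = p ->
  (\forall x \near p, h (h x) = h x) ->
  exists k l (phi : 'rV[R]_n -> 'rV[R]_(k + l)) (psi : 'rV[R]_(k + l) -> 'rV[R]_n)
    (V : set 'rV[R]_n),
  [/\ open V, V `<=` U, V p & forall i, cdiff i V phi] /\
  [/\ open (phi @` V), forall i, cdiff i (phi @` V) psi,
      forall x, V x -> psi (phi x) = x &
      forall x, V x -> (h x = x <-> rsubmx (phi x) = 0)].
Proof.
move=> oU ch Up hp hh.
have dh x : U x -> differentiable h x by case: (ch 1) => + _; apply.
pose P := jacobian h p; pose Q : 'M[R]_n := 1%:M - P.
(* Differentiate [h \o h = h] at the fixed point [p]. *)
have PP : P *m P = P.
  apply/row_matrixP => i; rewrite !rowE mulmxA.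
  set v := delta_mx 0 i; rewrite -!(deriveEjacobian _ (dh p Up)).
  rewrite -{1}hp -(derive_comp v (dh p Up)); last by rewrite hp; apply: dh.
  exact: near_eq_derive.
have QQ : Q *m Q = Q.
  by rewrite /Q mulmxBl mul1mx mulmxBr mulmx1 PP subrr subr0.
have PQ : P *m Q = 0 by rewrite /Q mulmxBr mulmx1 PP subrr.
have QP : Q *m P = 0 by rewrite /Q mulmxBl mul1mx PP subrr.
pose Phi x : 'rV[R]_n := h x *m P + (x - h x) *m Q.
have cPhi i : cdiff i U Phi.
  apply: cdiffD => //; apply: cdiff_mulmx => //.
  apply: cdiffD => //; first exact: cdiff_id.
  apply: (eq_cdiff oU) (cdiff_mulmx oU (- 1%:M) (ch i)) => x _.
  by rewrite mulmxN mulmx1.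
have DPhi v : 'D_v Phi p = v.
  have did : differentiable (fun x : 'rV[R]_n => x) p by exact: ex_diff.
  have dB : differentiable (fun x => x - h x) p.
    by apply: differentiableB => //; exact: dh.
  have dM m (f : 'rV[R]_n -> 'rV[R]_n) (M : 'M[R]_(n, m)) :
      differentiable f p -> derivable (fun y => f y *m M) p v.
    move=> df; apply/diff_derivable.
    exact: (differentiable_comp df (differentiable_mulmxr M (f p))).
  rewrite (deriveD (dM _ _ P (dh p Up)) (dM _ _ Q dB)).
  rewrite !derive_mulmx //; last exact: dh.
  rewrite (deriveB (diff_derivable did) (diff_derivable (dh p Up))) derive_id.
  rewrite (deriveEjacobian _ (dh p Up)) -/P -mulmxA PP mulmxBl -mulmxA PQ.
  by rewrite mulmx0 subr0 /Q mulmxBr mulmx1 addrC subrK.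
have [V0 [g [oV0 V0U V0p oV0' [gK cg]]]] := inverse_function oU cPhi Up DPhi.
have cth : {for p, continuous h} by apply: differentiable_continuous; apply: dh.
(* The point [h x] must lie in [V0] too, because the injectivity of [Phi] on [V0] is later applied
   to [x] and [h x]. *)
have : \forall x \near p, h (h x) = h x /\ V0 (h x).
  apply: filterS2 hh (_ : \forall x \near p, V0 (h x)) => //.
  by apply: cth; rewrite hp; apply: near_open.
move=> /near_open_nbhd[N [oN Np NH]].
pose V := V0 `&` N.
(* The change of basis and its inverse come from the factorisations of [P] and [Q]; for instance
   $AB=P+Q=1$. *)
pose A := row_mx (col_base P) (col_base Q).
pose B := col_mx (row_base P) (row_base Q).
have AB : A *m B = 1%:M.
  by rewrite mul_row_col !mulmx_base /Q addrC subrK.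
have BA : B *m A = 1%:M.
  rewrite mul_col_row !idempotent_factor // !base_orthogonal //.
  by rewrite -scalar_mx_block.
have PhiV : Phi @` V = Phi @` V0 `&` g @^-1` N.
  apply/seteqP; split=> [_ [x [V0x Nx] <-]|_ [[x V0x <-] /=]].
    by split; [exists x|rewrite /= gK].
  by rewrite gK // => Nx; exists x.
have oPhiV : open (Phi @` V).
  rewrite PhiV; apply: open_preimage_on => // x.
  exact: cdiff_continuous (cg 0).
have imB : (fun x => Phi x *m A) @` V = (fun y => y *m B) @^-1` (Phi @` V).
  apply/seteqP; split=> [_ [x Vx <-]|y [x Vx e]] /=.
    by exists x => //; rewrite -mulmxA AB mulmx1.
  by exists x => //; rewrite e -mulmxA BA mulmx1.
have oB : open ((fun x => Phi x *m A) @` V).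
  rewrite imB; have cB x : setT x -> {for x, continuous (fun y : 'rV[R]_(_ + _) => y *m B)}.
    exact: (cdiff_mulmx openT B (cdiff_id openT 0)).
  by have := open_preimage_on openT oPhiV cB; rewrite setTI.
exists (\rank P), (\rank Q), (fun x => Phi x *m A), (fun y => g (y *m B)), V.
have VU : V `<=` U by move=> x [/V0U].
have oV : open V by exact: openI.
split; split=> //.
- by move=> i; apply: cdiff_mulmx => //; apply: cdiff_sub VU _.
- move=> i; apply: (@cdiff_comp_row _ _ _ _ _ _ (Phi @` V0)) => //.
  + by rewrite imB => y [x [V0x _] <-]; exists x.
  + exact: (cdiff_mulmx _ B (cdiff_id _ _)).
- by move=> x [V0x _]; rewrite -mulmxA AB mulmx1 gK.
move=> x [V0x Nx]; have [hhx V0hx] := NH _ Nx.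
have QA : Q *m col_base Q = col_base Q.
  by rewrite -[X in X *m _](mulmx_base Q) -mulmxA idempotent_factor // mulmx1.
have PA : P *m col_base Q = 0.
  by rewrite -[X in X *m _](mulmx_base P) -mulmxA base_orthogonal // mulmx0.
rewrite mul_mx_row row_mxKr {1}/Phi mulmxDl -!mulmxA PA QA mulmx0 add0r.
split=> [->|e]; first by rewrite subrr mul0mx.
(* If the [Q]-component vanishes, [Phi x] reduces to $h(x)P$, which is also [Phi (h x)]. *)
have xQ : (x - h x) *m Q = 0 by rewrite -(mulmx_base Q) mulmxA e mul0mx.
rewrite -[RHS](gK x V0x) -[LHS](gK (h x) V0hx); congr (g _).
by rewrite /Phi xQ hhx subrr mul0mx.
Qed.

End Retraction.

(** * Smooth maps between open sets of row vectors *)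

Section SmoothOn.
Variable R : realType.

Lemma smooth_onP m n (U : set 'rV[R]_m) (f : 'rV[R]_m -> 'rV[R]_n) :
  smooth_on U f <-> open U /\ forall k, cdiff k U f.
Proof. by split=> -[oU cf]; split=> // k; apply/cdiffE. Qed.

Lemma smooth_on_local m n (U : set 'rV[R]_m) (f : 'rV[R]_m -> 'rV[R]_n) :
  (forall x, U x -> exists V, [/\ V x, V `<=` U & smooth_on V f]) ->
  smooth_on U f.
Proof.
move=> H; have oU : open U.
  rewrite openE => x /H[V [Vx VU [oV _]]]; rewrite /interior.
  by apply: filterS VU _; apply: near_open.
have {}H x : U x -> exists V, [/\ V x, V `<=` U, open V & forall k, cdiff k V f].
  by move=> /H[V [Vx VU /smooth_onP[oV cV]]]; exists V.
apply/smooth_onP; split=> // k.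
suff loc (W : normedModType R) (g : 'rV[R]_m -> W) :
    (forall x, U x -> exists V, [/\ V x, V `<=` U, open V & cdiff k V g]) ->
    cdiff k U g.
  by apply: loc => x /H[V [Vx VU oV cV]]; exists V.
elim: k g => [|k IH] g Hg.
  by move=> x /Hg[V [Vx _ _ cg]]; apply: cg.
split=> [x /Hg[V [Vx _ _ [dg _]]]|v]; first exact: dg.
by apply: IH => x /Hg[V [Vx VU oV [_ Dg]]]; exists V; split=> //; exact: Dg.
Qed.

Lemma smooth_on_sub m n (U V : set 'rV[R]_m) (f : 'rV[R]_m -> 'rV[R]_n) :
  open V -> V `<=` U -> smooth_on U f -> smooth_on V f.
Proof.
move=> oV VU /smooth_onP[_ cf]; apply/smooth_onP; split=> // k.
exact: cdiff_sub VU _.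
Qed.

Lemma eq_smooth_on m n (U : set 'rV[R]_m) (f g : 'rV[R]_m -> 'rV[R]_n) :
  (forall x, U x -> f x = g x) -> smooth_on U f -> smooth_on U g.
Proof.
move=> fg /smooth_onP[oU cf]; apply/smooth_onP; split=> // k.
exact: eq_cdiff fg _.
Qed.

Lemma smooth_on_continuous m n (U : set 'rV[R]_m) (f : 'rV[R]_m -> 'rV[R]_n) x :
  smooth_on U f -> U x -> {for x, continuous f}.
Proof. by move=> [_ /(_ 0)]; apply. Qed.

Lemma smooth_on_preimage m n (U : set 'rV[R]_m) (V : set 'rV[R]_n)
    (f : 'rV[R]_m -> 'rV[R]_n) :
  smooth_on U f -> open V -> open (U `&` f @^-1` V).
Proof.
move=> sf oV; have [oU _] := sf; apply: open_preimage_on => // x.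
exact: smooth_on_continuous.
Qed.

Lemma smooth_on_comp m n p (U : set 'rV[R]_m) (V : set 'rV[R]_n)
    (f : 'rV[R]_m -> 'rV[R]_n) (g : 'rV[R]_n -> 'rV[R]_p) :
  smooth_on U f -> smooth_on V g ->
  smooth_on (U `&` f @^-1` V) (fun x => g (f x)).
Proof.
move=> sf sg; have oUV := smooth_on_preimage sf sg.1.
have [/smooth_onP[oU cf] /smooth_onP[oV cg]] := (sf, sg).
apply/smooth_onP; split=> // k.
apply: cdiff_comp_row (cg k) => // [x [_ //]|].
by apply: cdiff_sub (cf k) => x [].
Qed.

Lemma smooth_on_id m (U : set 'rV[R]_m) : open U -> smooth_on U id.
Proof. by move=> oU; apply/smooth_onP; split=> // k; apply: cdiff_id. Qed.

Lemma smooth_on_cst m n (U : set 'rV[R]_m) (a : 'rV[R]_n) : open U ->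
  smooth_on U (fun _ => a).
Proof. by move=> oU; apply/smooth_onP; split=> // k; apply: cdiff_cst. Qed.

Lemma smooth_on_mulmx m n p (U : set 'rV[R]_m) (f : 'rV[R]_m -> 'rV[R]_n)
    (M : 'M[R]_(n, p)) : smooth_on U f -> smooth_on U (fun x => f x *m M).
Proof.
move=> /smooth_onP[oU cf]; apply/smooth_onP; split=> // k.
exact: cdiff_mulmx.
Qed.

Lemma smooth_on_add m n (U : set 'rV[R]_m) (f g : 'rV[R]_m -> 'rV[R]_n) :
  smooth_on U f -> smooth_on U g -> smooth_on U (fun x => f x + g x).
Proof.
move=> /smooth_onP[oU cf] /smooth_onP[_ cg]; apply/smooth_onP; split=> // k.
exact: cdiffD.
Qed.

Lemma smooth_on_row_mx m n p (U : set 'rV[R]_m) (f : 'rV[R]_m -> 'rV[R]_n)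
    (g : 'rV[R]_m -> 'rV[R]_p) :
  smooth_on U f -> smooth_on U g -> smooth_on U (fun x => row_mx (f x) (g x)).
Proof.
move=> /smooth_onP[oU cf] /smooth_onP[_ cg]; apply/smooth_onP; split=> // k.
exact: cdiff_row_mx.
Qed.

Lemma smooth_on_mxrow m n (q : 'I_n -> nat) (U : set 'rV[R]_m)
    (f : forall i, 'rV[R]_m -> 'rV[R]_(q i)) : open U ->
  (forall i, smooth_on U (f i)) -> smooth_on U (fun x => \mxrow_i f i x).
Proof.
move=> oU cf; apply/smooth_onP; split=> // k; apply: cdiff_rowP => // j.
have /smooth_onP[_ ci] := cf (tagnat.sig1 j).
by apply: (eq_cdiff oU) (cdiff_coord oU (tagnat.sig2 j) (ci k)) => x _;
  rewrite mxE.
Qed.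

(** Extraction of a block is multiplication by a constant matrix, which reduces its smoothness to
    [smooth_on_mulmx]. *)
Lemma submxrowE n (q : 'I_n -> nat) i (v : 'rV[R]_(\sum_i q i)) :
  submxrow v i = v *m submxrow 1%:M i.
Proof. by rewrite mul_submxrow mulmx1. Qed.

Lemma lsubmxE m n (v : 'rV[R]_(m + n)) : lsubmx v = v *m col_mx 1%:M 0.
Proof. by rewrite -{2}(hsubmxK v) mul_row_col mulmx1 mulmx0 addr0. Qed.

Lemma rsubmxE m n (v : 'rV[R]_(m + n)) : rsubmx v = v *m col_mx 0 1%:M.
Proof. by rewrite -{2}(hsubmxK v) mul_row_col mulmx1 mulmx0 add0r. Qed.

Lemma smooth_on_lsubmx m n p (U : set 'rV[R]_m) (f : 'rV[R]_m -> 'rV[R]_(n + p)) :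
  smooth_on U f -> smooth_on U (fun x => lsubmx (f x)).
Proof.
by move=> /(smooth_on_mulmx (col_mx 1%:M 0)); apply: eq_smooth_on => x _;
  rewrite lsubmxE.
Qed.

Lemma smooth_on_rsubmx m n p (U : set 'rV[R]_m) (f : 'rV[R]_m -> 'rV[R]_(n + p)) :
  smooth_on U f -> smooth_on U (fun x => rsubmx (f x)).
Proof.
by move=> /(smooth_on_mulmx (col_mx 0 1%:M)); apply: eq_smooth_on => x _;
  rewrite rsubmxE.
Qed.

Lemma smooth_on_submxrow m n (q : 'I_n -> nat) (U : set 'rV[R]_m)
    (f : 'rV[R]_m -> 'rV[R]_(\sum_i q i)) i :
  smooth_on U f -> smooth_on U (fun x => submxrow (f x) i).
Proof.
by move=> /(smooth_on_mulmx (submxrow 1%:M i)); apply: eq_smooth_on => x _;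
  rewrite submxrowE.
Qed.

End SmoothOn.

(** * Smooth maps *)

(* The manifold axioms without the separation and countability conditions,
   which play no role below. *)
Class premanifold (R : realType) (X : atlas_space R) : Prop := {
  pm_cover : forall x : X, exists2 c, atlas c & chart_dom c x;
  pm_chart : forall c : chart R X, atlas c -> chart_axiom c;
  pm_transition : forall c c' : chart R X, atlas c -> atlas c' ->
    smooth_transition c c' }.

Global Instance manifold_premanifold (R : realType) (X : manifold R) :
  premanifold X.
Proof. by case: (manifoldP X). Qed.

(** A bare set system rather than a topological structure on [X]; the filter instance below gives
    access to the lemmas on filters. *)
Definition anbhs (R : realType) (X : atlas_space R) (p : X) : set_system X :=
  [set P | exists N, [/\ atlas_open N, N p & N `<=` P]].

(** * The topology of the atlas seen in charts *)

Section Charts.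
Variables (R : realType) (X : atlas_space R).
Context {pX : premanifold X}.
Implicit Types (c : chart R X) (W : set X).

Lemma image_chartI c (A B : set X) : chart_axiom c ->
  c @` (chart_dom c `&` (A `&` B)) =
  (c @` (chart_dom c `&` A)) `&` (c @` (chart_dom c `&` B)).
Proof.
move=> [_ cinj]; apply/seteqP; split=> [_ [x [Dx [Ax Bx]] <-]|].
  by split; exists x.
move=> _ [[x [Dx Ax] <-] [y [Dy By] e]].
by exists x => //; split=> //; split=> //; rewrite -(cinj _ _ Dy Dx e).
Qed.

Lemma atlas_openI (A B : set X) :
  atlas_open A -> atlas_open B -> atlas_open (A `&` B).
Proof.
move=> oA oB c ac; rewrite image_chartI; last exact: pm_chart.
by apply: openI; [exact: oA|exact: oB].
Qed.

Lemma atlas_openT : atlas_open (setT : set X).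
Proof. by move=> c /pm_chart[oc _]; rewrite setIT. Qed.

Lemma atlas_open_local W :
  (forall x, W x -> exists N, [/\ atlas_open N, N x & N `<=` W]) ->
  atlas_open W.
Proof.
move=> H c ac; rewrite openE => _ [x [Dx /H[N [oN Nx NW]] <-]].
rewrite /interior; apply: filterS (near_open (oN c ac) _); last by exists x.
by move=> _ [y [Dy Ny] <-]; exists y => //; split=> //; apply: NW.
Qed.

Global Instance anbhs_filter (p : X) : ProperFilter (anbhs p).
Proof.
apply: Build_ProperFilter_ex => [P [N [_ Np NP]]|]; first by exists p; apply: NP.
split.
- by exists setT; split=> //; apply: atlas_openT.
- move=> A B [N [oN Np NA]] [N' [oN' Np' NB]].
  exists (N `&` N'); split=> //; first exact: atlas_openI.
  by move=> x [/NA ? /NB].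
- by move=> A B AB [N [oN Np NA]]; exists N; split=> // x /NA /AB.
Qed.

Lemma anbhs_singleton (p : X) (P : set X) : anbhs p P -> P p.
Proof. by move=> [N [_ Np NP]]; apply: NP. Qed.

Lemma atlas_open_dom c : admissible c -> atlas_open (chart_dom c).
Proof. by move=> [_ ac] c' /ac[_ [h [[]]]]. Qed.

Lemma atlas_admissible c : atlas c -> admissible c.
Proof.
by move=> ac; split=> [|c' ac']; [exact: pm_chart|split; exact: pm_transition].
Qed.

(** Openness is tested on charts of the atlas; near each point the transition to such a chart
    carries it over to an admissible one. *)
Lemma open_image_chart c W : admissible c -> atlas_open W ->
  open (c @` (chart_dom c `&` W)).
Proof.
move=> ac oW; have [cax tr] := ac; rewrite openE => _ [x [Dx Wx] <-].
have [c0 ac0 D0x] := pm_cover x.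
have [[h [sh ch]] _] := tr c0 ac0.
have := smooth_on_preimage sh (oW c0 ac0) => oP.
rewrite /interior; apply: filterS (near_open oP _); last first.
  by split; [exists x|rewrite /= -ch //; exists x].
move=> _ [[y [Dy D0y] <-] [z [D0z Wz] e]]; exists y => //; split=> //.
have [_ inj0] := pm_chart ac0.
by rewrite (inj0 _ _ D0y D0z) // e ch.
Qed.

(** Continuity of a chart for the topology of the atlas. Its counterpart [image_anbhs] says that
    charts are open; together they translate between the two kinds of neighbourhoods. *)
Lemma anbhs_chart c x (P : set 'rV[R]_(chart_dim c)) :
  admissible c -> chart_dom c x ->
  nbhs (c x) P -> anbhs x (fun y => chart_dom c y /\ P (c y)).
Proof.
move=> ac Dx /near_open_nbhd[N [oN Ncx NP]].
exists (chart_dom c `&` c @^-1` N); split=> [|//|y [Dy Ny]]; last first.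
  by split=> //; apply: NP.
apply: atlas_open_local => y [Dy Ny].
have [c0 ac0 D0y] := pm_cover y.
have [_ [h [sh ch]]] := ac.2 c0 ac0.
exists (chart_dom c `&` c @^-1` N) => //; split=> // c1 ac1.
have [_ [h1 [sh1 ch1]]] := ac.2 c1 ac1.
have := smooth_on_preimage sh1 oN; congr open; apply/seteqP; split.
  move=> _ [[z [D1z Dz] <-] /=]; rewrite -ch1 // => Nz.
  by exists z.
move=> _ [z [D1z [Dz Nz]] <-]; split; first by exists z.
by rewrite /= -ch1.
Qed.

Lemma image_anbhs c x (P : set X) : admissible c -> chart_dom c x ->
  anbhs x P -> nbhs (c x) (c @` (chart_dom c `&` P)).
Proof.
move=> ac Dx [N [oN Nx NP]].
apply: filterS (near_open (open_image_chart ac oN) _); last by exists x.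
by move=> _ [y [Dy Ny] <-]; exists y => //; split=> //; apply: NP.
Qed.

Lemma anbhs_dom c x : admissible c -> chart_dom c x -> anbhs x (chart_dom c).
Proof. by move=> /atlas_open_dom oD Dx; exists (chart_dom c); split. Qed.

End Charts.

(** * Compatibility of charts *)

Section Transitions.
Variable R : realType.

(** A transition needs one map on the whole image of the overlap. Injectivity of [c] makes the local
    maps agree, so they glue to [h0], which recovers the point from its coordinates. *)
Lemma smooth_transition_local (T : Type) (c c' : chart R T) :
  (forall x y, chart_dom c x -> chart_dom c y -> c x = c y -> x = y) ->
  (forall x, chart_dom c x -> chart_dom c' x -> exists O h,
     [/\ O (c x), smooth_on O h &
       forall v, O v -> exists z,
         [/\ chart_dom c z, chart_dom c' z, c z = v & c' z = h v]]) ->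
  smooth_transition c c'.
Proof.
move=> cinj H.
pose h0 v := xget 0 [set w | exists z,
  [/\ chart_dom c z, chart_dom c' z, c z = v & c' z = w]].
have h0E z : chart_dom c z -> chart_dom c' z -> h0 (c z) = c' z.
  move=> Dz D'z; rewrite /h0; case: xgetP => [w _ [y [Dy D'y e <-]]|].
    by rewrite (cinj _ _ Dy Dz e).
  by move=> /(_ (c' z)); case; exists z.
exists h0; split; last by move=> x Dx D'x; rewrite h0E.
apply: smooth_on_local => _ [x [Dx D'x] <-].
have [N [h [Nx sh HN]]] := H x Dx D'x.
exists N; split=> //; first by move=> v /HN[z [Dz D'z <- _]]; exists z.
apply: eq_smooth_on sh => v /HN[z [Dz D'z <- <-]].
by rewrite h0E.
Qed.

Variable X : atlas_space R.
Context {pX : premanifold X}.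

(** Near each point the transition factors through a chart of the atlas. *)
Lemma admissible_transition (c c' : chart R X) :
  admissible c -> admissible c' -> smooth_transition c c'.
Proof.
move=> ac ac'; have [[_ cinj] tr] := ac; have [[_ cinj'] tr'] := ac'.
apply: smooth_transition_local => // x Dx D'x.
have [c0 ac0 D0x] := pm_cover x.
have [[h1 [sh1 ch1]] _] := tr c0 ac0; have [_ [h2 [sh2 ch2]]] := tr' c0 ac0.
exists (c @` (chart_dom c `&` chart_dom c0) `&`
   h1 @^-1` (c0 @` (chart_dom c0 `&` chart_dom c'))), (fun v => h2 (h1 v)).
split; first by split; [exists x|rewrite /= -ch1 //; exists x].
  exact: smooth_on_comp.
move=> _ [[z [Dz D0z] <-] [y [D0y D'y]]]; rewrite /= -ch1 // => e.
have [_ inj0] := pm_chart ac0.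
have zy := inj0 _ _ D0y D0z e; rewrite zy in D'y D0y *.
by exists z; split=> //; rewrite ch2.
Qed.

End Transitions.

(** * Smoothness in arbitrary admissible charts *)

Section SmoothMaps.
Variables (R : realType) (X Y : atlas_space R).
Context {pX : premanifold X} {pY : premanifold Y}.
Implicit Types (f : X -> Y) (p : X).

(** [smooth_at] is witnessed by charts of the atlas; composing with transitions allows any
    admissible charts, such as slice charts. [smooth_at_rep] is the converse. *)
Lemma smooth_at_intro f p (c : chart R X) (c' : chart R Y) O
    (h : 'rV[R]_(chart_dim c) -> 'rV[R]_(chart_dim c')) :
  admissible c -> admissible c' -> chart_dom c p ->
  O (c p) -> smooth_on O h ->
  anbhs p (fun x => chart_dom c' (f x) /\ c' (f x) = h (c x)) ->
  smooth_at f p.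
Proof.
move=> ac ac' Dp Ocp sh near_f.
have [c0 ac0 D0p] := [elaborate pm_cover p].
have D'fp : chart_dom c' (f p) by case: (anbhs_singleton near_f).
have [c1 ac1 D1fp] := [elaborate pm_cover (f p)].
have [_ [k [sk ck]]] := ac.2 c0 ac0; have [[k' [sk' ck']] _] := ac'.2 c1 ac1.
have skhk := smooth_on_comp (smooth_on_comp sk sh) sk'.
set U := (X in smooth_on X _) in skhk.
have U0p : U (c0 p).
  rewrite /U /=; split; first by split; [exists p|rewrite /= -ck].
  exists (f p) => //; rewrite /= -ck //.
  by have [_ ->] := [elaborate anbhs_singleton near_f].
have nN : anbhs p (fun x => [/\ chart_dom c0 x, chart_dom c x, U (c0 x) &
    chart_dom c' (f x) /\ c' (f x) = h (c x)]).
  have := [elaborate anbhs_chart (atlas_admissible ac0) D0p (near_open skhk.1 U0p)].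
  have := [elaborate anbhs_dom ac Dp].
  by move: near_f; apply: filterS3 => x ? ? [].
have [N [oN Np HN]] := nN.
exists c0, c1, N, (fun v => k' (h (k v))); split; split=> //.
- by move=> x /HN[].
- move=> x /HN[D0x Dx [[_ _] [y [D'y D1y] e]] [D'fx fxE]].
  rewrite -ck // -fxE in e.
  by have [[_ inj'] _] := ac'; rewrite -(inj' _ _ D'y D'fx e).
- have oc0N : open (c0 @` N).
    have -> : N = chart_dom c0 `&` N.
      by apply/seteqP; split=> [x Nx|x []//]; split=> //; case: (HN x Nx).
    exact: oN.
  by apply: smooth_on_sub oc0N _ skhk => _ [x /HN[_ _ Ux _] <-].
- move=> x /HN[D0x Dx [[_ _] [y [D'y D1y] e]] [D'fx fxE]].
  rewrite -ck // -fxE in e *.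
  have [[_ inj'] _] := ac'; rewrite (inj' _ _ D'y D'fx e) in D1y.
  by rewrite ck'.
Qed.

Lemma smooth_at_rep f p (c : chart R X) (c' : chart R Y) :
  smooth_at f p -> admissible c -> admissible c' ->
  chart_dom c p -> chart_dom c' (f p) -> exists O h,
  [/\ O (c p), smooth_on O h &
   anbhs p (fun x => [/\ chart_dom c x, O (c x), chart_dom c' (f x) &
                         c' (f x) = h (c x)])].
Proof.
move=> [c0 [c1 [N [h [[ac0 ac1 oN Np] [ND D1 sh ch]]]]]] ac ac' Dp D'fp.
have [[k [sk ck]] _] := ac.2 c0 ac0; have [_ [k' [sk' ck']]] := ac'.2 c1 ac1.
have skhk := smooth_on_comp (smooth_on_comp sk sh) sk'.
set U := (X in smooth_on X _) in skhk.
have Up : U (c p).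
  have D0p := ND p Np.
  rewrite /U /=; split; first by split; [exists p|rewrite /= -ck //; exists p].
  by exists (f p); rewrite /= -?ck ?ch //; split=> //; apply: D1.
exists U, (fun v => k' (h (k v))); split=> //.
have nN : anbhs p N by exists N; split.
have := [elaborate anbhs_chart ac Dp (near_open skhk.1 Up)].
move: nN; apply: filterS2 => x Nx [Dx Ux]; split=> //; move: Ux => [[_ _]].
  move=> [y [D1y D'y]]; rewrite /= -ck -?ch //; last exact: ND.
  have [_ inj1] := pm_chart ac1.
  by move=> /(inj1 _ _ D1y (D1 _ Nx)) <-.
move=> [y [D1y D'y]]; rewrite /= -ck -?ch //; last exact: ND.
have [_ inj1] := pm_chart ac1.
by move=> /(inj1 _ _ D1y (D1 _ Nx)) e; rewrite -ck' // -e.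
Qed.

(** Continuity of smooth maps, in the form that pulls conditions near [f p] back to points near
    [p]. *)
Lemma smooth_at_near f p (P : set Y) :
  smooth_at f p -> anbhs (f p) P -> anbhs p (fun x => P (f x)).
Proof.
move=> sf nP; have [c ac Dp] := [elaborate pm_cover p].
have [c' ac' D'fp] := [elaborate pm_cover (f p)].
have aac := [elaborate atlas_admissible ac]; have aac' := [elaborate atlas_admissible ac'].
have [W [h [Ocp sh nf]]] := [elaborate smooth_at_rep sf aac aac' Dp D'fp].
have [_ _ _ fpE] := [elaborate anbhs_singleton nf].
have := [elaborate image_anbhs aac' D'fp nP]; rewrite fpE.
move=> /(smooth_on_continuous sh Ocp) => nh.
have := [elaborate anbhs_chart aac Dp nh].
move: nf; apply: filterS2 => x [_ _ D'fx fxE] [_ [y [D'y Py]]].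
rewrite -fxE => e; have [_ inj'] := pm_chart ac'.
by rewrite -(inj' _ _ D'y D'fx e).
Qed.

Lemma eq_smooth_at f g p :
  anbhs p (fun x => f x = g x) -> smooth_at f p -> smooth_at g p.
Proof.
move=> nfg [c [c' [N [h [[ac ac' oN Np] [ND D' sh ch]]]]]].
have nN : anbhs p N by exists N; split.
have [N' [oN' N'p HN']] : anbhs p (fun x => N x /\ f x = g x).
  exact: filterI nN nfg.
exists c, c', N', h; split; split=> //.
- by move=> x /HN'[/ND].
- by move=> x /HN'[/D' + <-].
- apply: smooth_on_sub sh; last by move=> _ [x /HN'[Nx _] <-]; exists x.
  have -> : N' = chart_dom c `&` N'.
    by apply/seteqP; split=> [x Nx|x []//]; split=> //; apply/ND; case: (HN' x Nx).
  exact: oN'.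
- by move=> x /HN'[/ch + <-].
Qed.

Lemma smooth_at_cst (y : Y) p : smooth_at (fun _ : X => y) p.
Proof.
have [c ac Dp] := [elaborate pm_cover p]; have [c' ac' D'y] := [elaborate pm_cover y].
apply: (smooth_at_intro (O := setT) (h := fun _ => c' y)
  (atlas_admissible ac) (atlas_admissible ac')) => //.
- by apply: smooth_on_cst; apply: openT.
- by apply: filterS filterT => x _.
Qed.

End SmoothMaps.

Section Composition.
Variables (R : realType) (X Y Z : atlas_space R).
Context {pX : premanifold X} {pY : premanifold Y} {pZ : premanifold Z}.

Lemma smooth_at_comp (f : X -> Y) (g : Y -> Z) (p : X) :
  smooth_at f p -> smooth_at g (f p) -> smooth_at (fun x => g (f x)) p.
Proof.
move=> sf sg; have [c ac Dp] := [elaborate pm_cover p].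
have [c' ac' D'fp] := [elaborate pm_cover (f p)].
have [c1 ac1 D1] := [elaborate pm_cover (g (f p))].
have aac := [elaborate atlas_admissible ac]; have aac' := [elaborate atlas_admissible ac'].
have aac1 := [elaborate atlas_admissible ac1].
have [U [h [Up sh nf]]] := [elaborate smooth_at_rep sf aac aac' Dp D'fp].
have [U' [h' [Up' sh' ng]]] := [elaborate smooth_at_rep sg aac' aac1 D'fp D1].
apply: (smooth_at_intro aac aac1 Dp _ (smooth_on_comp sh sh')).
  by split=> //=; have [_ _ _ <-] := [elaborate anbhs_singleton nf].
have := [elaborate smooth_at_near sf ng].
by move: nf; apply: filterS2 => x [_ _ _ fxE] [_ _ D1x ->]; rewrite fxE.
Qed.

Lemma smooth_at_id (p : X) : smooth_at (fun x : X => x) p.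
Proof.
have [c ac Dp] := [elaborate pm_cover p]; have aac := [elaborate atlas_admissible ac].
apply: (smooth_at_intro (O := setT) (h := id) aac aac) => //.
- by apply: smooth_on_id; apply: openT.
- by apply: filterS (anbhs_dom aac Dp).
Qed.

End Composition.

(** * Products, Euclidean spaces and charts *)

Section Euclidean.
Variables (R : realType).

Global Instance euclidean_premanifold n : premanifold (euclidean R n).
Proof.
have ax : chart_axiom (Chart setT (id : euclidean R n -> 'rV[R]_n)).
  by split=> [|x y _ _ //]; rewrite /= image_id; apply: openT.
split.
- by move=> x; exists (Chart setT (id : euclidean R n -> 'rV[R]_n)).
- by move=> c ->.
- move=> c c' -> ->; exists id; split=> //; apply: smooth_on_id.
  by rewrite /= image_id setTI; apply: openT.
Qed.

Lemma euclidean_chart n :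
  admissible (Chart setT (id : euclidean R n -> 'rV[R]_n)).
Proof. exact: atlas_admissible. Qed.

Lemma anbhs_euclidean n (v : euclidean R n) (P : set (euclidean R n)) :
  anbhs v P <-> nbhs (v : 'rV[R]_n) P.
Proof.
split=> nP.
  have := [elaborate image_anbhs (euclidean_chart n) I nP].
  by rewrite /= image_id setTI.
have := [elaborate anbhs_chart (euclidean_chart n) I nP].
by apply: filterS => x [].
Qed.

Lemma smooth_at_euclidean m n (O : set 'rV[R]_m) (f : 'rV[R]_m -> 'rV[R]_n) v :
  smooth_on O f -> O v -> smooth_at (f : euclidean R m -> euclidean R n) v.
Proof.
move=> sf Ov.
apply: (smooth_at_intro (euclidean_chart m) (euclidean_chart n) I Ov sf).
by apply: filterS filterT => x _.
Qed.

Variable (X : atlas_space R).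
Context {pX : premanifold X}.

Lemma smooth_at_chart (c : chart R X) p : admissible c -> chart_dom c p ->
  smooth_at (fun x => c x : euclidean R (chart_dim c)) p.
Proof.
move=> ac Dp.
apply: (smooth_at_intro ac (euclidean_chart (chart_dim c)) Dp (O := setT)) => //.
  by apply: smooth_on_id; apply: openT.
by apply: filterS filterT => x _.
Qed.

(** The inverse is made total by the value [p] off the image, so that it can be composed with maps
    that stay in the image only near a point. *)
Lemma chart_inverse (c : chart R X) (p : X) : admissible c -> chart_dom c p ->
  exists g : euclidean R (chart_dim c) -> X,
  [/\ smooth_at g (c p), anbhs p (fun x => g (c x) = x) &
      anbhs (c p : euclidean R _) (fun v => chart_dom c (g v) /\ c (g v) = v)].
Proof.
move=> ac Dp; have [[oc cinj] _] := ac.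
pose g v := if pselect (exists x, chart_dom c x /\ c x = v) is left e
  then sval (cid e) else p.
have gP x : chart_dom c x -> g (c x) = x.
  move=> Dx; rewrite /g; case: pselect => [e|[]]; last by exists x.
  by case: cid => y /= [Dy]; apply: cinj.
have nD : anbhs (c p : euclidean R _) (fun v => chart_dom c (g v) /\ c (g v) = v).
  apply/anbhs_euclidean; apply: filterS (near_open oc _); last by exists p.
  by move=> _ [x Dx <-]; rewrite gP.
exists g; split=> //.
- apply: (smooth_at_intro (euclidean_chart (chart_dim c)) ac I (O := setT)) => //;
    [by apply: smooth_on_id; apply: openT | exact: nD].
- by apply: filterS (anbhs_dom ac Dp) => x /gP.
Qed.

Lemma smooth_at_row_mx m n (f : X -> euclidean R m) (g : X -> euclidean R n) p :
  smooth_at f p -> smooth_at g p ->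
  smooth_at (fun x => row_mx (f x) (g x) : euclidean R (m + n)) p.
Proof.
move=> sf sg; have [c ac Dp] := pm_cover p; have aac := [elaborate atlas_admissible ac].
have [U [h [Up sh nf]]] := [elaborate smooth_at_rep sf aac (euclidean_chart m) Dp I].
have [W [k [Wp sk ng]]] := [elaborate smooth_at_rep sg aac (euclidean_chart n) Dp I].
have oUW : open (U `&` W) by apply: openI; [case: sh|case: sk].
have shk := smooth_on_row_mx (smooth_on_sub oUW (@subIsetl _ U W) sh)
                             (smooth_on_sub oUW (@subIsetr _ U W) sk).
apply: (smooth_at_intro aac (euclidean_chart (m + n)) Dp (conj Up Wp) shk).
by apply: filterS2 nf ng => x [_ _ _ /= ->] [_ _ _ /= ->].
Qed.

Lemma smooth_at_postcomp m n (f : X -> euclidean R m) (h : 'rV[R]_m -> 'rV[R]_n) p :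
  smooth_at f p -> smooth_on setT h ->
  smooth_at (fun x => h (f x) : euclidean R n) p.
Proof. by move=> sf sh; apply: smooth_at_comp sf (smooth_at_euclidean sh _). Qed.

Lemma smooth_at_rsubmx m n (f : X -> euclidean R (m + n)) p : smooth_at f p ->
  smooth_at (fun x => rsubmx (f x : 'rV[R]_(m + n)) : euclidean R n) p.
Proof.
move=> sf; apply: (smooth_at_postcomp (h := rsubmx) sf).
by apply: smooth_on_rsubmx; apply: smooth_on_id; apply: openT.
Qed.

Lemma smooth_at_add n (f g : X -> euclidean R n) p :
  smooth_at f p -> smooth_at g p ->
  smooth_at (fun x => (f x : 'rV[R]_n) + g x : euclidean R n) p.
Proof.
move=> sf sg.
have sid : smooth_on setT (id : 'rV[R]_(n + n) -> _) by apply: smooth_on_id; apply: openT.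
have := [elaborate smooth_at_postcomp (smooth_at_row_mx sf sg)
  (smooth_on_add (smooth_on_lsubmx sid) (smooth_on_rsubmx sid))].
by apply: eq_smooth_at; apply: filterS filterT => x _; rewrite row_mxKl row_mxKr.
Qed.

Lemma smooth_at_scale n (a : R) (f : X -> euclidean R n) p : smooth_at f p ->
  smooth_at (fun x => a *: (f x : 'rV[R]_n) : euclidean R n) p.
Proof.
move=> sf; apply: (smooth_at_postcomp (h := *:%R a) sf).
have sid : smooth_on setT (id : 'rV[R]_n -> _) by apply: smooth_on_id; apply: openT.
apply: eq_smooth_on (smooth_on_mulmx a%:M sid) => x _.
by rewrite mul_mx_scalar.
Qed.

End Euclidean.

Section Product.
Variables (R : realType) (X Y : atlas_space R).
Context {pX : premanifold X} {pY : premanifold Y}.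

Let pchart (a : chart R X) (b : chart R Y) : chart R (prod_space X Y) :=
  Chart (chart_dom a `*` chart_dom b)
        (fun p : X * Y => row_mx (a p.1) (b p.2)).

Lemma image_prod_chart a b (A : set X) (B : set Y) :
  pchart a b @` (A `*` B) =
  lsubmx @^-1` (a @` A) `&` rsubmx @^-1` (b @` B).
Proof.
apply/seteqP; split=> [_ [[x y] [/= Ax By] <-]|v [[x Ax ex] [y By ey]]].
  by split; rewrite /= ?row_mxKl ?row_mxKr; [exists x|exists y].
by exists (x, y) => //=; rewrite ex ey hsubmxK.
Qed.

Lemma smooth_prod_chart m n m' n' (U : set 'rV[R]_m) (V : set 'rV[R]_n)
    (f : 'rV[R]_m -> 'rV[R]_m') (g : 'rV[R]_n -> 'rV[R]_n') :
  smooth_on U f -> smooth_on V g ->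
  smooth_on (lsubmx @^-1` U `&` rsubmx @^-1` V)
            (fun v : 'rV[R]_(m + n) => row_mx (f (lsubmx v)) (g (rsubmx v))).
Proof.
move=> sf sg.
have sid : smooth_on setT (id : 'rV[R]_(m + n) -> _) by apply: smooth_on_id; apply: openT.
have sfl := smooth_on_comp (smooth_on_lsubmx sid) sf.
have sgr := smooth_on_comp (smooth_on_rsubmx sid) sg.
rewrite setTI in sfl; rewrite setTI in sgr.
have oUV := openI sfl.1 sgr.1.
exact: smooth_on_row_mx (smooth_on_sub oUV (@subIsetl _ _ _) sfl)
                        (smooth_on_sub oUV (@subIsetr _ _ _) sgr).
Qed.

Global Instance prod_premanifold : premanifold (prod_space X Y).
Proof.
split.
- move=> [x y]; have [a aa Dx] := pm_cover x; have [b ab Dy] := pm_cover y.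
  by exists (pchart a b) => //; exists a, b.
- move=> _ [a [b [aa ab ->]]]; have [oa inja] := pm_chart aa.
  have [ob injb] := pm_chart ab; split.
    rewrite [X in open X](image_prod_chart a b).
    have := smooth_prod_chart (smooth_on_id oa) (smooth_on_id ob).
    by case.
  move=> [x y] [x' y'] [/= Dx Dy] [/= Dx' Dy'] /eq_row_mx[ex ey].
  by rewrite (inja _ _ Dx Dx' ex) (injb _ _ Dy Dy' ey).
- move=> _ _ [a [b [aa ab ->]]] [a' [b' [aa' ab' ->]]].
  have [f [sf cf]] := [elaborate pm_transition aa aa'].
  have [g [sg cg]] := [elaborate pm_transition ab ab'].
  exists (fun v => row_mx (f (lsubmx v)) (g (rsubmx v))); split; last first.
    move=> [x y] [/= Dx Dy] [/= Dx' Dy'].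
    by rewrite row_mxKl row_mxKr -cf // -cg.
  rewrite [X in smooth_on X](_ : _ = lsubmx @^-1` (a @` (chart_dom a `&` chart_dom a'))
     `&` rsubmx @^-1` (b @` (chart_dom b `&` chart_dom b'))).
    exact: smooth_prod_chart.
  rewrite -image_prod_chart; congr (image _ _).
  by apply/seteqP; split=> [[x y] [[/= ? ?] [/= ? ?]]|[x y] [[/= ? ?] [/= ? ?]]].
Qed.

Lemma prod_chart_admissible a b : atlas a -> atlas b -> admissible (pchart a b).
Proof.
by move=> aa ab; apply: atlas_admissible; exists a, b.
Qed.

Lemma smooth_at_fst (p : X * Y) : smooth_at (fun q : prod_space X Y => q.1) p.
Proof.
have [a aa Da] := pm_cover p.1; have [b ab Db] := pm_cover p.2.
have sid : smooth_on setT (id : 'rV[R]_(chart_dim a + chart_dim b) -> _).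
  by apply: smooth_on_id; apply: openT.
have aab := [elaborate prod_chart_admissible aa ab].
apply: (smooth_at_intro aab (atlas_admissible aa) _ _ (smooth_on_lsubmx sid)) => //.
apply: filterS (anbhs_dom aab _) => // -[x y] [/= Dx Dy].
by rewrite row_mxKl.
Qed.

Lemma smooth_at_snd (p : X * Y) : smooth_at (fun q : prod_space X Y => q.2) p.
Proof.
have [a aa Da] := pm_cover p.1; have [b ab Db] := pm_cover p.2.
have sid : smooth_on setT (id : 'rV[R]_(chart_dim a + chart_dim b) -> _).
  by apply: smooth_on_id; apply: openT.
have aab := [elaborate prod_chart_admissible aa ab].
apply: (smooth_at_intro aab (atlas_admissible ab) _ _ (smooth_on_rsubmx sid)) => //.
apply: filterS (anbhs_dom aab _) => // -[x y] [/= Dx Dy].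
by rewrite row_mxKr.
Qed.

Lemma smooth_at_pair (Z : atlas_space R) {pZ : premanifold Z} (f : Z -> X)
    (g : Z -> Y) (z : Z) : smooth_at f z -> smooth_at g z ->
  smooth_at (fun w => (f w, g w) : prod_space X Y) z.
Proof.
move=> sf sg; have [c ac Dz] := pm_cover z; have aac := [elaborate atlas_admissible ac].
have [a aa Da] := pm_cover (f z); have [b ab Db] := pm_cover (g z).
have [U [h [Up sh nf]]] :=
  [elaborate smooth_at_rep sf aac (atlas_admissible aa) Dz Da].
have [W [k [Wp sk ng]]] :=
  [elaborate smooth_at_rep sg aac (atlas_admissible ab) Dz Db].
have oUW : open (U `&` W) by apply: openI; [case: sh|case: sk].
have shk := smooth_on_row_mx (smooth_on_sub oUW (@subIsetl _ U W) sh)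
                             (smooth_on_sub oUW (@subIsetr _ U W) sk).
apply: (smooth_at_intro aac (prod_chart_admissible aa ab) Dz (conj Up Wp) shk).
by apply: filterS2 nf ng => x [_ _ Dfx /= ->] [_ _ Dgx /= ->].
Qed.

End Product.

Section FiniteProduct.
Variables (R : realType) (I : finType) (X : I -> atlas_space R).
Context {pX : forall i, premanifold (X i)}.

Let pchart (a : forall i, chart R (X i)) : chart R (pi_space X) :=
  Chart [set x : forall i, X i | forall i, chart_dom (a i) (x i)]
        (fun x : forall i, X i => \mxrow_(k < #|I|)
           a (enum_val k) (x (enum_val k))).

Lemma enum_val_ind (P : I -> Prop) : (forall k : 'I_#|I|, P (enum_val k)) ->
  forall i, P i.
Proof. by move=> H i; rewrite -(enum_rankK i). Qed.

Lemma pi_charts (x : forall i, X i) : exists a : forall i, chart R (X i),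
  forall i, atlas (a i) /\ chart_dom (a i) (x i).
Proof.
exists (fun i => s2val (cid2 (pm_cover (x i)))) => i.
by case: cid2.
Qed.

Lemma image_pi_chart a (A : forall i, set (X i)) :
  pchart a @` [set x | forall i, A i (x i)] =
  [set v | forall k, (a (enum_val k) @` A (enum_val k)) (submxrow v k)].
Proof.
apply/seteqP; split=> [_ [x Ax <-] k|v H].
  by rewrite /= mxrowK; exists (x (enum_val k)).
(* The point is chosen for [i] itself and its coordinates are transported along every equation
   [enum_val k = i]; taking [k] with [erefl] at the end avoids a cast along [enum_rankK]. *)
have H' i : exists x, A i x /\
    forall k (e : enum_val k = i),
      a i x = ecast j ('rV[R]_(chart_dim (a j))) e (submxrow v k).
  elim/enum_val_ind: i => k; have [x Ax xE] := H k; exists x; split=> // k' e.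
  have kk : k' = k by exact: enum_val_inj.
  by rewrite kk in e *; rewrite eq_axiomK.
exists (fun i => sval (cid (H' i))) => [i|].
  by case: cid => x [].
rewrite /= -[RHS]submxrowK; apply: eq_mxrow => k.
by case: cid => x [Ax] /= /(_ k erefl) ->.
Qed.

Lemma smooth_pi_chart n (q q' : 'I_n -> nat) (U : forall k, set 'rV[R]_(q k))
    (f : forall k, 'rV[R]_(q k) -> 'rV[R]_(q' k)) :
  (forall k, smooth_on (U k) (f k)) ->
  smooth_on [set v : 'rV[R]_(\sum_k q k) | forall k, U k (submxrow v k)]
            (fun v => \mxrow_k f k (submxrow v k)).
Proof.
move=> sf.
have sid : smooth_on setT (id : 'rV[R]_(\sum_k q k) -> _).
  by apply: smooth_on_id; apply: openT.
have sfk k : smooth_on ((fun v : 'rV[R]_(\sum_k q k) => submxrow v k) @^-1` U k)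
    (fun v => f k (submxrow v k)).
  by have := smooth_on_comp (smooth_on_submxrow k sid) (sf k); rewrite setTI.
have oU : open [set v : 'rV[R]_(\sum_k q k) | forall k, U k (submxrow v k)].
  rewrite openE => v Uv; have nU k := near_open (sfk k).1 (Uv k).
  exact: (filter_forall (nbhs_filter v) nU).
apply: smooth_on_mxrow => // k; apply: smooth_on_sub (sfk k) => // v; exact.
Qed.

Global Instance pi_premanifold : premanifold (pi_space X).
Proof.
split.
- move=> x; have [a aD] := pi_charts x.
  exists (pchart a) => [|i]; last by case: (aD i).
  by exists a; split=> // i; case: (aD i).
- move=> _ [a [aa ->]]; split.
    have soid (k : 'I_#|I|) : smooth_on
        (a (enum_val k) @` chart_dom (a (enum_val k))) id.
      by apply: smooth_on_id; case: (pm_chart (aa (enum_val k))).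
    have := (smooth_pi_chart soid).1.
    by rewrite -(image_pi_chart a (fun i => chart_dom (a i))).
  move=> x y Dx Dy e; apply: functional_extensionality_dep.
  apply: enum_val_ind => k; apply: (pm_chart (aa (enum_val k))).2 => //.
  by have := congr1 (fun v => submxrow v k) e; rewrite !mxrowK.
- move=> _ _ [a [aa ->]] [a' [aa' ->]].
  have tr i : smooth_transition (a i) (a' i) by apply: pm_transition.
  pose f (k : 'I_#|I|) := sval (cid (tr (enum_val k))).
  have fP (k : 'I_#|I|) := svalP (cid (tr (enum_val k))).
  exists (fun v => \mxrow_k f k (submxrow v k)); split; last first.
    move=> x Dx Dx'; apply: eq_mxrow => k.
    by rewrite mxrowK; apply: (fP k).2.
  rewrite [X in smooth_on X](_ : _ = [set v | forall k,
    (a (enum_val k) @` (chart_dom (a (enum_val k)) `&` chart_dom (a' (enum_val k))))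
      (submxrow v k)]).
    exact: (smooth_pi_chart (fun k => (fP k).1)).
  rewrite -(image_pi_chart a (fun i => chart_dom (a i) `&` chart_dom (a' i))).
  congr (image _ _); apply/seteqP.
  by split=> [x [Dx Dx'] i|x Dx]; [split|split=> i; case: (Dx i)].
Qed.

Lemma smooth_at_proj (i : I) (p : pi_space X) :
  smooth_at (fun x : pi_space X => (x : forall j, X j) i) p.
Proof.
elim/enum_val_ind: i => k.
have [a /all_and2[aa Dp]] := pi_charts p.
have ap : admissible (pchart a) by apply: atlas_admissible; exists a.
have sid : smooth_on setT (id : 'rV[R]_(chart_dim (pchart a)) -> _).
  by apply: smooth_on_id; apply: openT.
apply: (smooth_at_intro ap (atlas_admissible (aa (enum_val k))) Dp _
  (smooth_on_submxrow k sid)) => //.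
apply: filterS (anbhs_dom ap Dp) => x Dx; split; first exact: Dx.
by rewrite /= mxrowK.
Qed.

Lemma smooth_at_tuple (Z : atlas_space R) {pZ : premanifold Z}
    (f : forall i, Z -> X i) (z : Z) : (forall i, smooth_at (f i) z) ->
  smooth_at (fun w => (fun i => f i w) : pi_space X) z.
Proof.
move=> sf; have [c ac Dz] := pm_cover z.
have aac := [elaborate atlas_admissible ac].
have [a /all_and2[aa Df]] := pi_charts (fun i => f i z).
have ap : admissible (pchart a) by apply: atlas_admissible; exists a.
have rep (k : 'I_#|I|) := [elaborate smooth_at_rep (sf (enum_val k)) aac
  (atlas_admissible (aa (enum_val k))) Dz (Df (enum_val k))].
pose U k := sval (cid (rep k)).
pose h k := sval (cid (svalP (cid (rep k)))).
have hP k : [/\ U k (c z), smooth_on (U k) (h k) & anbhs z (fun x =>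
    [/\ chart_dom c x, U k (c x), chart_dom (a (enum_val k)) (f (enum_val k) x) &
      a (enum_val k) (f (enum_val k) x) = h k (c x)])].
  exact: (svalP (cid (svalP (cid (rep k))))).
pose W := [set v | forall k, U k v].
have oW : open W.
  rewrite openE => v Wv.
  have nU k : nbhs v (U k) by case: (hP k) => _ [oU _] _; exact: near_open (Wv k).
  exact: (filter_forall (nbhs_filter v) nU).
have sh : smooth_on W (fun v => \mxrow_k h k v).
  apply: smooth_on_mxrow => // k; have [_ shk _] := hP k.
  by apply: smooth_on_sub shk => // v; apply.
have Wz : W (c z) by move=> k; case: (hP k).
apply: (smooth_at_intro aac ap Dz Wz sh).
have nf k : anbhs z (fun x => chart_dom (a (enum_val k)) (f (enum_val k) x) /\
      a (enum_val k) (f (enum_val k) x) = h k (c x)).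
  by have [_ _] := hP k; apply: filterS => x [].
have := [elaborate filter_forall (anbhs_filter z) nf].
apply: filterS => x H; split; first by apply: enum_val_ind => k; case: (H k).
by apply: eq_mxrow => k; case: (H k).
Qed.

End FiniteProduct.

(** * Embedded submanifolds *)

(* Lets instance resolution supply the premanifold structure of a subspace from a proof of
   embeddedness. *)
Existing Class embedded_submanifold.

Section Induced.
Variables (R : realType) (X : atlas_space R) (S : set X).
Context {pX : premanifold X}.

Let ichart k l (U : set X) (phi : X -> 'rV[R]_(k + l)) :
    chart R (induced_space S) :=
  Chart (fun p : set_type S => U (val p))
        (fun p : set_type S => lsubmx (phi (val p))).

Let emb k (l : nat) (v : 'rV[R]_k) : 'rV[R]_(k + l) := row_mx v 0.

Lemma smooth_on_emb k l : smooth_on setT (@emb k l).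
Proof.
have oT : open (setT : set 'rV[R]_k) by apply: openT.
by apply: smooth_on_row_mx; [exact: smooth_on_id|exact: smooth_on_cst].
Qed.

(** In slice coordinates the points of [S] are those of the form $(v,0)$, so the image in the
    subspace chart is a preimage under $v\mapsto(v,0)$, whence its openness. *)
Lemma image_induced_chart k l (U W : set X) (phi : X -> 'rV[R]_(k + l)) :
  slice_chart S U phi -> W `<=` U ->
  (ichart U phi) @` (fun p : set_type S => W (val p)) =
  @emb k l @^-1` (phi @` W).
Proof.
move=> [_ HS] WU; apply/seteqP; split=> [_ [p Wp <-]|v [x Wx e]] /=.
  exists (val p) => //; have Sp : S (val p) by apply/set_mem/valP.
  by rewrite -[LHS]hsubmxK ((HS _ (WU _ Wp)).1 Sp).
have Sx : S x by apply/HS; [exact: WU|rewrite e /emb row_mxKr].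
exists (SigSub (mem_set Sx)); first exact: Wx.
by rewrite /= e /emb row_mxKl.
Qed.

Global Instance induced_premanifold {eS : embedded_submanifold S} :
  premanifold (induced_space S).
Proof.
split.
- move=> p; have Sp : S (val p) by apply/set_mem/valP.
  have [k [l [U [phi [sl Up]]]]] := eS _ Sp.
  by exists (ichart U phi) => //; exists k, l, U, phi.
- move=> _ [k [l [U [phi [sl ->]]]]].
  have [[[oU injU] _] HS] := sl; split.
    rewrite [X in open X](image_induced_chart sl (fun x Ux => Ux)).
    have := smooth_on_preimage (smooth_on_emb k l) oU.
    by rewrite setTI.
  move=> p q /= Up Uq e; apply/val_inj/injU => //=.
  have [Sp Sq] : S (val p) /\ S (val q) by split; apply/set_mem/valP.
  rewrite -[LHS]hsubmxK -[RHS]hsubmxK e.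
  by rewrite ((HS _ Up).1 Sp) ((HS _ Uq).1 Sq).
- move=> _ _ [k [l [U [phi [sl ->]]]]] [k' [l' [U' [phi' [sl' ->]]]]].
  have [au _] := sl; have [au' _] := sl'.
  have [h [sh ch]] := admissible_transition au au'.
  exists (fun v => lsubmx (h (emb l v))); split; last first.
    move=> p /= Up U'p; have /= -> := ch _ Up U'p; congr (lsubmx (h _)).
    rewrite -[LHS]hsubmxK; congr row_mx.
    by apply/sl.2 => //; apply/set_mem/valP.
  have := smooth_on_lsubmx (smooth_on_comp (smooth_on_emb k l) sh).
  have := image_induced_chart sl (@subIsetl _ U U').
  by rewrite setTI => <-.
Qed.

Context {eS : embedded_submanifold S}.

Lemma slice_charts (p : induced_space S) : exists k l (U : set X)
    (phi : X -> 'rV[R]_(k + l)),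
  [/\ slice_chart S U phi, U (incl p) & admissible (ichart U phi)].
Proof.
have Sp : S (val p) by apply/set_mem/valP.
have [k [l [U [phi [sl Up]]]]] := eS Sp; exists k, l, U, phi; split=> //.
by apply: atlas_admissible; exists k, l, U, phi.
Qed.

Lemma in_subspace (p : induced_space S) : S (incl p).
Proof. exact/set_mem/valP. Qed.

Lemma smooth_at_incl (p : induced_space S) : smooth_at (@incl R X S) p.
Proof.
have [k [l [U [phi [sl Up ai]]]]] := slice_charts p.
apply: (smooth_at_intro ai sl.1 Up I (smooth_on_emb k l)).
apply: filterS (anbhs_dom ai Up) => q Uq; split; first exact: Uq.
rewrite -[LHS]hsubmxK /emb; congr row_mx.
by apply/sl.2 => //; apply: in_subspace.
Qed.

Lemma smooth_at_corestrict (Z : atlas_space R) {pZ : premanifold Z}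
    (f : Z -> induced_space S) z :
  smooth_at (fun w => incl (f w)) z -> smooth_at f z.
Proof.
move=> sf; have [k [l [U [phi [sl Up ai]]]]] := slice_charts (f z).
have [c ac Dz] := pm_cover z; have aac := [elaborate atlas_admissible ac].
have [W [h [Wz sh nf]]] := [elaborate smooth_at_rep sf aac sl.1 Dz Up].
apply: (smooth_at_intro aac ai Dz Wz (smooth_on_lsubmx sh)).
by apply: filterS nf => x [_ _ Ux /= e]; split=> //; rewrite -e.
Qed.

(** A point near [p] is sent to the point of [S] with the same first slice coordinates; where there
    is none, the value is [p]. *)
Lemma local_retraction (p : induced_space S) : exists r : X -> induced_space S,
  smooth_at r (incl p) /\ anbhs (incl p) (fun x => S x -> incl (r x) = x).
Proof.
have [k [l [U [phi [sl Up ai]]]]] := slice_charts p.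
have [au HS] := sl; have [[oU injU] _] := au.
pose r x := if pselect (exists q : induced_space S,
    U (incl q) /\ lsubmx (phi (incl q)) = lsubmx (phi x)) is left e
  then sval (cid e) else p.
have rE x : (exists q : induced_space S,
    U (incl q) /\ lsubmx (phi (incl q)) = lsubmx (phi x)) ->
    U (incl (r x)) /\ lsubmx (phi (incl (r x))) = lsubmx (phi x).
  by move=> e; rewrite /r; case: pselect => // e'; case: cid.
have embE x : S x -> U x -> emb l (lsubmx (phi x)) = phi x.
  by move=> Sx Ux; rewrite -[RHS]hsubmxK ((HS x Ux).1 Sx).
exists r; split; last first.
  apply: filterS (anbhs_dom au Up) => x Ux Sx.
  have [|Ur e] := rE x; first by exists (SigSub (mem_set Sx)).
  apply: injU => //=; rewrite -(embE _ Sx Ux) -e embE //.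
  exact: in_subspace.
have sid : smooth_on setT (id : 'rV[R]_(k + l) -> _).
  by apply: smooth_on_id; apply: openT.
apply: (smooth_at_intro au ai Up (O := setT) _ (smooth_on_lsubmx sid)) => //.
have oE := smooth_on_preimage (smooth_on_comp (smooth_on_lsubmx sid) (smooth_on_emb k l)) oU.
have pE : ((setT `&` lsubmx @^-1` setT) `&`
    (fun v => emb l (lsubmx v)) @^-1` (phi @` U)) (phi (incl p)).
  by split=> //; exists (incl p) => //=; rewrite embE //; apply: in_subspace.
apply: filterS (anbhs_chart au Up (near_open oE pE)) => x /= [Ux [_ [y Uy ye]]].
apply: rE; have Sy : S y by apply/HS => //; rewrite ye row_mxKr.
by exists (SigSub (mem_set Sy)); split=> //=; rewrite ye row_mxKl.
Qed.

(** Here [f] may leave [S] near [z], and the lift follows it only where it stays in [S]. This turns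
    coordinates on an ambient space into maps to a subspace. *)
Lemma smooth_lift (Z : atlas_space R) {pZ : premanifold Z} (f : Z -> X) z :
  smooth_at f z -> S (f z) -> exists g : Z -> induced_space S,
  smooth_at g z /\ anbhs z (fun w => S (f w) -> incl (g w) = f w).
Proof.
move=> sf Sfz.
have [r [sr nr]] := local_retraction (SigSub (mem_set Sfz) : induced_space S).
exists (fun w => r (f w)); split; first exact: smooth_at_comp sf sr.
exact: smooth_at_near sf nr.
Qed.

End Induced.

(** * Maps that are smooth on a subspace *)

Section MapsFromSubspaces.
Variables (R : realType) (X Y : atlas_space R) (S : set X).
Context {pX : premanifold X} {pY : premanifold Y}.

(** Smoothness at a point provides a chart of the induced atlas around it, which is a slice chart by
    construction. Thus the smoothness of the multiplication and of the splitting contains the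
    embeddedness of their domains. *)
Lemma smooth_map_embedded (f : induced_space S -> Y) :
  smooth_map f -> embedded_submanifold S.
Proof.
move=> sf p Sp; have [c [c' [N [h [[ac _ _ Np] [ND _ _ _]]]]]] :=
  sf (SigSub (mem_set Sp)).
move: ac Np ND => [k [l [U [phi [sl ->]]]]] Np /(_ _ Np) /= Up.
by exists k, l, U, phi.
Qed.

(** Serves operations such as [gr_mul] and [sigma], which are total as functions but assumed smooth
    only on a subspace. *)
Lemma smooth_at_restrict (Z : atlas_space R) {pZ : premanifold Z} (f : X -> Y)
    (a : Z -> X) z :
  smooth_map (fun p : induced_space S => f (incl p)) -> smooth_at a z ->
  anbhs z (fun w => S (a w)) -> smooth_at (fun w => f (a w)) z.
Proof.
move=> sf sa nS; have eS := smooth_map_embedded sf.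
have [g [sg ng]] := [elaborate smooth_lift sa (anbhs_singleton nS)].
apply: eq_smooth_at (smooth_at_comp sg (sf (g z))).
by apply: filterS2 ng nS => w /[apply] ->.
Qed.

End MapsFromSubspaces.

(** * Images of local retractions *)

Section RetractionLemma.
Variables (R : realType) (X : atlas_space R).
Context {pX : premanifold X}.

Lemma admissible_comp (c : chart R X) n (V : set 'rV[R]_(chart_dim c))
    (phi : 'rV[R]_(chart_dim c) -> 'rV[R]_n) (psi : 'rV[R]_n -> 'rV[R]_(chart_dim c))
    (N : set X) :
  admissible c -> smooth_on V phi -> smooth_on (phi @` V) psi ->
  (forall v, V v -> psi (phi v) = v) -> atlas_open N ->
  admissible (Chart (chart_dom c `&` (N `&` c @^-1` V)) (fun x => phi (c x))).
Proof.
move=> ac sphi spsi psiK oN; have [[oc injc] tr] := ac.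
set c1 := Chart _ _.
have inj1 x y : chart_dom c1 x -> chart_dom c1 y -> c1 x = c1 y -> x = y.
  move=> [Dx [_ Vx]] [Dy [_ Vy]] /= e; apply: injc => //.
  by rewrite -(psiK _ Vx) e psiK.
have oN' := [elaborate open_image_chart ac oN].
split.
  split=> //; have := smooth_on_preimage spsi oN'.
  congr open; apply/seteqP; split.
    move=> _ [[v Vv <-] [x [Dx Nx] e]]; rewrite psiK // in e.
    by exists x; rewrite /= ?e //; split=> //; split.
  move=> _ [x [Dx [Nx Vx]] <-]; split; first by exists (c x).
  by rewrite /= psiK //; exists x.
move=> c' ac'; have [[t1 [st1 ct1]] [t2 [st2 ct2]]] := tr c' ac'.
split; apply: smooth_transition_local => //.
- move=> x [Dx [Nx Vx]] D'x.
  have oND' := [elaborate atlas_openI oN (atlas_open_dom (atlas_admissible ac'))].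
  have oN2 := [elaborate open_image_chart ac oND'].
  have o1 := smooth_on_preimage spsi oN2.
  have s1 := smooth_on_comp spsi st1.
  exists (phi @` V `&` psi @^-1` (c @` (chart_dom c `&` (N `&` chart_dom c')))).
  exists (fun v => t1 (psi v)); split.
  + by split; [exists (c x)|rewrite /= psiK //; exists x].
  + apply: smooth_on_sub s1 => // v [fv [y [Dy [Ny D'y]] e]]; split=> //.
    by exists y.
  + move=> _ [[v Vv <-] [y [Dy [Ny D'y]] e]]; rewrite psiK // in e.
    exists y; split=> //.
    * by split=> //; split=> //=; rewrite /= e.
    * by rewrite /= e.
    * by rewrite psiK // ct1 // e.
- by case: (pm_chart ac').
- move=> x D'x [Dx [Nx Vx]].
  have oN2 := [elaborate atlas_openI (atlas_open_dom ac) oN].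
  have s1 := smooth_on_comp st2 sphi.
  exists ((c' @` (chart_dom c' `&` (chart_dom c `&` N))) `&`
    (c' @` (chart_dom c' `&` chart_dom c) `&` t2 @^-1` V)), (fun v => phi (t2 v)).
  split.
  + by split; [exists x|split; [exists x|rewrite /= -ct2]].
  + apply: (smooth_on_sub _ _ s1); last by move=> v [].
    by apply: openI; [exact: oN2|case: s1].
  + move=> _ [[y [D'y [Dy Ny]] <-] [_ Vy]]; rewrite /= -ct2 // in Vy.
    by exists y; split=> //; rewrite -ct2.
Qed.

(** Near [p] the set [S] consists of the fixed points of [rho]: its points are fixed, and a fixed
    point lies in [S] because [rho] takes values there. In a chart [rho] becomes an idempotent map
    to be straightened. *)
Lemma retract_slice_chart (S : set X) (p : X) (rho : X -> X) :
  S p -> smooth_at rho p -> anbhs p (fun x => S (rho x)) ->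
  anbhs p (fun x => S x -> rho x = x) ->
  exists k l (U : set X) (phi : X -> 'rV[R]_(k + l)),
    slice_chart S U phi /\ U p.
Proof.
move=> Sp srho nS nrho; have [c ac0 Dp] := [elaborate pm_cover p].
have ac := [elaborate atlas_admissible ac0]; have [_ injc] := [elaborate pm_chart ac0].
have rp : rho p = p by apply: (anbhs_singleton nrho).
have Dr : chart_dom c (rho p) by rewrite rp.
have [W [h [Wp sh nh]]] := [elaborate smooth_at_rep srho ac ac Dp Dr].
pose P x := [/\ chart_dom c x, W (c x), chart_dom c (rho x) & c (rho x) = h (c x)] /\
  (S (rho x) /\ (S x -> rho x = x)).
have nP : anbhs p P by apply: filterI => //; apply: filterI.
(* Idempotence in coordinates also uses the representation of [rho] at the point [rho x]. *)
have nPr : anbhs p (fun x => P (rho x)).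
  by apply: smooth_at_near srho _; rewrite rp.
have [N [oN Np NP]] : anbhs p (fun x => P x /\ P (rho x)) by apply: filterI.
have hp : h (c p) = c p.
  by have [[_ _ _ <-] _] := [elaborate anbhs_singleton nP]; rewrite rp.
have hh : \forall v \near c p, h (h v) = h v.
  have := [elaborate image_anbhs ac Dp (ex_intro _ N (And3 oN Np (@subset_refl _ N)))].
  apply: filterS => _ [x [Dx /NP[[[_ _ _ e] [Sr _]] [[_ _ _ e'] [_ Sr']]]] <-].
  by rewrite -e -e' Sr'.
have /smooth_onP[oW ch] := sh.
have [k [l [phi [psi [V [[oV VW Vp cphi] [oV' cpsi psiK hS]]]]]]] :=
  retraction_straighten oW ch Wp hp hh.
exists k, l, (chart_dom c `&` (N `&` c @^-1` V)), (fun x => phi (c x)).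
split=> //; split.
  by apply: (admissible_comp ac _ _ psiK oN); apply/smooth_onP.
move=> x [Dx [/NP[[[_ _ Drx rxE] [Sr Srx]] _] Vx]].
split=> [/Srx e|/(hS _ Vx) e]; first by apply/(hS _ Vx); rewrite -rxE e.
by rewrite -(injc _ _ Drx Dx _) // rxE.
Qed.

End RetractionLemma.

(** * Ranges of maps with local smooth inverses *)

Section Ranges.
Variables (R : realType) (N X : atlas_space R).
Context {pN : premanifold N} {pX : premanifold X}.

(** [iota \o f] is a retraction onto [S] near each of its points, whence embeddedness. By
    injectivity of [iota], each [f] coincides on [S], near the given point, with the global inverse
    [F], which is therefore smooth. *)
Lemma range_diffeomorphic (iota : N -> X) (S : set X) :
  smooth_map iota -> injective iota -> (forall n, S (iota n)) ->
  (forall x, S x -> exists n, iota n = x) ->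
  (forall n, exists f : X -> N, smooth_at f (iota n) /\
     anbhs (iota n) (fun x => S x -> iota (f x) = x)) ->
  embedded_submanifold S /\ diffeomorphic (induced_space S) N.
Proof.
move=> siota inji Si SE Hf.
have eS : embedded_submanifold S.
  move=> p Sp; have [n np] := SE p Sp.
  have [f [sf nf]] := Hf n; rewrite np in sf nf.
  apply: (retract_slice_chart Sp (smooth_at_comp sf (siota _))) => //.
  by apply: filterS filterT => x _; apply: Si.
split=> //.
have inv (p : induced_space S) : exists n, iota n = incl p.
  exact: SE (in_subspace p).
pose F p := sval (cid (inv p)).
have FE p : iota (F p) = incl p by rewrite /F; case: cid.
pose G n : induced_space S := SigSub (mem_set (Si n)).
exists F, G; split.
- move=> p; have [f [sf nf]] := Hf (F p); rewrite FE in sf nf.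
  have sfi := [elaborate smooth_at_comp (smooth_at_incl p) sf].
  apply: eq_smooth_at sfi.
  apply: filterS (smooth_at_near (smooth_at_incl p) nf) => q H.
  by apply: inji; rewrite FE H //; apply: in_subspace.
- by move=> n; apply: smooth_at_corestrict; apply: siota.
- by move=> p; apply: val_inj; exact: FE.
- by move=> n; apply: inji; rewrite FE.
Qed.

End Ranges.

(** * Maps that are locally projections *)

Section Lifts.
Variables (R : realType) (X M : atlas_space R).
Context {pX : premanifold X} {pM : premanifold M}.

(* For (y, x) near (f x0, x0), lambda moves x to the fibre of f over y. *)
Definition local_lift (f : X -> M) (x0 : X) (lambda : prod_space M X -> X) :=
  [/\ smooth_at lambda (f x0, x0),
      anbhs ((f x0, x0) : prod_space M X) (fun p => f (lambda p) = p.1) &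
      anbhs x0 (fun x => lambda (f x, x) = x)].

Definition liftable (f : X -> M) :=
  smooth_map f /\ forall x0, exists lambda, local_lift f x0 lambda.

(** The correction does nothing where [a] already lies over [b]; this is what makes it usable for
    retractions onto solution sets. *)
Lemma lift_along (f : X -> M) : liftable f ->
  forall (Z : atlas_space R) {pZ : premanifold Z} (a : Z -> X) (b : Z -> M) z,
  smooth_at a z -> smooth_at b z -> f (a z) = b z ->
  exists a' : Z -> X, [/\ smooth_at a' z, anbhs z (fun w => f (a' w) = b w) &
    anbhs z (fun w => f (a w) = b w -> a' w = a w)].
Proof.
move=> [sf lf] Z pZ a b z sa sb e; have [l [sl fl lx]] := lf (a z).
rewrite e in sl fl; exists (fun w => l (b w, a w)).
have sba := [elaborate smooth_at_pair sb sa]; split.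
- exact: smooth_at_comp sba sl.
- exact: (smooth_at_near sba fl).
- by apply: filterS (smooth_at_near sa lx) => w + <-.
Qed.

(** In adapted charts [f] is the projection to the first [k] coordinates, which [tau] replaces by
    those of the prescribed image. *)
Lemma submersion_liftable (f : X -> M) :
  smooth_map f -> submersion f -> liftable f.
Proof.
move=> sf subf; split=> // x0.
have [k [l [U [phi [V [psi [[aphi apsi Ux0] H]]]]]]] := subf x0.
have [Vfx0 psifx0] := H _ Ux0.
have [g [sg gphi phig]] := [elaborate chart_inverse aphi Ux0].
pose pp : prod_space M X := (f x0, x0).
pose tau (p : prod_space M X) : euclidean R (k + l) :=
  row_mx (psi p.1) (rsubmx (phi p.2)).
have tau0 : tau pp = phi x0 by rewrite /tau /= psifx0 hsubmxK.
have s1 : smooth_at (fun p : prod_space M X => psi p.1 : euclidean R k) pp.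
  exact: (smooth_at_comp (smooth_at_fst pp) (smooth_at_chart apsi Vfx0)).
have s2 : smooth_at (fun p : prod_space M X => phi p.2 : euclidean R (k + l)) pp.
  exact: (smooth_at_comp (smooth_at_snd pp) (smooth_at_chart aphi Ux0)).
have stau : smooth_at tau pp.
  exact: smooth_at_row_mx s1 (smooth_at_rsubmx s2).
have stau' : smooth_at g (tau pp) by rewrite tau0.
exists (fun p => g (tau p)); split.
- exact: smooth_at_comp stau stau'.
- have nV : anbhs pp (fun p => V p.1).
    exact: smooth_at_near (smooth_at_fst pp) (anbhs_dom apsi Vfx0).
  have ng : anbhs pp (fun p => U (g (tau p)) /\ phi (g (tau p)) = tau p).
    by have phig' := phig; rewrite -[X in anbhs X _]tau0 in phig';
      exact: (smooth_at_near stau phig').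
  apply: filterS2 nV ng => -[y x] /= Vy [Ug e].
  have [Vfg fg] := H _ Ug; have [[_ injpsi] _] := apsi.
  by apply: injpsi => //=; rewrite fg e /tau row_mxKl.
- apply: filterS2 gphi (anbhs_dom aphi Ux0) => x gx Ux.
  by have [_ e] := H _ Ux; rewrite /tau /= e hsubmxK.
Qed.

End Lifts.

(** * Vector bundles and groupoids *)

Section VectorBundle.
Variables (R : realType) (E M : atlas_space R).
Context {pE : premanifold E} {pM : premanifold M}.
Variable B : vector_bundle E M.

(** A trivialisation is injective and linear on a fibre, so the vector space identities below can be
    checked in $\mathbb R^n$. *)
Lemma vb_fibre_coordinates (x : M) : exists n (phi : E -> 'rV[R]_n),
  [/\ forall e e', B e = x -> B e' = x -> phi e = phi e' -> e = e',
      phi (vb_zero B x) = 0,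
      forall e e', B e = x -> B e' = x -> phi (vb_add B e e') = phi e + phi e' &
      forall a e, B e = x -> phi (vb_scale B a e) = a *: phi e].
Proof.
have [U [n [phi [psi [[oU Ux _ _] [psiK _ phi0 phiD phiZ]]]]]] :=
  vb_locally_trivial B x.
exists n, phi; split.
- move=> e e' Be Be' ee'; rewrite -(psiK e) ?Be // -(psiK e') ?Be' //.
  by rewrite ee'.
- exact: phi0.
- by move=> e e' Be Be'; rewrite phiD ?Be ?Be'.
- by move=> a e Be; rewrite phiZ ?Be.
Qed.

Lemma vb_scale0 e : vb_scale B 0 e = vb_zero B (B e).
Proof.
have [n [phi [inj phi0 _ phiZ]]] := vb_fibre_coordinates (B e).
apply: inj; rewrite ?vb_proj_scale ?vb_proj_zero //.
by rewrite phiZ // scale0r phi0.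
Qed.

Lemma vb_scale_zero a x : vb_scale B a (vb_zero B x) = vb_zero B x.
Proof.
have [n [phi [inj phi0 _ phiZ]]] := vb_fibre_coordinates x.
apply: inj; rewrite ?vb_proj_scale ?vb_proj_zero //.
by rewrite phiZ ?vb_proj_zero // phi0 scaler0.
Qed.

Lemma vb_add0l x e : B e = x -> vb_add B (vb_zero B x) e = e.
Proof.
move=> Be; have [n [phi [inj phi0 phiD _]]] := vb_fibre_coordinates x.
apply: inj; rewrite ?vb_proj_add ?vb_proj_zero // phiD ?vb_proj_zero //.
by rewrite phi0 add0r.
Qed.

Lemma vb_add0r x e : B e = x -> vb_add B e (vb_zero B x) = e.
Proof.
move=> Be; have [n [phi [inj phi0 phiD _]]] := vb_fibre_coordinates x.
apply: inj; rewrite ?vb_proj_add ?vb_proj_zero // phiD ?vb_proj_zero //.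
by rewrite phi0 addr0.
Qed.

Definition vb_sub e e' := vb_add B e (vb_scale B (-1) e').

Lemma vb_proj_sub e e' : B e = B e' -> B (vb_sub e e') = B e.
Proof. by move=> ee'; rewrite vb_proj_add // vb_proj_scale. Qed.

Lemma vb_subK e e' : B e = B e' -> vb_add B (vb_sub e e') e' = e.
Proof.
move=> ee'; have [n [phi [inj _ phiD phiZ]]] := vb_fibre_coordinates (B e').
have Bs := vb_proj_sub ee'.
apply: inj => //; first by rewrite vb_proj_add ?Bs.
by rewrite !phiD ?phiZ ?vb_proj_scale ?Bs // scaleN1r subrK.
Qed.

Lemma vb_addK e e' : B e = B e' -> vb_sub (vb_add B e e') e' = e.
Proof.
move=> ee'; have [n [phi [inj _ phiD phiZ]]] := vb_fibre_coordinates (B e').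
have Ba := vb_proj_add ee'.
apply: inj => //; first by rewrite vb_proj_sub Ba.
by rewrite !phiD ?phiZ ?vb_proj_scale ?Ba // scaleN1r addrK.
Qed.

Lemma vb_subrr e : vb_sub e e = vb_zero B (B e).
Proof.
have [n [phi [inj phi0 phiD phiZ]]] := vb_fibre_coordinates (B e).
apply: inj; rewrite ?vb_proj_sub ?vb_proj_zero //.
by rewrite phiD ?phiZ ?vb_proj_scale // scaleN1r subrr phi0.
Qed.

Lemma vb_subr0 x e : B e = x -> vb_sub e (vb_zero B x) = e.
Proof. by move=> Be; rewrite /vb_sub vb_scale_zero vb_add0r. Qed.

(** Smoothness of the operations comes from the trivialisations: a sum is [psi] applied to the base
    point and the sum of the fibre coordinates. *)
Lemma smooth_at_vb_add (Z : atlas_space R) {pZ : premanifold Z} (a b : Z -> E) z :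
  smooth_at a z -> smooth_at b z -> anbhs z (fun w => B (a w) = B (b w)) ->
  smooth_at (fun w => vb_add B (a w) (b w)) z.
Proof.
move=> sa sb nab; have ab := [elaborate anbhs_singleton nab].
have [U [n [phi [psi [[oU Ux sphi spsi] [psiK _ _ phiD _]]]]]] :=
  vb_locally_trivial B (B (a z)).
have sBa := [elaborate smooth_at_comp sa (vb_proj_smooth B (a z))].
have Ubz : U (B (b z)) by rewrite -ab.
have sphiab := [elaborate smooth_at_add (smooth_at_comp sa (sphi _ Ux))
                             (smooth_at_comp sb (sphi _ Ubz))].
have s := [elaborate smooth_at_comp (smooth_at_pair sBa sphiab) (spsi (B (a z), _) Ux)].
apply: eq_smooth_at s.
have nU : anbhs z (fun w => U (B (a w))).
  by apply: (smooth_at_near sBa); exists U; split.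
apply: filterS2 nU nab => w Uw e.
have := psiK (vb_add B (a w) (b w)); rewrite vb_proj_add // phiD //.
exact.
Qed.

Lemma smooth_at_vb_scale (Z : atlas_space R) {pZ : premanifold Z} c
    (a : Z -> E) z :
  smooth_at a z -> smooth_at (fun w => vb_scale B c (a w)) z.
Proof.
move=> sa.
have [U [n [phi [psi [[oU Ux sphi spsi] [psiK _ _ _ phiZ]]]]]] :=
  vb_locally_trivial B (B (a z)).
have sBa := [elaborate smooth_at_comp sa (vb_proj_smooth B (a z))].
have sphia := [elaborate smooth_at_scale c (smooth_at_comp sa (sphi _ Ux))].
have s := [elaborate smooth_at_comp (smooth_at_pair sBa sphia) (spsi (B (a z), _) Ux)].
apply: eq_smooth_at s.
have nU : anbhs z (fun w => U (B (a w))).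
  by apply: (smooth_at_near sBa); exists U; split.
apply: filterS nU => w Uw.
have := psiK (vb_scale B c (a w)); rewrite vb_proj_scale phiZ //.
exact.
Qed.

Lemma smooth_at_vb_sub (Z : atlas_space R) {pZ : premanifold Z} (a b : Z -> E) z :
  smooth_at a z -> smooth_at b z -> anbhs z (fun w => B (a w) = B (b w)) ->
  smooth_at (fun w => vb_sub (a w) (b w)) z.
Proof.
move=> sa sb nab; apply: smooth_at_vb_add => //.
  exact: smooth_at_vb_scale.
by apply: filterS nab => w; rewrite vb_proj_scale.
Qed.

Lemma smooth_vb_zero : smooth_map (vb_zero B).
Proof.
move=> x; have [U [n [phi [psi [[oU Ux _ spsi] [psiK _ phi0 _ _]]]]]] :=
  vb_locally_trivial B x.
have s := [elaborate smooth_at_comp (smooth_at_pair (smooth_at_id x)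
  (smooth_at_cst (0 : euclidean R n) x)) (spsi (x, _) Ux)].
apply: eq_smooth_at s.
have nU : anbhs x U by exists U; split.
apply: filterS nU => y Uy.
have := psiK (vb_zero B y); rewrite vb_proj_zero phi0 //.
exact.
Qed.

(** A trivialisation moves a vector to a nearby fibre by keeping its fibre coordinates. *)
Lemma vector_bundle_liftable : liftable B.
Proof.
split; first exact: vb_proj_smooth.
move=> e0; have [U [n [phi [psi [[oU Ux sphi spsi] [psiK Bpsi _ _ _]]]]]] :=
  vb_locally_trivial B (B e0).
pose p0 : prod_space M E := (B e0, e0).
have sp : smooth_at (fun p : prod_space M E =>
    (p.1, phi p.2) : prod_space M (euclidean R n)) p0.
  apply: smooth_at_pair (smooth_at_fst _) _.
  exact: smooth_at_comp (smooth_at_snd p0) (sphi _ Ux).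
have nU : anbhs (B e0) U by exists U; split.
exists (fun p => psi (p.1, phi p.2)); split.
- exact: smooth_at_comp sp (spsi (_, _) Ux).
- apply: filterS (smooth_at_near (smooth_at_fst p0) nU) => -[y e] /= Uy.
  by case: (Bpsi y (phi e) Uy).
- apply: filterS (smooth_at_near (vb_proj_smooth B e0) nU) => e Ue /=.
  exact: psiK.
Qed.

End VectorBundle.

Section LinearOver.
Variables (R : realType) (E M E' M' : atlas_space R).
Variables (B : vector_bundle E M) (B' : vector_bundle E' M').

Lemma linear_over_zero (f : M -> M') (F : E -> E') x :
  linear_over B B' f F -> F (vb_zero B x) = vb_zero B' (f x).
Proof.
move=> [pF _ FZ]; rewrite -{1}(vb_scale_zero B 0 x) FZ vb_scale0 pF.
by rewrite vb_proj_zero.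
Qed.

Lemma linear_over_sub (f : M -> M') (F : E -> E') e e' : B e = B e' ->
  linear_over B B' f F -> F (vb_sub B e e') = vb_sub B' (F e) (F e').
Proof. by move=> ee' [_ FD FZ]; rewrite FD ?vb_proj_scale // FZ. Qed.

End LinearOver.

Section Groupoid.
Variables (R : realType) (G M : atlas_space R) (g : lie_groupoid G M).
Context {pG : premanifold G} {pM : premanifold M}.

Lemma smooth_at_gr_mul (Z : atlas_space R) {pZ : premanifold Z} (a b : Z -> G) z :
  smooth_at a z -> smooth_at b z ->
  anbhs z (fun w => gr_src g (a w) = gr_tgt g (b w)) ->
  smooth_at (fun w => gr_mul g (a w) (b w)) z.
Proof.
move=> sa sb nab.
exact: (@smooth_at_restrict _ _ _ (composable (gr_src g) (gr_tgt g)) _ _ _ _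
  (fun p : prod_space G G => gr_mul g p.1 p.2) (fun w => (a w, b w)) z
  (@gr_mul_smooth _ _ _ g) (smooth_at_pair sa sb) nab).
Qed.

Lemma gr_inv_unit x : gr_inv g (gr_unit g x) = gr_unit g x.
Proof.
have := gr_mulg1 g (gr_inv g (gr_unit g x)).
by rewrite gr_src_inv gr_tgt_unit gr_mulVg gr_src_unit.
Qed.

End Groupoid.

(** * The core of a VB-groupoid *)

Section Core.
Variables (R : realType) (V : vb_groupoid R).
Local Notation M := (vbM V).
Local Notation G := (vbG V).
Local Notation E := (vbE V).
Local Notation Gam := (vbGam V).
Local Notation s := (gr_src (vb_base V)).
Local Notation t := (gr_tgt (vb_base V)).
Local Notation one := (gr_unit (vb_base V)).
Local Notation s' := (gr_src (vb_total V)).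
Local Notation t' := (gr_tgt (vb_total V)).
Local Notation mul := (gr_mul (vb_total V)).
Local Notation q := (vb_proj (vb_qE V)).
Local Notation qGam := (vb_proj (vb_qGam V)).
Local Notation zeroE := (vb_zero (vb_qE V)).
Local Notation zeroG := (vb_zero (vb_qGam V)).
Local Notation subG := (vb_sub (vb_qGam V)).

Lemma src_linear : linear_over (vb_qGam V) (vb_qE V) s s'.
Proof. by case: (vb_src_morphism V). Qed.

Lemma tgt_linear : linear_over (vb_qGam V) (vb_qE V) t t'.
Proof. by case: (vb_tgt_morphism V). Qed.

Lemma vb_qE_src c : q (s' c) = s (qGam c).
Proof. by have [-> _ _] := src_linear. Qed.

Lemma vb_qE_tgt c : q (t' c) = t (qGam c).
Proof. by have [-> _ _] := tgt_linear. Qed.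

Lemma src_zero g : s' (zeroG g) = zeroE (s g).
Proof. exact: linear_over_zero src_linear. Qed.

Lemma tgt_zero g : t' (zeroG g) = zeroE (t g).
Proof. exact: linear_over_zero tgt_linear. Qed.

Lemma unit_zero x : gr_unit (vb_total V) (zeroE x) = zeroG (one x).
Proof. by case: (vb_unit_morphism V) => _ _ /linear_over_zero. Qed.

(** Linearity of the multiplication shows that the product equals 0 times itself. *)
Lemma mul_zero g h : s g = t h ->
  mul (zeroG g) (zeroG h) = zeroG (gr_mul (vb_base V) g h).
Proof.
move=> gh; have cmp : s' (zeroG g) = t' (zeroG h).
  by rewrite src_zero tgt_zero gh.
have := vb_mul_scale 0 cmp; rewrite !vb_scale_zero => ->.
by rewrite vb_scale0 vb_mul_proj // !vb_proj_zero.
Qed.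

Lemma mul_zero_one c x : s' c = zeroE x -> mul c (zeroG (one x)) = c.
Proof. by move=> e; rewrite -unit_zero -e gr_mulg1. Qed.

Lemma core_setE c : core_set c ->
  qGam c = one (s (qGam c)) /\ s' c = zeroE (s (qGam c)).
Proof. by move=> [x [-> ->]]; rewrite gr_src_unit. Qed.

Variable sigma : E -> G -> Gam.
Hypothesis splits : is_splitting sigma.

(* The projections of the splitting of vbGam into t^!C and s^!E: a fibre element
   over g is [core_part * 0_g + sigma]. *)
Definition core_part (c : Gam) : Gam :=
  mul (subG c (sigma (s' c) (qGam c))) (zeroG (gr_inv (vb_base V) (qGam c))).

Definition assemble (c : Gam) (e : E) (g : G) : Gam :=
  vb_add (vb_qGam V) (mul c (zeroG g)) (sigma e g).

Let sigma_proj e g : q e = s g -> qGam (sigma e g) = g.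
Proof. by case: splits => _ + _ _ _; apply. Qed.

Let sigma_src e g : q e = s g -> s' (sigma e g) = e.
Proof. by case: splits => _ _ + _ _; apply. Qed.

Let sigma_zero g : sigma (zeroE (s g)) g = zeroG g.
Proof.
have qz : q (zeroE (s g)) = s g by rewrite vb_proj_zero.
have [_ _ _ _ /(_ 0 _ g qz)] := splits.
by rewrite vb_scale_zero vb_scale0 sigma_proj.
Qed.

Section Parts.
Variable c : Gam.
(** Subtracting the splitting leaves an element with zero source. It can therefore be multiplied by
    $0_{g^{-1}}$, where $g$ is the arrow below [c], and this carries it to the unit at the target of
    $g$. *)
Let d := subG c (sigma (s' c) (qGam c)).

Let sc_proj : qGam c = qGam (sigma (s' c) (qGam c)).
Proof. by rewrite sigma_proj // vb_qE_src. Qed.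

Let d_proj : qGam d = qGam c.
Proof. exact: vb_proj_sub. Qed.

Let d_src : s' d = zeroE (s (qGam c)).
Proof.
rewrite /d (linear_over_sub sc_proj src_linear) sigma_src ?vb_qE_src //.
by rewrite vb_subrr vb_qE_src.
Qed.

Let d_cmp : s' d = t' (zeroG (gr_inv (vb_base V) (qGam c))).
Proof. by rewrite d_src tgt_zero gr_tgt_inv. Qed.

Lemma core_part_proj : qGam (core_part c) = one (t (qGam c)).
Proof. by rewrite vb_mul_proj // d_proj vb_proj_zero gr_mulgV. Qed.

Lemma core_part_src : s' (core_part c) = zeroE (t (qGam c)).
Proof. by rewrite gr_src_mul // src_zero gr_src_inv. Qed.

Lemma core_part_core : core_set (core_part c).
Proof. by exists (t (qGam c)); rewrite core_part_proj core_part_src. Qed.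

Lemma assemble_core_part : assemble (core_part c) (s' c) (qGam c) = c.
Proof.
rewrite /assemble -gr_mulA //; last first.
  by rewrite src_zero tgt_zero gr_src_inv.
rewrite mul_zero ?gr_src_inv // gr_mulVg mul_zero_one //.
exact: vb_subK.
Qed.

End Parts.

(** For a core element the splitting is evaluated at a zero vector, where linearity makes it
    zero. *)
Lemma core_part_id c : core_set c -> core_part c = c.
Proof.
move=> /core_setE[]; set x := s (qGam c) => qc sc.
rewrite /core_part sc {1 2}qc -{1}(gr_src_unit (vb_base V) x) sigma_zero.
by rewrite vb_subr0 // gr_inv_unit mul_zero_one.
Qed.

Section Assemble.
Variables (c : Gam) (e : E) (g : G).
Hypotheses (Cc : core_set c) (cg : s (qGam c) = t g) (eg : q e = s g).

Let cmp : s' c = t' (zeroG g).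
Proof. by rewrite tgt_zero -cg; case: (core_setE Cc). Qed.

Let mul_proj : qGam (mul c (zeroG g)) = g.
Proof.
rewrite vb_mul_proj // vb_proj_zero (core_setE Cc).1 cg.
exact: gr_mul1g.
Qed.

Lemma assemble_proj : qGam (assemble c e g) = g.
Proof. by rewrite vb_proj_add ?mul_proj ?sigma_proj. Qed.

Lemma assemble_src : s' (assemble c e g) = e.
Proof.
have [_ FD _] := src_linear.
rewrite FD ?mul_proj ?sigma_proj // gr_src_mul // src_zero sigma_src //.
exact: vb_add0l.
Qed.

Lemma core_part_assemble : core_part (assemble c e g) = c.
Proof.
rewrite /core_part assemble_src assemble_proj vb_addK; last first.
  by rewrite mul_proj sigma_proj.
rewrite -gr_mulA // ?src_zero ?tgt_zero ?gr_tgt_inv //.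
rewrite mul_zero ?gr_tgt_inv // gr_mulgV mul_zero_one // -cg.
by case: (core_setE Cc).
Qed.

End Assemble.

Lemma smooth_at_sigma (Z : atlas_space R) {pZ : premanifold Z} (e : Z -> E)
    (g : Z -> G) z : smooth_at e z -> smooth_at g z ->
  anbhs z (fun w => q (e w) = s (g w)) ->
  smooth_at (fun w => sigma (e w) (g w)) z.
Proof.
move=> se sg neg; have [ssig _ _ _ _] := splits.
exact: (@smooth_at_restrict _ _ _ (@pullback_set R V) _ _ _ _
  (fun p : prod_space E G => sigma p.1 p.2) (fun w => (e w, g w)) z
  ssig (smooth_at_pair se sg) neg).
Qed.

(** The composability conditions hold for every element of [vbGam], so smoothness is not confined to
    a submanifold. *)
Lemma smooth_core_part : smooth_map core_part.
Proof.
move=> c; have sid := [elaborate smooth_at_id c].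
have ss := gr_src_smooth (vb_total V) c; have sq := vb_proj_smooth (vb_qGam V) c.
have ssig : smooth_at (fun c => sigma (s' c) (qGam c)) c.
  by apply: smooth_at_sigma => //; apply: filterS filterT => d _; apply: vb_qE_src.
apply: smooth_at_gr_mul.
- apply: smooth_at_vb_sub => //; apply: filterS filterT => d _.
  by rewrite sigma_proj // vb_qE_src.
- have si := [elaborate smooth_at_comp sq (gr_inv_smooth (vb_base V) _)].
  exact: smooth_at_comp si (smooth_vb_zero (vb_qGam V) _).
- apply: filterS filterT => d _.
  have dd : qGam d = qGam (sigma (s' d) (qGam d)).
    by rewrite sigma_proj // vb_qE_src.
  rewrite (linear_over_sub dd src_linear) sigma_src ?vb_qE_src //.
  by rewrite vb_subrr vb_qE_src tgt_zero gr_tgt_inv.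
Qed.

Lemma core_embedded : embedded_submanifold (@core_set R V).
Proof.
move=> c Cc; apply: (retract_slice_chart Cc (smooth_core_part c)).
  by apply: filterS filterT => d _; apply: core_part_core.
by apply: filterS filterT => d _; apply: core_part_id.
Qed.

Lemma smooth_at_assemble (Z : atlas_space R) {pZ : premanifold Z} (c : Z -> Gam)
    (e : Z -> E) (g : Z -> G) z : smooth_at c z -> smooth_at e z ->
  smooth_at g z -> anbhs z (fun w => [/\ core_set (c w), s (qGam (c w)) = t (g w) &
    q (e w) = s (g w)]) ->
  smooth_at (fun w => assemble (c w) (e w) (g w)) z.
Proof.
move=> sc se sg nH; apply: smooth_at_vb_add.
- apply: smooth_at_gr_mul => //.
    exact: smooth_at_comp sg (smooth_vb_zero (vb_qGam V) _).
  apply: filterS nH => w [Cc cg _].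
  by rewrite tgt_zero -cg; case: (core_setE Cc).
- by apply: smooth_at_sigma => //; apply: filterS nH => w [].
- apply: filterS nH => w [Cc cg eg].
  rewrite sigma_proj // vb_mul_proj ?vb_proj_zero.
    by rewrite (core_setE Cc).1 cg gr_mul1g.
  by rewrite tgt_zero -cg; case: (core_setE Cc).
Qed.

Definition core_point (c : Gam) : core V := SigSub (mem_set (core_part_core c)).

Lemma smooth_core_point : smooth_map core_point.
Proof.
have eC := core_embedded; move=> c.
by apply: smooth_at_corestrict; apply: smooth_core_part.
Qed.

(** A core element is lifted in [vbGam] to the fibre over the unit at the prescribed point. The
    result may leave the core, but its core part lies over the same unit. *)
Lemma core_proj_liftable : liftable (@core_proj R V).
Proof.
have eC := core_embedded.
have scp : smooth_map (@core_proj R V).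
  move=> c; have si := [elaborate smooth_at_incl c].
  have sq := [elaborate smooth_at_comp si (vb_proj_smooth (vb_qGam V) _)].
  exact: smooth_at_comp sq (gr_src_smooth (vb_base V) _).
split=> // c0.
have [_ /(_ (incl c0))[l [sl ql lid]]] :=
  [elaborate vector_bundle_liftable (vb_qGam V)].
pose p0 : prod_space M (core V) := (core_proj c0, c0).
pose a (p : prod_space M (core V)) : prod_space G Gam := (one p.1, incl p.2).
have a0 : a p0 = (qGam (incl c0), incl c0).
  by rewrite /a /= /core_proj -(core_setE (in_subspace c0)).1.
have sa : smooth_at a p0.
  apply: smooth_at_pair.
    exact: smooth_at_comp (smooth_at_fst p0) (gr_unit_smooth (vb_base V) _).
  exact: smooth_at_comp (smooth_at_snd p0) (smooth_at_incl _).
rewrite -a0 in sl ql.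
exists (fun p => core_point (l (a p))); split.
- have sla := [elaborate smooth_at_comp sa sl].
  exact: smooth_at_comp sla (smooth_core_point _).
- apply: filterS (smooth_at_near sa ql) => -[x c] /=.
  rewrite /core_proj /= core_part_proj gr_src_unit => ->.
  exact: gr_tgt_unit.
- apply: filterS (smooth_at_near (smooth_at_incl c0) lid) => c e.
  apply: val_inj; rewrite /= /a /= /core_proj.
  have Cc := in_subspace c.
  by rewrite -(core_setE Cc).1 e core_part_id.
Qed.

End Core.

(** * Fibre products *)

Existing Class liftable.

Section FibrePower.
Variables (R : realType) (X M : atlas_space R) (p : X -> M).
Context {pX : premanifold X} {pM : premanifold M} {lp : liftable p}.

Lemma smooth_at_entry (I : finType) (S : set (power_space I X))
    {eS : embedded_submanifold S} (i : I) (x : induced_space S) :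
  smooth_at (fun y : induced_space S => (incl y : forall i, X) i) x.
Proof.
exact: (smooth_at_comp (smooth_at_incl x)
  (smooth_at_proj (X := fun _ : I => X) i (incl x))).
Qed.

Lemma lift_tuple (I : finType) (Z : atlas_space R) {pZ : premanifold Z}
    (a : I -> Z -> X) (b : Z -> M) z :
  (forall i, smooth_at (a i) z) -> smooth_at b z ->
  (forall i, p (a i z) = b z) ->
  exists a' : Z -> power_space I X, [/\ smooth_at a' z,
    anbhs z (fun w => forall i, p ((a' w : forall i, X) i) = b w) &
    anbhs z (fun w => (forall i, p (a i w) = b w) -> a' w = (fun i => a i w))].
Proof.
move=> sa sb ab.
have /choice[a' a'P] := [elaborate fun i => lift_along lp (sa i) sb (ab i)].
exists (fun w i => a' i w); split.
- by apply: smooth_at_tuple => i; case: (a'P i).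
- have H i : anbhs z (fun w => p (a' i w) = b w) by case: (a'P i).
  exact: filter_forall (anbhs_filter z) H.
- have H i : anbhs z (fun w => p (a i w) = b w -> a' i w = a i w).
    by case: (a'P i).
  have nH := [elaborate filter_forall (anbhs_filter z) H].
  apply: filterS nH => w Hw pab.
  by apply: functional_extensionality_dep => i; apply: Hw.
Qed.

Local Notation fibre_set n :=
  ([set x | forall i j : 'I_n.+1, p (x i) = p (x j)] :
     set (power_space 'I_n.+1 X)).

(** All entries are moved to the fibre of entry 0, which exists because the index type is
    ['I_n.+1]. *)
Global Instance fibre_power_embedded n : embedded_submanifold (fibre_set n).
Proof.
move=> x0 Sx0.
have sa i : smooth_at (fun x : power_space 'I_n.+1 X => (x : forall i, X) i) x0.
  exact: (smooth_at_proj (X := fun _ : 'I_n.+1 => X)).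
have sb := [elaborate smooth_at_comp (sa ord0) (lp.1 _)].
have [rho [srho nrho fixr]] := [elaborate lift_tuple sa sb (fun i => Sx0 i ord0)].
apply: (retract_slice_chart Sx0 srho).
  by apply: filterS nrho => x H i j; rewrite !H.
by apply: filterS fixr => x H Sx; apply: H => i; apply: Sx.
Qed.

Lemma fibre_power_lift n (Z : atlas_space R) {pZ : premanifold Z}
    (a : Z -> induced_space (fibre_set n)) (b : Z -> M) z :
  smooth_at a z -> smooth_at b z ->
  (forall i, p ((incl (a z) : forall i, X) i) = b z) ->
  exists a' : Z -> induced_space (fibre_set n), [/\ smooth_at a' z,
    anbhs z (fun w => forall i, p ((incl (a' w) : forall i, X) i) = b w) &
    anbhs z (fun w => (forall i, p ((incl (a w) : forall i, X) i) = b w) ->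
      a' w = a w)].
Proof.
move=> sa sb ab.
have sai i : smooth_at (fun w => (incl (a w) : forall i, X) i) z.
  exact: (smooth_at_comp sa (smooth_at_entry i (a z))).
have [u [su nu fixu]] := [elaborate lift_tuple sai sb ab].
have Suz : (fun x : power_space 'I_n.+1 X => forall i j : 'I_n.+1,
    p ((x : forall i, X) i) = p ((x : forall i, X) j)) (u z).
  by move=> i j; rewrite !(anbhs_singleton nu).
have [a' [sa' na']] := [elaborate smooth_lift su Suz].
exists a'; split=> //.
- apply: filterS2 nu na' => w Hw e i.
  by rewrite e // => ? ?; rewrite !Hw.
- apply: filterS3 nu na' fixu => w Hw e fw paw.
  apply: val_inj; rewrite -[LHS]/(incl (a' w)) e; first exact: fw.
  by move=> ? ?; rewrite !Hw.
Qed.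

End FibrePower.

Global Instance fibre_power_premanifold (R : realType) (V : vb_groupoid R)
    (X : atlas_space R) {pX : premanifold X} (p : X -> vbM V)
    {lp : liftable p} n : premanifold (fibre_power p n.+1).
Proof. exact: induced_premanifold. Qed.

(** * Composable tuples of arrows *)

Section ComposableTuples.
Variables (R : realType) (V : vb_groupoid R).
Local Notation G := (vbG V).
Local Notation s := (gr_src (vb_base V)).
Local Notation t := (gr_tgt (vb_base V)).

(* A retraction onto the composable tuples is built by correcting the sources
   of the entries from the last one to the first one. *)
Global Instance composable_tuples_embedded r : embedded_submanifold
  ([set g | forall i j : 'I_r, j = i.+1 :> nat -> s (g i) = t (g j)]
     : set (power_space 'I_r G)).
Proof.
pose T := power_space 'I_r G.
pose C m (x : T) := forall i j : 'I_r, (m <= i)%N -> j = i.+1 :> nat ->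
  s ((x : forall i, G) i) = t ((x : forall i, G) j).
move=> x0 Sx0.
have sproj i (x : T) : smooth_at (fun x : T => (x : forall i, G) i) x.
  exact: (smooth_at_proj (X := fun _ : 'I_r => manifold_space G)).
have ls : liftable s.
  exact: submersion_liftable (gr_src_smooth _) (gr_src_submersion _).
(* After [k] corrections the conditions hold from index [r - k] on. A correction can disturb only
   the condition with the left neighbour, which is treated later. *)
have H k : exists rho : T -> T, [/\ smooth_at rho x0,
    anbhs x0 (fun x => C (r - k)%N (rho x)) &
    anbhs x0 (fun x => C 0 x -> rho x = x)].
  elim: k => [|k [rho [srho Crho fixr]]].
    exists id; split; first exact: smooth_at_id.
      apply: filterS filterT => x _ i j; rewrite subn0 leqNgt.
      by rewrite ltn_ord.
    by apply: filterS filterT.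
  case: (pickP (fun i : 'I_r => (i : nat) == (r - k.+1)%N)) => [i0 /eqP i0E|no]; last first.
    exists rho; split=> //; apply: filterS Crho => x Cx i j mi ij.
    apply: Cx ij; move: mi (no i); rewrite leq_eqVlt eq_sym => /orP[-> //|].
    by move=> + _; apply: leq_trans; rewrite subnS; case: (r - k)%N.
  (* Without such a [j0] the entry is the last one and has nothing to match. *)
  case: (pickP (fun j : 'I_r => (j : nat) == i0.+1)) => [j0 /eqP j0E|no]; last first.
    exists rho; split=> //; apply: filterS Crho => x Cx i j mi ij.
    apply: Cx (ij); move: mi; rewrite -i0E leq_eqVlt => /orP[/eqP e|].
      by move: (no j); rewrite ij e eqxx.
    by apply: leq_trans; rewrite i0E subnS; case: (r - k)%N.
  have rx0 : rho x0 = x0 by apply: (anbhs_singleton fixr) => i j _; apply: Sx0.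
  have sa i := [elaborate smooth_at_comp srho (sproj i _)].
  have sb := [elaborate smooth_at_comp (sa j0) (gr_tgt_smooth (vb_base V) _)].
  have ab : s ((rho x0 : forall i, G) i0) = t ((rho x0 : forall i, G) j0).
    by rewrite rx0; apply: Sx0.
  have [a' [sa' na' fixa]] := [elaborate lift_along ls (sa i0) sb ab].
  exists (fun x i => if i == i0 then a' x else (rho x : forall i, G) i); split.
  - apply: smooth_at_tuple => i; case: (i == i0) => //; exact: sa.
  - apply: filterS2 Crho na' => x Cx ax i j mi ij.
    have ji0 : j != i0.
      apply/eqP => ji; move: mi; rewrite -i0E -ji ij; by rewrite ltnn.
    rewrite (negbTE ji0); case: eqP => [e|/eqP ne].
      by rewrite ax; congr (t ((rho x : forall i, G) _)); apply/val_inj; rewrite /= j0E -e -ij.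
    apply: Cx ij; move: mi; rewrite -i0E leq_eqVlt => /orP[/eqP e|].
      by case/eqP: ne; apply/val_inj.
    by apply: leq_trans; rewrite i0E subnS; case: (r - k)%N.
  - apply: filterS2 fixr fixa => x fx ax Cx.
    apply: functional_extensionality_dep => i; case: eqP => [->|_].
      by rewrite ax ?fx //; apply: Cx.
    by rewrite fx.
have [rho [srho Crho fixr]] := H r.
apply: (retract_slice_chart Sx0 srho).
  by apply: filterS Crho => x Cx i j; apply: Cx; rewrite subnn.
by apply: filterS fixr => x H' Sx; apply: H' => i j _; apply: Sx.
Qed.

Global Instance composable_tuples_premanifold r :
  premanifold (composable_tuples V r).
Proof. exact: induced_premanifold. Qed.

End ComposableTuples.

(** * Layers *)

Section LayerMatrices.
Variables (R : realType) (V : vb_groupoid R).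
Context {lC : liftable (@core_proj R V)} {eC : embedded_submanifold (@core_set R V)}.
Local Notation M := (vbM V).
Local Notation G := (vbG V).
Local Notation E := (vbE V).
Local Notation s := (gr_src (vb_base V)).
Local Notation t := (gr_tgt (vb_base V)).
Local Notation q := (vb_proj (vb_qE V)).
Local Notation MX n := (matrix_space V n.+1).

#[local] Instance source_bundle_liftable : liftable q := vector_bundle_liftable _.

Global Instance core_premanifold : premanifold (core V).
Proof. exact: induced_premanifold. Qed.

Global Instance matrix_space_premanifold n : premanifold (MX n).
Proof. exact: prod_premanifold. Qed.

(** Natural numbers as indices allow arithmetic on neighbouring entries; [inord] sends an index
    beyond [n] to 0. *)
Definition mat_g n (m : MX n) (k : nat) : G :=
  (incl m.1 : forall _ : 'I_n.+1, G) (inord k).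

Definition mat_e n (m : MX n) (i : nat) : E :=
  (incl m.2.1 : forall _ : 'I_n.+1, E) (inord i).

Definition mat_column n (m : MX n) (j : 'I_n) : fibre_power (@core_proj R V) j.+1 :=
  m.2.2 j.

Definition mat_c n (m : MX n) (j : 'I_n) (i : 'I_j.+1) : core V :=
  (incl (mat_column m j) : forall _ : 'I_j.+1, core V) i.

Lemma smooth_mat_g n k : smooth_map (fun m : MX n => mat_g m k).
Proof.
move=> m; exact: (smooth_at_comp (smooth_at_fst _)
  (smooth_at_entry (X := manifold_space G) (inord k) m.1)).
Qed.

Lemma smooth_mat_e n i : smooth_map (fun m : MX n => mat_e m i).
Proof.
move=> m; exact: (smooth_at_comp (smooth_at_comp (smooth_at_snd _)
  (smooth_at_fst _)) (smooth_at_entry (X := manifold_space E) (inord i) m.2.1)).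
Qed.

Lemma smooth_mat_column n (j : 'I_n) : smooth_map (fun m : MX n => mat_column m j).
Proof.
move=> m; exact: (smooth_at_comp (smooth_at_comp (smooth_at_snd _)
  (smooth_at_snd _))
  (smooth_at_proj (X := fun j : 'I_n => fibre_power (@core_proj R V) j.+1) j m.2.2)).
Qed.

Lemma smooth_mat_c n (j : 'I_n) (i : 'I_j.+1) :
  smooth_map (fun m : MX n => mat_c m i).
Proof.
move=> m; exact: (smooth_at_comp (smooth_mat_column j m)
  (smooth_at_entry (X := core V) i _)).
Qed.

Lemma layer_matricesP n (m : MX n) : layer_matrices m <->
  (forall (j : 'I_n) (i : 'I_j.+1), core_proj (mat_c m i) = t (mat_g m j.+1)) /\
  (forall i : nat, (i <= n)%N -> q (mat_e m i) = s (mat_g m n)).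
Proof.
split=> [[Hc He]|[Hc He]]; split.
- by move=> j i; apply: Hc; rewrite inordK // ltnS.
- by move=> i _; apply: He; rewrite inordK.
- move=> j i k kj; rewrite (Hc j i) /mat_g; congr (t ((incl m.1 : forall i, G) _)).
  by apply: val_inj; rewrite /= inordK ?ltnS // kj.
- move=> i k kn; have := He i (ltn_ord i).
  rewrite /mat_e inord_val => ->; rewrite /mat_g.
  by congr (s ((incl m.1 : forall i, G) _)); apply: val_inj; rewrite /= inordK.
Qed.

Lemma mat_g_composable n (m : MX n) k : (k < n)%N ->
  s (mat_g m k) = t (mat_g m k.+1).
Proof.
move=> kn; apply: (in_subspace m.1).
by rewrite !inordK // ltnS // ltnW.
Qed.

Lemma eq_matrix n (m m' : MX n) :
  (forall k, (k <= n)%N -> mat_g m k = mat_g m' k) ->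
  (forall i, (i <= n)%N -> mat_e m i = mat_e m' i) ->
  (forall (j : 'I_n) (i : 'I_j.+1), mat_c m i = mat_c m' i) -> m = m'.
Proof.
move=> eg ee ec; rewrite (surjective_pairing m) (surjective_pairing m').
congr pair.
  apply/val_inj/functional_extensionality_dep => k.
  by have := eg k (ltn_ord k); rewrite /mat_g inord_val.
rewrite (surjective_pairing m.2) (surjective_pairing m'.2); congr pair.
  apply/val_inj/functional_extensionality_dep => k.
  by have := ee k (ltn_ord k); rewrite /mat_e inord_val.
apply: functional_extensionality_dep => j.
by apply/val_inj/functional_extensionality_dep => i; apply: ec.
Qed.

(** The row of arrows is kept, and each column of core elements, as well as the column of vectors,
    is moved over the base point which that row prescribes. *)
Global Instance layer_matrices_embedded n :
  embedded_submanifold (@layer_matrices R V n.+1).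
Proof.
move=> m0 Lm0; have [Lc Le] := (layer_matricesP m0).1 Lm0.
have se : smooth_at (fun m : MX n => m.2.1) m0.
  exact: (smooth_at_comp (smooth_at_snd m0) (smooth_at_fst m0.2)).
have sbn := [elaborate smooth_at_comp (smooth_mat_g n m0) (gr_src_smooth (vb_base V) _)].
have Le' (i : 'I_n.+1) : q ((incl m0.2.1 : forall _ : 'I_n.+1, E) i) = s (mat_g m0 n).
  by have := Le i (ltn_ord i); rewrite /mat_e inord_val.
have [e' [se' Le1 fixe]] := [elaborate fibre_power_lift se sbn Le'].
have cH (j : 'I_n) := [elaborate fibre_power_lift (smooth_mat_column j m0)
  (smooth_at_comp (smooth_mat_g j.+1 m0) (gr_tgt_smooth (vb_base V) _)) (Lc j)].
pose c' j := sval (cid (cH j)).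
have c'P j := svalP (cid (cH j)).
pose rho (m : MX n) : MX n := (m.1, (e' m, fun j => c' j m)).
have srho : smooth_at rho m0.
  apply: smooth_at_pair (smooth_at_fst m0) _; apply: smooth_at_pair => //.
  apply: (smooth_at_tuple (X := fun j : 'I_n => fibre_power (@core_proj R V) j.+1)).
  by move=> j; case: (c'P j).
apply: (retract_slice_chart Lm0 srho).
  have nc : anbhs m0 (fun m => forall (j : 'I_n) (i : 'I_j.+1),
      core_proj ((incl (c' j m) : forall i, core V) i) = t (mat_g m j.+1)).
    have H (j : 'I_n) : anbhs m0 (fun m => forall i : 'I_j.+1,
      core_proj ((incl (c' j m) : forall i, core V) i) = t (mat_g m j.+1)).
      by case: (c'P j).
    exact: filter_forall (anbhs_filter m0) H.
  apply: filterS2 Le1 nc => m He Hc; apply/layer_matricesP; split.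
    exact: Hc.
  by move=> i _; apply: He.
have nc : anbhs m0 (fun m => forall j : 'I_n, (forall i : 'I_j.+1,
    core_proj (mat_c m i) = t (mat_g m j.+1)) -> c' j m = mat_column m j).
  have H (j : 'I_n) : anbhs m0 (fun m => (forall i : 'I_j.+1,
    core_proj (mat_c m i) = t (mat_g m j.+1)) -> c' j m = mat_column m j).
    by case: (c'P j).
  exact: filter_forall (anbhs_filter m0) H.
apply: filterS2 fixe nc => m fe fc /layer_matricesP[Hc He].
rewrite /rho fe; last first.
  by move=> i; have := He i (ltn_ord i); rewrite /mat_e inord_val.
rewrite [RHS](surjective_pairing m) [in RHS](surjective_pairing m.2).
congr (_, (_, _)); apply: functional_extensionality_dep => j.
by rewrite fc //; apply: Hc.
Qed.

End LayerMatrices.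

(** * The bar layer and its matrix coordinates *)

Section Layers.
Variables (R : realType) (V : vb_groupoid R) (n : nat).
Local Notation M := (vbM V).
Local Notation G := (vbG V).
Local Notation E := (vbE V).
Local Notation Gam := (vbGam V).
Local Notation s := (gr_src (vb_base V)).
Local Notation t := (gr_tgt (vb_base V)).
Local Notation s' := (gr_src (vb_total V)).
Local Notation t' := (gr_tgt (vb_total V)).
Local Notation q := (vb_proj (vb_qE V)).
Local Notation qGam := (vb_proj (vb_qGam V)).
Local Notation MX := (matrix_space V n.+1).
Local Notation W := (bar_ambient (vb_double_sides V) n.+1).
Local Notation Tri := (triangle n.+1).

Variable sigma : E -> G -> Gam.
Hypothesis splits : is_splitting sigma.

#[local] Instance core_set_embedded : embedded_submanifold (@core_set R V) :=
  core_embedded splits.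

#[local] Instance core_liftable : liftable (@core_proj R V) :=
  core_proj_liftable splits.

#[local] Instance vb_source_bundle_liftable : liftable q := vector_bundle_liftable _.

#[local] Instance bar_premanifold : premanifold W.
Proof. exact: prod_premanifold. Qed.

Lemma tri_exists i j : (0 < i)%N -> (i <= j)%N -> (j <= n)%N ->
  exists p : Tri, tri_row p = i /\ tri_col p = j.
Proof.
move=> i0 ij jn.
have ir : (i < n.+1)%N by rewrite ltnS (leq_trans ij).
have jr : (j < n.+1)%N by [].
pose P (u : 'I_n.+1 * 'I_n.+1) := (0 < u.1)%N && (u.1 <= u.2)%N.
have H : P (Ordinal ir, Ordinal jr) by rewrite /P /= i0 ij.
by exists (exist P _ H).
Qed.

Lemma tri_eq (p p' : Tri) :
  tri_row p = tri_row p' -> tri_col p = tri_col p' -> p = p'.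
Proof.
move=> er ec; apply: val_inj; move: er ec; rewrite /tri_row /tri_col.
by case: (val p) (val p') => [a b] [a' b'] /= /val_inj -> /val_inj ->.
Qed.

Lemma tri_bounds (p : Tri) :
  [/\ (0 < tri_row p)%N, (tri_row p <= tri_col p)%N & (tri_col p <= n)%N].
Proof.
have /andP[p0 pc] := valP p; split=> //.
by rewrite -ltnS; apply: ltn_ord.
Qed.

(** The value [None] outside the triangle selects the two boundary entries of a bar configuration,
    [w.1] and [w.2.2], in [bar_g] and [bar_e]. *)
Definition tri_point (i j : nat) : option Tri :=
  [pick p : Tri | (tri_row p == i) && (tri_col p == j)].

Lemma tri_pointP (p : Tri) : tri_point (tri_row p) (tri_col p) = Some p.
Proof.
rewrite /tri_point; case: pickP => [p' /andP[/eqP er /eqP ec]|/(_ p)].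
  by congr Some; apply: tri_eq.
by rewrite !eqxx.
Qed.

Lemma tri_point_none i j : (i == 0)%N || (n < i)%N -> tri_point i j = None.
Proof.
move=> H; rewrite /tri_point; case: pickP => // p /andP[/eqP er /eqP ec].
have [p0 pc cn] := tri_bounds p; move: H; rewrite -er.
by rewrite eqn0Ngt p0 /= ltnNge (leq_trans pc cn).
Qed.

Section CorePoint.
Variables (j : 'I_n) (i : 'I_j.+1).

Lemma core_index_subproof : exists p : Tri,
  tri_row p = i.+1 /\ tri_col p = j.+1.
Proof. by apply: tri_exists => //; apply: ltn_ord. Qed.

Definition core_index : Tri := sval (cid core_index_subproof).

Lemma core_indexE : tri_row core_index = i.+1 /\ tri_col core_index = j.+1.
Proof. exact: (svalP (cid core_index_subproof)). Qed.

End CorePoint.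

Lemma core_index_surj (p : Tri) : exists (j : 'I_n) (i : 'I_j.+1),
  p = core_index i /\ (tri_row p = i.+1 /\ tri_col p = j.+1).
Proof.
have [p0 pc cn] := tri_bounds p.
have c0 := leq_trans p0 pc.
have j0 : ((tri_col p).-1 < n)%N by rewrite prednK.
have i0 : ((tri_row p).-1 < (Ordinal j0).+1)%N by rewrite /= !prednK.
exists (Ordinal j0), (Ordinal i0); have [er ec] := core_indexE (Ordinal i0).
have er' : tri_row p = (Ordinal i0).+1 by rewrite /= prednK.
have ec' : tri_col p = (Ordinal j0).+1 by rewrite /= prednK.
by split=> //; apply: tri_eq; rewrite ?er ?ec.
Qed.

(* Coordinates on the ambient space of the bar layer, which restrict to those of
   the corresponding matrix: g_k, e_(i+1) and c_(i+1, j+1). *)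
Definition bar_gamma (w : W) (p : Tri) : Gam := (w.2.1 : forall _ : Tri, Gam) p.

(** On the layer all entries of column [k] lie over the same arrow; off it a representative must be
    chosen, and the diagonal entry exists in every column. For [k = 0] the arrow is [w.1]. *)
Definition bar_g (w : W) (k : nat) : G :=
  if tri_point k k is Some p then qGam (bar_gamma w p) else w.1.

(** The source of the last entry in row [i.+1]; for [i = n] there is no such row and the vector is
    [w.2.2]. *)
Definition bar_e (w : W) (i : nat) : E :=
  if tri_point i.+1 n is Some p then s' (bar_gamma w p) else w.2.2.

Definition bar_c (w : W) (j : 'I_n) (i : 'I_j.+1) : core V :=
  core_point splits (bar_gamma w (core_index i)).

Lemma smooth_bar_gamma p : smooth_map (fun w : W => bar_gamma w p).
Proof.
move=> w; exact: (smooth_at_comp (smooth_at_comp (smooth_at_snd w)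
  (smooth_at_fst w.2))
  (smooth_at_proj (X := fun _ : Tri => manifold_space Gam) p w.2.1)).
Qed.

Lemma smooth_bar_g k : smooth_map (fun w : W => bar_g w k).
Proof.
move=> w; rewrite /bar_g; case: (tri_point k k) => [p|]; last exact: smooth_at_fst.
exact: (smooth_at_comp (smooth_bar_gamma p w) (vb_proj_smooth (vb_qGam V) _)).
Qed.

Lemma smooth_bar_e i : smooth_map (fun w : W => bar_e w i).
Proof.
move=> w; rewrite /bar_e; case: (tri_point i.+1 n) => [p|].
  exact: (smooth_at_comp (smooth_bar_gamma p w) (gr_src_smooth (vb_total V) _)).
exact: (smooth_at_comp (smooth_at_snd w) (smooth_at_snd w.2)).
Qed.

Lemma smooth_bar_c (j : 'I_n) (i : 'I_j.+1) : smooth_map (fun w : W => bar_c w i).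
Proof.
move=> w; exact: (smooth_at_comp (smooth_bar_gamma _ w) (smooth_core_point splits _)).
Qed.

(* The entry gamma_(i+1, n-k) is assembled from right to left, its source being
   the target of its right neighbour. *)
Definition mat_c_nat (m : MX) (i j : nat) : Gam :=
  if insub j is Some j' then incl (@mat_c R V n m j' (inord i))
  else vb_zero (vb_qGam V) (mat_g m 0).

(** Core columns are numbered from 1 in the matrix but from 0 in [mat_c], so column [n - k] has
    index [n.-1 - k]. *)
Fixpoint mat_gamma (m : MX) (i k : nat) : Gam :=
  assemble sigma (mat_c_nat m i (n.-1 - k)%N)
    (if k is k'.+1 then t' (mat_gamma m i k') else mat_e m i)
    (mat_g m (n - k)%N).

(** The source prescribed in [mat_gamma], under a name that makes the unfolding [mat_gammaE] uniform
    in [k]. *)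
Definition mat_src (m : MX) (i k : nat) : E :=
  if k is k'.+1 then t' (mat_gamma m i k') else mat_e m i.

Lemma mat_gammaE m i k : mat_gamma m i k =
  assemble sigma (mat_c_nat m i (n.-1 - k)%N) (mat_src m i k) (mat_g m (n - k)%N).
Proof. by case: k. Qed.

Definition bar_of_matrix (m : MX) : W :=
  (mat_g m 0, ((fun p : Tri => mat_gamma m (tri_row p).-1 (n - tri_col p)%N),
               mat_e m n)).

Lemma mat_c_natE (m : MX) (j : 'I_n) (i : 'I_j.+1) :
  mat_c_nat m i j = incl (mat_c m i).
Proof. by rewrite /mat_c_nat valK inord_val. Qed.

(** * From matrices to the bar layer *)

Section FromMatrix.
Variable m : MX.
Hypothesis Lm : layer_matrices m.

(** The bounds say that $(i+1,n-k)$ lies in the triangle, where [mat_c_nat] does not take its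
    default value. *)
Lemma mat_c_nat_core i k : (k < n)%N -> (i <= n.-1 - k)%N ->
  core_set (mat_c_nat m i (n.-1 - k)) /\
  s (qGam (mat_c_nat m i (n.-1 - k))) = t (mat_g m (n - k)).
Proof.
move=> kn ik.
have jn : (n.-1 - k < n)%N by lia.
have e := mat_c_natE m (Ordinal (ik : (i < (Ordinal jn).+1)%N)).
rewrite /= in e; rewrite e.
split; first exact: in_subspace.
have [Lc _] := (layer_matricesP m).1 Lm.
have := Lc _ (Ordinal (ik : (i < (Ordinal jn).+1)%N)).
rewrite /core_proj => ->; congr (t (mat_g m _)); rewrite /=; lia.
Qed.

(** The target of the right neighbour lies over the target of its arrow, which by composability is
    the source of the next arrow to the left. *)
Lemma mat_src_proj i k : (k < n)%N -> (i <= n.-1 - k)%N ->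
  q (mat_src m i k) = s (mat_g m (n - k)).
Proof.
elim: k => [|k IH] kn ik.
  rewrite subn0; have [_ Le] := (layer_matricesP m).1 Lm.
  by apply: Le; lia.
have kn' : (k < n)%N by exact: ltnW.
have ik' : (i <= n.-1 - k)%N by lia.
have [Cc cg] := mat_c_nat_core kn' ik'.
rewrite /= vb_qE_tgt mat_gammaE (assemble_proj splits) ?IH //.
rewrite (mat_g_composable m (k := n - k.+1)) ?subnSK //; lia.
Qed.

Let mat_gamma_ok i k : (k < n)%N -> (i <= n.-1 - k)%N ->
  [/\ core_set (mat_c_nat m i (n.-1 - k)),
      s (qGam (mat_c_nat m i (n.-1 - k))) = t (mat_g m (n - k)) &
      q (mat_src m i k) = s (mat_g m (n - k))].
Proof.
by move=> kn ik; have [? ?] := mat_c_nat_core kn ik; rewrite mat_src_proj.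
Qed.

Lemma mat_gamma_proj i k : (k < n)%N -> (i <= n.-1 - k)%N ->
  qGam (mat_gamma m i k) = mat_g m (n - k).
Proof.
by move=> kn ik; have [? ? ?] := mat_gamma_ok kn ik;
  rewrite mat_gammaE (assemble_proj splits).
Qed.

Lemma mat_gamma_src i k : (k < n)%N -> (i <= n.-1 - k)%N ->
  s' (mat_gamma m i k) = mat_src m i k.
Proof.
by move=> kn ik; have [? ? ?] := mat_gamma_ok kn ik;
  rewrite mat_gammaE (assemble_src splits).
Qed.

Lemma core_part_mat_gamma i k : (k < n)%N -> (i <= n.-1 - k)%N ->
  core_part sigma (mat_gamma m i k) = mat_c_nat m i (n.-1 - k).
Proof.
by move=> kn ik; have [? ? ?] := mat_gamma_ok kn ik;
  rewrite mat_gammaE (core_part_assemble splits).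
Qed.

Let tri_ok (p : Tri) :
  (n - tri_col p < n)%N /\ ((tri_row p).-1 <= n.-1 - (n - tri_col p))%N.
Proof. by have [p0 pc cn] := tri_bounds p; split; lia. Qed.

Lemma bar_gamma_proj p : qGam (bar_gamma (bar_of_matrix m) p) = mat_g m (tri_col p).
Proof.
have [kn ik] := tri_ok p; have [p0 pc cn] := tri_bounds p.
by rewrite [LHS]mat_gamma_proj // subKn.
Qed.

Lemma bar_of_matrix_bar_set : bar_set (bar_of_matrix m).
Proof.
have [Lc Le] := (layer_matricesP m).1 Lm.
rewrite /bar_set /=; split.
- by move=> [n0]; rewrite (Le n (leqnn n)); congr (s (mat_g m _)); rewrite n0.
- move=> p _ p1; have := bar_gamma_proj p; rewrite /bar_gamma /= => ->.
  rewrite p1; apply: mat_g_composable.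
  by have [_ _] := tri_bounds p; rewrite p1.
- move=> p p' rr cc; have [kn ik] := tri_ok p.
  have [p0 pc cn] := tri_bounds p; have [p0' pc' cn'] := tri_bounds p'.
  rewrite mat_gamma_src //.
  (* Counted from the right, the neighbour [p'] comes one place earlier, and [mat_src] at a
     successor is by definition the target found there. *)
  have -> : (n - tri_col p)%N = (n - tri_col p').+1 by rewrite cc in cn' *; lia.
  by rewrite rr.
- move=> p p' rr cc; have := bar_gamma_proj p; have := bar_gamma_proj p'.
  by rewrite /bar_gamma /= => -> ->; rewrite cc.
- move=> p rn cn; have [kn ik] := tri_ok p.
  rewrite vb_qE_src; have := bar_gamma_proj p; rewrite /bar_gamma /= => ->.
  by rewrite cn; apply: Le.
Qed.

Lemma bar_g_of_matrix k : (k <= n)%N -> bar_g (bar_of_matrix m) k = mat_g m k.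
Proof.
rewrite /bar_g; case: k => [|k] kn.
  by rewrite tri_point_none.
have [//|//|//|p [pr pc]] := @tri_exists k.+1 k.+1.
have := tri_pointP p; rewrite pr pc => ->.
by rewrite bar_gamma_proj pc.
Qed.

Lemma bar_e_of_matrix i : (i <= n)%N -> bar_e (bar_of_matrix m) i = mat_e m i.
Proof.
rewrite leq_eqVlt /bar_e => /orP[/eqP ->|i_n].
  by rewrite tri_point_none // ltnSn orbT.
have [//|//|//|p [pr pc]] := @tri_exists i.+1 n.
have := tri_pointP p; rewrite pr pc => ->.
have [kn ik] := tri_ok p.
rewrite [LHS](mat_gamma_src kn ik).
by rewrite pr pc subnn.
Qed.

Lemma bar_c_of_matrix (j : 'I_n) (i : 'I_j.+1) :
  bar_c (bar_of_matrix m) i = mat_c m i.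
Proof.
apply: val_inj; rewrite -[RHS]mat_c_natE /=.
have [er ec] := core_indexE i; have [kn ik] := tri_ok (core_index i).
rewrite [LHS](core_part_mat_gamma kn ik) er ec /=; congr mat_c_nat.
by have := ltn_ord j; lia.
Qed.

End FromMatrix.

(** * From the bar layer to matrices *)

Section FromLayer.
Variable w : W.
Hypothesis Bw : bar_set w.

Let clause1 : n = 0%N -> s w.1 = q w.2.2.
Proof. by move=> n0; case: Bw => + _ _ _ _; apply; rewrite n0. Qed.

Let clause2 (p : Tri) : tri_row p = 1%N -> tri_col p = 1%N ->
  s w.1 = t (qGam (bar_gamma w p)).
Proof. by case: Bw => _ + _ _ _; apply. Qed.

Let clause3 (p p' : Tri) : tri_row p' = tri_row p -> tri_col p' = (tri_col p).+1 ->
  s' (bar_gamma w p) = t' (bar_gamma w p').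
Proof. by case: Bw => _ _ + _ _; apply. Qed.

Let clause4 (p p' : Tri) : tri_row p' = (tri_row p).+1 -> tri_col p' = tri_col p ->
  qGam (bar_gamma w p) = qGam (bar_gamma w p').
Proof. by case: Bw => _ _ _ + _; apply. Qed.

Let clause5 (p : Tri) : tri_row p = n -> tri_col p = n ->
  q w.2.2 = q (s' (bar_gamma w p)).
Proof. by case: Bw => _ _ _ _; apply. Qed.

(** Vertical matching leads down the column, one row at a time, to the diagonal entry that defines
    [bar_g]; the induction is on the distance to it. *)
Lemma bar_column p : qGam (bar_gamma w p) = bar_g w (tri_col p).
Proof.
have [d] := ubnP (tri_col p - tri_row p); elim: d p => // d IH p.
have [p0 pc cn] := tri_bounds p; move: (pc); rewrite leq_eqVlt => /orP[/eqP e|lt].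
  by move=> _; rewrite /bar_g -{1}e tri_pointP.
have [//|//|//|p' [pr' pc']] := @tri_exists (tri_row p).+1 (tri_col p).
by rewrite ltnS => dE; rewrite (clause4 pr' pc') IH ?pc' // pr'; lia.
Qed.

(** For positive [k] this is horizontal matching of the entries $(k,k)$ and $(k,k+1)$, projected to
    the base; at [k = 0] it is the corner condition on [w.1]. *)
Lemma bar_g_composable k : (k < n)%N -> s (bar_g w k) = t (bar_g w k.+1).
Proof.
case: k => [|k] kn.
  have [//|//|//|p [pr pc]] := @tri_exists 1 1.
  by rewrite -pc -bar_column -(clause2 pr pc) /bar_g tri_point_none.
have [//|//||p [pr pc]] := @tri_exists k.+1 k.+1; first exact: ltnW.
have [//|//|//|p' [pr' pc']] := @tri_exists k.+1 k.+2.
rewrite -[in LHS]pc -bar_column -vb_qE_src (@clause3 p p') ?pr ?pc //.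
by rewrite vb_qE_tgt bar_column pc'.
Qed.

Lemma bar_e_proj i : (i <= n)%N -> q (bar_e w i) = s (bar_g w n).
Proof.
rewrite leq_eqVlt /bar_e => /orP[/eqP ->|i_n].
  rewrite tri_point_none ?ltnSn ?orbT //.
  have [n0|n_gt0] := posnP n.
    by rewrite -(clause1 n0) /bar_g tri_point_none // n0.
  have [//|//|//|p [pr pc]] := @tri_exists n n.
  by rewrite (clause5 pr pc) vb_qE_src bar_column pc.
have [//|//|//|p [pr pc]] := @tri_exists i.+1 n.
have := tri_pointP p; rewrite pr pc => ->.
by rewrite vb_qE_src bar_column pc.
Qed.

Lemma bar_c_proj (j : 'I_n) (i : 'I_j.+1) : core_proj (bar_c w i) = t (bar_g w j.+1).
Proof.
have [er ec] := core_indexE i.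
by rewrite /core_proj /= (core_part_proj splits) gr_src_unit bar_column ec.
Qed.

(** Any matrix with the coordinates of [w]. It is kept abstract because it is later built in two
    ways, smoothly near a point and at a single point. *)
Variable m : MX.
Hypothesis mg : forall k, (k <= n)%N -> mat_g m k = bar_g w k.
Hypothesis me : forall i, (i <= n)%N -> mat_e m i = bar_e w i.
Hypothesis mc : forall (j : 'I_n) (i : 'I_j.+1), mat_c m i = bar_c w i.

Lemma layer_matrices_of_bar : layer_matrices m.
Proof.
apply/layer_matricesP; split=> [j i|i i_n].
  by rewrite mc mg // bar_c_proj.
by rewrite me // mg // bar_e_proj.
Qed.

(** Both sides are assembled from the same core part, source and arrow. The sources agree by
    induction from the right, as each is the target of the right neighbour. *)
Lemma mat_gamma_of_bar (p : Tri) i k : tri_row p = i.+1 -> tri_col p = (n - k)%N ->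
  (k < n)%N -> mat_gamma m i k = bar_gamma w p.
Proof.
elim: k p => [|k IH] p pr pc kn; rewrite mat_gammaE -[RHS](assemble_core_part splits).
all: have [j [i' [pE [pr' pc']]]] := core_index_surj p.
all: rewrite mg ?leq_subr // -pc -bar_column.
all: rewrite (_ : (n.-1 - _)%N = j); last by lia.
all: have -> : i = i' :> nat by move: pr'; rewrite pr => -[].
all: have -> : mat_c_nat m i' j = core_part sigma (bar_gamma w p)
  by rewrite mat_c_natE mc pE.
  congr (assemble _ _ _ _); rewrite /mat_src me; last by have := ltn_ord i'; lia.
  have := tri_pointP p; rewrite /bar_e pc subn0 pr'.
  by move=> ->.
have i'k : i' = i :> nat by move: pr'; rewrite pr => -[].
have [p0 pcc cn] := tri_bounds p.
have [||| p' [pr1 pc1]] := @tri_exists i.+1 (n - k); try lia.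
rewrite /mat_src i'k (IH p') //; last exact: ltnW.
have -> // : s' (bar_gamma w p) = t' (bar_gamma w p').
by apply: clause3; rewrite ?pr1 ?pr // pc1 pc; lia.
Qed.

Lemma bar_of_matrixK : bar_of_matrix m = w.
Proof.
rewrite [RHS](surjective_pairing w) [w.2](surjective_pairing w.2).
congr (_, (_, _)).
- by rewrite mg // /bar_g tri_point_none.
- apply: functional_extensionality_dep => p.
  have [p0 pc cn] := tri_bounds p.
  apply: mat_gamma_of_bar; first by rewrite prednK.
    by rewrite subKn.
  by lia.
- by rewrite me // /bar_e tri_point_none // ltnSn orbT.
Qed.

End FromLayer.

(** * The diffeomorphism *)

Local Notation L := (induced_space (@layer_matrices R V n.+1)).

(** Assembling requires matching sources and targets, which the layer conditions guarantee; hence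
    the domain [L] rather than [MX]. *)
Lemma smooth_mat_gamma i k : (k < n)%N -> (i <= n.-1 - k)%N ->
  smooth_map (fun m : L => mat_gamma (incl m) i k).
Proof.
move=> + + m; have si := [elaborate smooth_at_incl m].
have sg j := [elaborate smooth_at_comp si (smooth_mat_g j _)].
elim: k => [|k IH] kn ik.
all: apply: (smooth_at_assemble splits).
- rewrite /mat_c_nat; case: insubP => [j _ jE|].
    exact: (smooth_at_comp (smooth_at_comp si (smooth_mat_c _ _)) (smooth_at_incl _)).
  by rewrite subn0 prednK // leqnn.
- exact: (smooth_at_comp si (smooth_mat_e i _)).
- exact: sg.
- apply: filterS filterT => x _; have Lx := in_subspace x.
  have [Cc cg] := mat_c_nat_core Lx kn ik.
  by have eg := mat_src_proj Lx kn ik.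
- rewrite /mat_c_nat; case: insubP => [j _ jE|]; last by lia.
  exact: (smooth_at_comp (smooth_at_comp si (smooth_mat_c _ _)) (smooth_at_incl _)).
- have IHk : smooth_at (fun m : L => mat_gamma (incl m) i k) m.
    by apply: IH; lia.
  exact: (smooth_at_comp IHk (gr_tgt_smooth (vb_total V) _)).
- exact: sg.
- apply: filterS filterT => x _; have Lx := in_subspace x.
  have [Cc cg] := mat_c_nat_core Lx kn ik.
  by have eg := mat_src_proj Lx kn ik.
Qed.

Lemma smooth_bar_of_matrix : smooth_map (fun m : L => bar_of_matrix (incl m)).
Proof.
move=> m; have si := [elaborate smooth_at_incl m].
have s0 := [elaborate smooth_at_comp si (smooth_mat_g 0 _)].
have sn := [elaborate smooth_at_comp si (smooth_mat_e n _)].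
apply: smooth_at_pair s0 _; apply: (smooth_at_pair _ sn).
apply: (smooth_at_tuple (X := fun _ : Tri => manifold_space Gam)) => p.
by have [p0 pc cn] := tri_bounds p; apply: smooth_mat_gamma; lia.
Qed.

(** The coordinates of [w] are smooth on all of [W], but their tuples satisfy the matching
    conditions only on the bar layer. Lifting each tuple to its subspace gives smooth maps with the
    right values there. *)
Lemma bar_of_matrix_local_inverse (m0 : L) : exists f : W -> L,
  smooth_at f (bar_of_matrix (incl m0)) /\
  anbhs (bar_of_matrix (incl m0)) (fun w => bar_set w -> bar_of_matrix (incl (f w)) = w).
Proof.
set w0 := bar_of_matrix _.
have Bw0 : bar_set w0 by apply: bar_of_matrix_bar_set; apply: in_subspace.
pose ag (w : W) : power_space 'I_n.+1 G := fun k => bar_g w k.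
pose ae (w : W) : power_space 'I_n.+1 E := fun k => bar_e w k.
pose ac (j : 'I_n) (w : W) : power_space 'I_j.+1 (core V) := fun i => bar_c w i.
have sag : smooth_at ag w0 by apply: smooth_at_tuple => k; apply: smooth_bar_g.
have sae : smooth_at ae w0 by apply: smooth_at_tuple => k; apply: smooth_bar_e.
have sac (j : 'I_n) : smooth_at (ac j) w0.
  by apply: smooth_at_tuple => i; apply: smooth_bar_c.
have Sg w : bar_set w -> forall i j : 'I_n.+1, j = i.+1 :> nat ->
    s ((ag w : forall k, G) i) = t ((ag w : forall k, G) j).
  move=> Bw i j ji; rewrite /ag ji; apply: bar_g_composable Bw _ _.
  by rewrite -ltnS -ji; apply: ltn_ord.
have Se w : bar_set w -> forall i j : 'I_n.+1,
    q ((ae w : forall k, E) i) = q ((ae w : forall k, E) j).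
  by move=> Bw i j; rewrite /ae !bar_e_proj // -ltnS; apply: ltn_ord.
have Sc (j : 'I_n) w : bar_set w -> forall i i' : 'I_j.+1,
    core_proj ((ac j w : forall k, core V) i) = core_proj ((ac j w : forall k, core V) i').
  by move=> Bw i i'; rewrite /ac !bar_c_proj.
have [fg [sfg nfg]] := [elaborate smooth_lift sag (Sg w0 Bw0)].
have [fe [sfe nfe]] := [elaborate smooth_lift sae (Se w0 Bw0)].
have fcH (j : 'I_n) := [elaborate smooth_lift (sac j) (Sc j w0 Bw0)].
pose fc j := sval (cid (fcH j)); have fcP j := svalP (cid (fcH j)).
pose fm (w : W) : MX := (fg w, (fe w, fun j => fc j w)).
have sfm : smooth_at fm w0.
  apply: smooth_at_pair sfg _; apply: smooth_at_pair sfe _.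
  apply: (smooth_at_tuple (X := fun j : 'I_n => fibre_power (@core_proj R V) j.+1)).
  by move=> j; case: (fcP j).
have nfc : anbhs w0 (fun w => forall j : 'I_n, bar_set w -> incl (fc j w) = ac j w).
  have H (j : 'I_n) : anbhs w0 (fun w => bar_set w -> incl (fc j w) = ac j w).
    by have [_] := fcP j; apply: filterS => w H Bw; apply: H; apply: Sc.
  exact: filter_forall (anbhs_filter w0) H.
have nfm : anbhs w0 (fun w => bar_set w ->
    layer_matrices (fm w) /\ bar_of_matrix (fm w) = w).
  apply: filterS3 nfg nfe nfc => w eg ee ec Bw.
  have mg k : (k <= n)%N -> mat_g (fm w) k = bar_g w k.
    by move=> kn; rewrite /mat_g /= (eg (Sg w Bw)) /ag inordK.
  have me k : (k <= n)%N -> mat_e (fm w) k = bar_e w k.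
    by move=> kn; rewrite /mat_e /= (ee (Se w Bw)) /ae inordK.
  have mc (j : 'I_n) (i : 'I_j.+1) : mat_c (fm w) i = bar_c w i.
    by rewrite /mat_c /mat_column /= (ec j Bw).
  split; first exact: (layer_matrices_of_bar Bw mg me mc).
  exact: (bar_of_matrixK Bw mg me mc).
(* The matrix [fm w] is known to satisfy the layer conditions only for [w] in the bar layer, so one
   more lift is made to land in [L]. *)
have [f [sf nf]] := [elaborate smooth_lift sfm (anbhs_singleton nfm Bw0).1].
exists f; split=> //; apply: filterS2 nf nfm => w e H Bw.
by have [Lw {2}<-] := H Bw; rewrite e.
Qed.

Lemma bar_of_matrix_inj : injective (fun m : L => bar_of_matrix (incl m)).
Proof.
move=> m m' e; have [Lm Lm'] := (in_subspace m, in_subspace m').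
apply: val_inj; apply: eq_matrix => [k kn|i i_n|j i].
- rewrite -[LHS](bar_g_of_matrix Lm kn) -[RHS](bar_g_of_matrix Lm' kn).
  by rewrite -/(incl m) e.
- rewrite -[LHS](bar_e_of_matrix Lm i_n) -[RHS](bar_e_of_matrix Lm' i_n).
  by rewrite -/(incl m) e.
- rewrite -[LHS](bar_c_of_matrix Lm i) -[RHS](bar_c_of_matrix Lm' i).
  by rewrite -/(incl m) e.
Qed.

(** At a single point of the bar layer the coordinates themselves form a matrix. *)
Lemma bar_of_matrix_surj (w : W) : bar_set w ->
  exists m : L, bar_of_matrix (incl m) = w.
Proof.
move=> Bw.
have Sg : [set g : power_space 'I_n.+1 G | forall i j : 'I_n.+1, j = i.+1 :> nat ->
    s (g i) = t (g j)] (fun k : 'I_n.+1 => bar_g w k).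
  move=> i j ji; rewrite ji; apply: bar_g_composable Bw _ _.
  by rewrite -ltnS -ji; apply: ltn_ord.
have Se : [set x : power_space 'I_n.+1 E | forall i j : 'I_n.+1, q (x i) = q (x j)]
    (fun k : 'I_n.+1 => bar_e w k).
  by move=> i j; rewrite !bar_e_proj // -ltnS; apply: ltn_ord.
have Sc (j : 'I_n) : [set x : power_space 'I_j.+1 (core V) | forall i i' : 'I_j.+1,
    core_proj (x i) = core_proj (x i')] (fun i => bar_c w i).
  by move=> i i'; rewrite !bar_c_proj.
pose m : MX := (SigSub (mem_set Sg), (SigSub (mem_set Se),
  fun j => SigSub (mem_set (Sc j)))).
have mg k : (k <= n)%N -> mat_g m k = bar_g w k.
  by move=> kn; rewrite -[in RHS](@inordK n k).
have me k : (k <= n)%N -> mat_e m k = bar_e w k.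
  by move=> kn; rewrite -[in RHS](@inordK n k).
have mc (j : 'I_n) (i : 'I_j.+1) : mat_c m i = bar_c w i by [].
have Lm := layer_matrices_of_bar Bw mg me mc.
by exists (SigSub (mem_set Lm)); exact: (bar_of_matrixK Bw mg me mc).
Qed.

Lemma bar_layer_diffeomorphic : embedded_submanifold (@layer_matrices R V n.+1) /\
  diffeomorphic (bar_layer (vb_double_sides V) n.+1) L.
Proof.
split; first exact: layer_matrices_embedded.
apply: (range_diffeomorphic smooth_bar_of_matrix bar_of_matrix_inj _
  bar_of_matrix_surj bar_of_matrix_local_inverse).2 => m.
by apply: bar_of_matrix_bar_set; apply: in_subspace.
Qed.

End Layers.

Theorem proposition5p1 (R : realType) (V : vb_groupoid R)
    (sigma : vbE V -> vbG V -> vbGam V)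
    (sigma_splitting : is_splitting sigma)
    (sigma_unital : is_unital sigma)
    (r : nat) (r_gt0 : (0 < r)%N) :
  embedded_submanifold (@layer_matrices R V r) /\
  diffeomorphic (bar_layer (vb_double_sides V) r)
                (induced_space (@layer_matrices R V r)).
Proof.
by case: r r_gt0 => // n _; apply: bar_layer_diffeomorphic sigma_splitting.
Qed.
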